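(* For edge-costs, undirected $a$-Based $D$-SNA admits a polynomial-time algorithm that, on any feasible instance, computes a feasible solution $I$ with $c(I)\le H(\Delta_k)\cdot\tau^*(\mathcal{F})$, where $\Delta_k=(4k-3)^2$, and with $c(I)\le H(2k-1)\cdot\tau^*(\mathcal{F})$ if $D$ is a star with center $s=a$; here $\mathcal{F}$ is the family of tight bisets.
   Context: $H(j)=\sum_{i=1}^j 1/i$. Undirected $a$-Based $D$-SNA with edge-costs: given an undirected graph $G=(V,E)$, node capacities $q_v\ge1$, a node $a$, a set $F$ of edges on $V$ all incident to $a$, nonnegative costs $c_e$ on $F$, and a set $D$ of demand pairs; find $I\subseteq F$ minimizing $c(I)=\sum_{e\in I}c_e$ with $\lambda^q_{G+I}(u,v)\ge\lambda^q_G(u,v)+1$ for all $uv\in D$, where $\lambda^q_H(u,v)$ is the maximum $u$–$v$ flow value with unit edge capacities and capacity $q_w$ on each node $w\notin\{u,v\}$. Set $r_{uv}=\lambda^q_G(u,v)+1$ and $k=\max_{uv\in D}r_{uv}$. A biset is a pair $\hat X=(X,X^+)$ with $X\subseteq X^+\subseteq V$; its boundary is $\Gamma(\hat X)=X^+\setminus X$. An edge covers $\hat X$ if one endnode is in $X$ and the other in $V\setminus X^+$; $\delta_J(\hat X)$ is the set of edges of $J$ covering $\hat X$. Let $r(\hat X)=\max\{r_{uv}:uv\in D \text{ covers }\hat X\}$ (or $0$ if none) and $h(\hat X)=\max\{r(\hat X)-(\sum_{w\in\Gamma(\hat X)}q_w+|\delta_E(\hat X)|),0\}$. A biset is tight if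 $h(\hat X)=1$; $\mathcal{F}$ is the family of tight bisets. $\tau^*(\mathcal{F})=\min\{\sum_{e\in F}c_ex_e: x\in\mathbb{R}^F,\ \sum_{e\in\delta_F(\hat Y)}x_e\ge1\ \forall\hat Y\in\mathcal{F},\ 0\le x_e\le1\}$. ''$D$ is a star with center $s$'' means every pair in $D$ contains $s$. *)

(* Defs.v *)
From HB Require Import structures.
From mathcomp Require Import all_boot all_order all_algebra.
From mathcomp Require Import all_classical all_reals all_analysis.
Import Order.TTheory GRing.Theory Num.Theory.
Import numFieldNormedType.Exports.

Set Implicit Arguments.
Unset Strict Implicit.
Unset Printing Implicit Defensive.

(* A graph on V is the list of its edges, each given by its two endnodes in an
   arbitrary order; an edge occurring several times is a bundle of parallel
   edges.  Adding edges to a graph is list concatenation. *)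
Section Flow.
Variables (V : finType) (E : seq (V * V)) (q : V -> nat) (u v : V).

(* (i, true) is the i-th edge directed from its first to its second endnode,
   (i, false) is the i-th edge directed the other way. *)
Definition arc : finType := ('I_(size E) * bool)%type.

Definition arc_tail (a : arc) : V :=
  let e := tnth (in_tuple E) a.1 in if a.2 then e.1 else e.2.

Definition arc_head (a : arc) : V :=
  let e := tnth (in_tuple E) a.1 in if a.2 then e.2 else e.1.

Definition inflow (f : {set arc}) (w : V) : nat :=
  #|[set a in f | arc_head a == w]|.

Definition outflow (f : {set arc}) (w : V) : nat :=
  #|[set a in f | arc_tail a == w]|.

(* All capacities are integers, so maximum flows are taken among integral flows;
   since edges have capacity one these are sets of arcs, the arcs that carry one
   unit.  An edge is used in at most one direction. *)
Definition is_flow (f : {set arc}) : bool :=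
  [forall i : 'I_(size E), ~~ (((i, true) \in f) && ((i, false) \in f))] &&
  [forall w : V, (w != u) && (w != v) ==>
     (inflow f w == outflow f w) && (inflow f w <= q w)].

(* The subtraction truncates flows of negative value to 0, which is harmless as
   the empty flow has value 0. *)
Definition flow_value (f : {set arc}) : nat := outflow f u - inflow f u.

Definition max_flow : nat := \max_(f : {set arc} | is_flow f) flow_value f.

End Flow.

Section Bisets.
Variable V : finType.
Implicit Types (X : {set V} * {set V}) (e : V * V).

Definition is_biset X : bool := X.1 \subset X.2.

Definition boundary X : {set V} := X.2 :\: X.1.

Definition covers e X : bool :=
  (e.1 \in X.1) && (e.2 \notin X.2) || (e.2 \in X.1) && (e.1 \notin X.2).

End Bisets.

(* Costs are rational so that an instance is a finite object. *)
Record instance := Instance {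
  nodes : nat;
  edges : seq ('I_nodes * 'I_nodes);
  cap : {ffun 'I_nodes -> nat};
  root : 'I_nodes;
  links : seq (('I_nodes * 'I_nodes) * rat);
  demands : seq ('I_nodes * 'I_nodes) }.

Definition incident (V : eqType) (a : V) (e : V * V) : bool :=
  (e.1 == a) || (e.2 == a).

Definition well_formed (P : instance) : bool :=
  [&& [forall w, 1 <= cap P w],
      all (fun e => e.1 != e.2) (edges P),
      all (fun l => [&& l.1.1 != l.1.2, incident (root P) l.1 & (0 <= l.2)%R])
          (links P)
    & all (fun d => d.1 != d.2) (demands P)].

Section Problem.
Variable P : instance.
Local Notation V := 'I_(nodes P).

Local Notation link := 'I_(size (links P)).

Definition ends (i : link) : V * V := (tnth (in_tuple (links P)) i).1.

Definition cost (i : link) : rat := (tnth (in_tuple (links P)) i).2.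

Definition total_cost (I : {set link}) : rat := (\sum_(i in I) cost i)%R.

Definition lambda (I : {set link}) (u v : V) : nat :=
  max_flow (edges P ++ [seq ends i | i <- enum I]) (cap P) u v.

Definition feasible (I : {set link}) : Prop :=
  forall d, d \in demands P -> lambda finset.set0 d.1 d.2 + 1 <= lambda I d.1 d.2.

Definition feasible_instance : Prop := exists I : {set link}, feasible I.

Definition req (d : V * V) : nat := lambda finset.set0 d.1 d.2 + 1.

Definition kmax : nat := \max_(d <- demands P) req d.

Definition biset_req (X : {set V} * {set V}) : nat :=
  \max_(d <- demands P | covers d X) req d.

(* Truncated subtraction is the maximum of the difference and 0. *)
Definition deficiency (X : {set V} * {set V}) : nat :=
  biset_req X -
  (\sum_(w in boundary X) cap P w + count (fun e => covers e X) (edges P)).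

Definition tight (X : {set V} * {set V}) : bool :=
  is_biset X && (deficiency X == 1).

Definition star_at_root : Prop :=
  forall d, d \in demands P -> incident (root P) d.

Section Relaxation.
Variable R : realType.
Local Open Scope ring_scope.
Local Open Scope classical_set_scope.

Definition fractional_cover : set 'rV[R]_(size (links P)) :=
  [set x | (forall i, 0 <= x 0 i <= 1) /\
           (forall Y, tight Y -> 1 <= \sum_(i : link | covers (ends i) Y) x 0 i)].

Definition fractional_cost (x : 'rV[R]_(size (links P))) : R :=
  \sum_(i : link) ratr (cost i) * x 0 i.

(* A minimum whenever a fractional cover exists, see [tau_star_min]. *)
Definition tau_star : R := inf (fractional_cost @` fractional_cover).

Lemma tau_star_min : fractional_cover !=set0 ->
  exists2 x, fractional_cover x & fractional_cost x = tau_star /\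
    forall y, fractional_cover y -> tau_star <= fractional_cost y.
Proof.
move=> ne.
have cx (i : link) : continuous (fun x : 'rV[R]_(size (links P)) => x 0 i).
  exact: coord_continuous.
have sum_continuous (Q : pred link) (g : link -> 'rV[R]_(size (links P)) -> R) :
    (forall i, Q i -> continuous (g i)) ->
    continuous (fun x => \sum_(i | Q i) g i x).
  by move=> cg; apply: continuous_big => //; exact: add_continuous.
have closed_cover : closed fractional_cover.
  rewrite (_ : fractional_cover =
      \bigcap_(i in [set: link])
        ([set x | 0 <= x 0 i] `&` [set x | x 0 i <= 1]) `&`
      \bigcap_(Y in [set Y | tight Y])
        [set x | 1 <= \sum_(i : link | covers (ends i) Y) x 0 i]).
    apply: closedI.
      apply: closed_bigI => i _; apply: closedI.
        by apply: (@preimage_closed _ _ (fun x : 'rV[R]_(size (links P)) => x 0 i)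
          [set y | 0 <= y]); [move=> x _; exact: cx|exact: closed_ge].
      by apply: (@preimage_closed _ _ (fun x : 'rV[R]_(size (links P)) => x 0 i)
          [set y | y <= 1]); [move=> x _; exact: cx|exact: closed_le].
    apply: closed_bigI => Y _.
    apply: (@preimage_closed _ _ (fun x : 'rV[R]_(size (links P)) =>
      \sum_(i : link | covers (ends i) Y) x 0 i) [set y | 1 <= y]).
      by move=> x _; apply: sum_continuous => i _; exact: cx.
    exact: closed_ge.
  apply/seteqP; split=> x /= [hx hY]; split=> //.
    by move=> i _ /=; have /andP[] := hx i.
  by move=> i; apply/andP; exact: hx i I.
have compact_cover : compact fractional_cover.
  apply: (subclosed_compact closed_cover
    (@rV_compact R _ (fun=> `[0%R, 1%R]%classic) (fun=> @segment_compact _ _ _))).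
  by move=> x [hx _] i /=; rewrite in_itv; exact: hx.
have cost_continuous : continuous fractional_cost.
  apply: (@sum_continuous predT (fun i x => ratr (cost i) * x 0 i)) => i _ y.
  exact: (continuous_comp (@cx i y) (@mulrl_continuous R (ratr (cost i)) _)).
have [x /set_mem xC xmin] := @compact_EVT_min _ R fractional_cost
  fractional_cover ne compact_cover (continuous_subspaceT cost_continuous).
have lbx : lbound (fractional_cost @` fractional_cover) (fractional_cost x).
  by move=> _ [y yC <-]; apply: xmin; apply/mem_set.
have ltau y : fractional_cover y -> tau_star <= fractional_cost y.
  by move=> yC; apply: ge_inf; [exists (fractional_cost x)|exists y].
exists x => //; split=> //; apply/eqP; rewrite eq_le ltau// andbT.
by apply: lb_le_inf => //; exists (fractional_cost x), x.
Qed.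

End Relaxation.
End Problem.

Definition harmonic_sum (R : realType) (j : nat) : R :=
  (\sum_(1 <= i < j.+1) i%:R^-1)%R.

(* Programs of a first-order, call-by-value functional language over binary
   trees.  Each rule of [evaluates] is one step of a pointer machine (values are
   shared, never copied), so that time is a unit cost that is polynomially
   related to Turing machine time; there are no primitive operations on
   numbers, which are processed bit by bit. *)
Inductive tree := Leaf | Branch (l r : tree).

Fixpoint tree_size (t : tree) : nat :=
  if t is Branch l r then (tree_size l + tree_size r).+1 else 1.

(* Variables are de Bruijn indices. *)
Inductive expr :=
| Var (i : nat)
| ELeaf
| EBranch (e1 e2 : expr)
| Let (e1 e2 : expr)
| Case (e e_leaf e_branch : expr)
| Call (f : nat) (e : expr).

(* A program is the list of the bodies of its unary, mutually recursive
   functions; execution starts with function 0. *)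
Definition program : Type := seq expr.

(* [evaluates A env e t n]: in the environment env, e evaluates to t in time n. *)
Inductive evaluates (A : program) : seq tree -> expr -> tree -> nat -> Prop :=
| eval_var env i : evaluates A env (Var i) (nth Leaf env i) 1
| eval_leaf env : evaluates A env ELeaf Leaf 1
| eval_branch env e1 e2 t1 t2 n1 n2 :
    evaluates A env e1 t1 n1 -> evaluates A env e2 t2 n2 ->
    evaluates A env (EBranch e1 e2) (Branch t1 t2) (n1 + n2).+1
| eval_let env e1 e2 t1 t2 n1 n2 :
    evaluates A env e1 t1 n1 -> evaluates A (t1 :: env) e2 t2 n2 ->
    evaluates A env (Let e1 e2) t2 (n1 + n2).+1
| eval_case_leaf env e e1 e2 t n n1 :
    evaluates A env e Leaf n -> evaluates A env e1 t n1 ->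
    evaluates A env (Case e e1 e2) t (n + n1).+1
| eval_case_branch env e e1 e2 l r t n n2 :
    evaluates A env e (Branch l r) n -> evaluates A (l :: r :: env) e2 t n2 ->
    evaluates A env (Case e e1 e2) t (n + n2).+1
| eval_call env f e t1 t2 n1 n2 :
    evaluates A env e t1 n1 -> evaluates A [:: t1] (nth ELeaf A f) t2 n2 ->
    evaluates A env (Call f e) t2 (n1 + n2).+1.

Lemma eval_det A env e t n t' n' :
  evaluates A env e t n -> evaluates A env e t' n' -> t = t' /\ n = n'.
Proof.
move=> ev; elim: ev t' n' => {env e t n}.
all: intros; match goal with
  | ev : evaluates _ _ ?e ?t ?n |- _ = ?t /\ _ = ?n => inversion ev; subst
  end.
all: repeat match goal with
  | IH : (forall t n, evaluates _ ?env ?e t n -> _),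
    ev : evaluates _ ?env ?e _ _ |- _ =>
      destruct (IH _ _ ev) as [h ?]; clear IH ev; try discriminate h;
      try (injection h as ? ?); subst
  end.
all: by [].
Qed.

Definition runs (A : program) (input output : tree) (n : nat) : Prop :=
  evaluates A [:: input] (nth ELeaf A 0) output n.

Definition enc_bool (b : bool) : tree := if b then Branch Leaf Leaf else Leaf.

Definition enc_seq (T : Type) (enc : T -> tree) (s : seq T) : tree :=
  foldr (fun x t => Branch (enc x) t) Leaf s.

Definition enc_pair (T1 T2 : Type) (enc1 : T1 -> tree) (enc2 : T2 -> tree)
  (p : T1 * T2) : tree := Branch (enc1 p.1) (enc2 p.2).

(* Binary notation, least significant bit first. *)
Fixpoint pos_bits (p : BinNums.positive) : seq bool :=
  match p with
  | BinNums.xH => [:: true]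
  | BinNums.xO p => false :: pos_bits p
  | BinNums.xI p => true :: pos_bits p
  end.

Definition enc_nat (n : nat) : tree :=
  enc_seq enc_bool (if bin_of_nat n is BinNums.Npos p then pos_bits p else [::]).

(* Only used for costs, which are nonnegative. *)
Definition enc_cost (c : rat) : tree :=
  Branch (enc_nat `|numq c|%N) (enc_nat `|denq c|%N).

Definition enc_ord (n : nat) (i : 'I_n) : tree := enc_nat i.

Definition enc_edge (n : nat) : 'I_n * 'I_n -> tree :=
  enc_pair (@enc_ord n) (@enc_ord n).

(* The number of nodes is the length of the list of capacities. *)
Definition enc_instance (P : instance) : tree :=
  Branch (enc_seq (@enc_edge (nodes P)) (edges P))
 (Branch (enc_seq enc_nat [seq cap P w | w <- enum 'I_(nodes P)])
 (Branch (enc_ord (root P))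
 (Branch (enc_seq (enc_pair (@enc_edge (nodes P)) enc_cost) (links P))
         (enc_seq (@enc_edge (nodes P)) (demands P))))).

(* A solution is output as its membership bits. *)
Definition enc_solution (P : instance) (I : {set 'I_(size (links P))}) : tree :=
  enc_seq enc_bool [seq i \in I | i <- enum 'I_(size (links P))].

(* Main.v *)
From mathcomp Require Import all_classical all_reals all_analysis.
From mathcomp Require Import all_boot all_order all_algebra.
From mathcomp Require Import zify ring.
Require Import Defs.

(* By Menger's theorem a set of links is feasible iff it covers all tight
   bisets.  A link between [v] and the root [a] covers a tight biset X with
   [a \notin X.2] iff [v \in X.1], and complementation reduces to such bisets, so
   feasible solutions are the hitting sets of the inclusion-minimal inner parts.
   The greedy algorithm finds one of cost at most H(D) times the optimum of the
   relaxation, by dual fitting, if every node lies in at most D of these parts.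

   If X_1, ..., X_m are tight for the pairs p_1, ..., p_m, with distinct minimal
   inner parts that contain a common node, then uncrossing shows that for i <> j
   a node of p_i lies in the boundary of X_j, or conversely.  Boundaries have at
   most k - 1 nodes.  Hence at most 2k - 1 of the pairs contain a given node t
   (their other nodes are distinct), which is the bound for stars, and
   m <= 2(k - 1)(2k - 1) + 1 <= (4k - 3)^2 in general.

   The least minimum cut separating u from v is the set of vertices reachable
   from u after reversing paths from u to v in the split digraph as long as there
   is one: each reversal lowers all cuts that separate u from v by exactly one. *)

Set Implicit Arguments.
Unset Strict Implicit.
Unset Printing Implicit Defensive.
Import Order.TTheory GRing.Theory Num.Theory.

(** * Polynomial-time computability *)

(** Only the analysis refers to [kmax P], to stars and to the relaxation; one algorithm serves both
    bounds. It inspects two candidates per demand, one for each orientation. Among the minimum cuts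
    of an orientation the least one has the least outer part as well as the least inner part. If its
    outer part contains the root, so does that of every minimum cut of this orientation; otherwise
    its inner part lies below all the others.

    Running time is that of an actual program over binary trees, so every list operation and every
    bit of arithmetic needs a program. Two dangers shape this half. Values are shared, so a fast
    program could build an exponentially large tree; the closure lemmas therefore carry a bound on
    the size of the output. Capacities are written in binary and may be exponential, so the number
    of parallel arcs that replace a node has to be capped.

    The algorithm never builds a flow: reversals alone yield the cut. Flows are constructed only for
    the proof of Menger's theorem, by the same search on other arcs, which is why the search is
    stated for arbitrary types of arcs. *)

Fixpoint rename (r : nat -> nat) (e : expr) : expr :=
  match e with
  | Var i => Var i
  | ELeaf => ELeaf
  | EBranch e1 e2 => EBranch (rename r e1) (rename r e2)
  | Let e1 e2 => Let (rename r e1) (rename r e2)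
  | Case e e1 e2 => Case (rename r e) (rename r e1) (rename r e2)
  | Call f e => Call (r f) (rename r e)
  end.

Definition embeds (A B : program) (r : nat -> nat) : Prop :=
  forall f, nth ELeaf B (r f) = rename r (nth ELeaf A f).

Lemma evaluates_embeds A B r env e t n :
  embeds A B r -> evaluates A env e t n -> evaluates B env (rename r e) t n.
Proof.
move=> AB; elim=> /=; try by econstructor; eauto.
move=> env' f e' t1 t2 n1 n2 _ ev1 _ ev2; apply: eval_call ev1 _.
by rewrite AB.
Qed.

Lemma embeds_call A B r env e t t' m n :
  embeds A B r -> runs A t t' m -> evaluates B env e t n ->
  evaluates B env (Call (r 0) e) t' (n + m).+1.
Proof.
move=> AB runA ev; apply: eval_call ev _.
by rewrite AB; exact: evaluates_embeds runA.
Qed.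

(** The body [e] is quantified last because it mentions the renamings. An index beyond the end of a
    program stands for [ELeaf], so each renaming sends such indices to [N], which lies beyond the
    end of [e :: C]. *)
Lemma embeds_three A1 A2 A3 : exists (C : program) (r1 r2 r3 : nat -> nat),
  forall e, [/\ embeds A1 (e :: C) r1, embeds A2 (e :: C) r2 & embeds A3 (e :: C) r3].
Proof.
pose N := (size A1 + size A2 + size A3).+1.
pose r1 f := if f < size A1 then f.+1 else N.
pose r2 f := if f < size A2 then (size A1 + f).+1 else N.
pose r3 f := if f < size A3 then (size A1 + size A2 + f).+1 else N.
exists (map (rename r1) A1 ++ map (rename r2) A2 ++ map (rename r3) A3), r1, r2, r3.
have big : nth ELeaf (map (rename r1) A1 ++ map (rename r2) A2 ++ map (rename r3) A3)
    (size A1 + size A2 + size A3) = ELeaf.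
  by rewrite nth_default// !size_cat !size_map addnA.
move=> e; split=> f; [rewrite [r1 f]/r1|rewrite [r2 f]/r2|rewrite [r3 f]/r3];
  (case: ltnP => h /=; last by rewrite big// [nth _ _ f]nth_default).
- by rewrite nth_cat size_map h (nth_map ELeaf).
- by rewrite !nth_cat !size_map ltnNge leq_addr /= addKn h (nth_map ELeaf).
- rewrite !nth_cat !size_map ltnNge -addnA leq_addr /= addKn.
  by rewrite ltnNge leq_addr /= addKn (nth_map ELeaf).
Qed.

Lemma tree_size_gt0 t : 0 < tree_size t.
Proof. by case: t. Qed.

(* Polynomial bounds are powers of the successor of the size, which is at
   least 2, so that a single exponent describes a bound. *)
Definition poly_bounded (X : Type) (i : X -> tree) (f : X -> nat) : Prop :=
  exists c, forall x, f x <= (tree_size (i x)).+1 ^ c.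

Section PolyBounded.
Variables (X : Type) (i : X -> tree).
Implicit Types f g : X -> nat.

Lemma poly_bounded_le f g :
  (forall x, f x <= g x) -> poly_bounded i g -> poly_bounded i f.
Proof. by move=> fg [c gc]; exists c => x; exact: leq_trans (gc x). Qed.

Lemma poly_bounded_const k : poly_bounded i (fun=> k).
Proof.
exists k => x; apply: leq_trans (ltnW (ltn_expl k (leqnn 2))) _.
by case: k => // k; rewrite leq_exp2r// ltnS tree_size_gt0.
Qed.

Lemma poly_bounded_size : poly_bounded i (fun x => tree_size (i x)).
Proof. by exists 1 => x; rewrite expn1. Qed.

Lemma poly_bounded_add f g :
  poly_bounded i f -> poly_bounded i g -> poly_bounded i (fun x => f x + g x).
Proof.
move=> [c fc] [d gd]; exists (maxn c d).+1 => x.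
have s2 : 1 < (tree_size (i x)).+1 by rewrite ltnS tree_size_gt0.
rewrite expnS; apply: leq_trans (leq_mul s2 (leqnn _)).
rewrite mul2n -addnn; apply: leq_add.
  by apply: leq_trans (fc x) _; rewrite leq_exp2l// leq_maxl.
by apply: leq_trans (gd x) _; rewrite leq_exp2l// leq_maxr.
Qed.

Lemma poly_bounded_mul f g :
  poly_bounded i f -> poly_bounded i g -> poly_bounded i (fun x => f x * g x).
Proof.
by move=> [c fc] [d gd]; exists (c + d) => x; rewrite expnD; exact: leq_mul.
Qed.

Lemma poly_bounded_exp f k :
  poly_bounded i f -> poly_bounded i (fun x => f x ^ k).
Proof.
by move=> [c fc]; exists (c * k) => x; rewrite expnM; case: k => // k; rewrite leq_exp2r.
Qed.

Lemma poly_boundedS f : poly_bounded i f -> poly_bounded i (fun x => (f x).+1).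
Proof.
move=> hf; apply: poly_bounded_le (poly_bounded_add hf (poly_bounded_const 1)).
by move=> x; rewrite addn1.
Qed.

Lemma poly_bounded_comp (j : X -> tree) f :
  poly_bounded i (fun x => tree_size (j x)) -> poly_bounded j f -> poly_bounded i f.
Proof.
move=> hj [c fc]; apply: poly_bounded_le fc _.
exact: poly_bounded_exp (poly_boundedS hj).
Qed.

End PolyBounded.

(* The uniform family of inputs [i x] and outputs [o x] is polynomial-time
   computable.  The size of the output needs its own bound since values are
   shared. *)
Definition tree_ptime (X : Type) (i o : X -> tree) : Prop :=
  exists (A : program) (T : X -> nat),
    [/\ forall x, runs A (i x) (o x) (T x), poly_bounded i T
      & poly_bounded i (fun x => tree_size (o x))].

Section TreePtime.
Variable X : Type.
Implicit Types i o : X -> tree.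

Lemma tree_ptime_ext i o o' : o =1 o' -> tree_ptime i o -> tree_ptime i o'.
Proof.
move=> eo [A [T [run bT bo]]]; exists A, T; split=> //.
  by move=> x; rewrite -eo; exact: run.
by apply: poly_bounded_le bo => x; rewrite eo.
Qed.

Lemma tree_ptime_dom (Y : Type) (g : Y -> X) i o :
  tree_ptime i o -> tree_ptime (i \o g) (o \o g).
Proof.
move=> [A [T [run [c bT] [d bo]]]]; exists A, (T \o g); split.
- by move=> y; exact: run.
- by exists c => y; exact: bT.
- by exists d => y; exact: bo.
Qed.

Lemma tree_ptime_id i : tree_ptime i i.
Proof.
exists [:: Var 0], (fun=> 1); split.
- by move=> x; exact: eval_var.
- exact: poly_bounded_const.
- exact: poly_bounded_size.
Qed.

Lemma tree_ptime_const i t : tree_ptime i (fun=> t).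
Proof.
pose fix quote t := if t is Branch l r then EBranch (quote l) (quote r) else ELeaf.
exists [:: quote t], (fun=> tree_size t); split; try exact: poly_bounded_const.
have quoteP A env u : evaluates A env (quote u) u (tree_size u).
  by elim: u => [|l IHl r IHr] /=; [exact: eval_leaf|exact: eval_branch].
by move=> x; exact: quoteP.
Qed.

Lemma tree_ptime_comp i m o : tree_ptime i m -> tree_ptime m o -> tree_ptime i o.
Proof.
move=> [A [S [runA bS bm]]] [B [T [runB bT bo]]].
have [C [r1 [r2 [r3 emb]]]] := embeds_three A B [::].
pose e := Call (r2 0) (Call (r1 0) (Var 0)).
have [eA eB _] := emb e.
exists (e :: C), (fun x => ((1 + S x).+1 + T x).+1); split.
- move=> x; apply: (embeds_call eB (runB x)); apply: (embeds_call eA (runA x)).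
  exact: eval_var.
- apply: poly_boundedS; apply: poly_bounded_add; last exact: poly_bounded_comp bT.
  by apply: poly_boundedS; apply: poly_bounded_add => //; exact: poly_bounded_const.
- exact: poly_bounded_comp bo.
Qed.

Lemma tree_ptime_branch i o1 o2 : tree_ptime i o1 -> tree_ptime i o2 ->
  tree_ptime i (fun x => Branch (o1 x) (o2 x)).
Proof.
move=> [A [S [runA bS bo1]]] [B [T [runB bT bo2]]].
have [C [r1 [r2 [r3 emb]]]] := embeds_three A B [::].
pose e := EBranch (Call (r1 0) (Var 0)) (Call (r2 0) (Var 0)).
have [eA eB _] := emb e.
exists (e :: C), (fun x => ((1 + S x).+1 + (1 + T x).+1).+1); split.
- move=> x; apply: eval_branch.
    by apply: (embeds_call eA (runA x)); exact: eval_var.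
  by apply: (embeds_call eB (runB x)); exact: eval_var.
- by do ![assumption | exact: poly_bounded_const | apply: poly_bounded_add | apply: poly_boundedS].
- by apply: poly_boundedS; exact: poly_bounded_add.
Qed.

Lemma tree_ptime_left i (l r : X -> tree) :
  tree_ptime i (fun x => Branch (l x) (r x)) -> tree_ptime i l.
Proof.
move=> h; apply: tree_ptime_comp h _.
exists [:: Case (Var 0) ELeaf (Var 0)], (fun=> 3); split.
- by move=> x; apply: (@eval_case_branch _ _ _ _ _ (l x) (r x) _ 1 1);
    [exact: (eval_var _ _ 0)|exact: (eval_var _ _ 0)].
- exact: poly_bounded_const.
- apply: poly_bounded_le (poly_bounded_size _) => x /=; lia.
Qed.

Lemma tree_ptime_right i (l r : X -> tree) :
  tree_ptime i (fun x => Branch (l x) (r x)) -> tree_ptime i r.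
Proof.
move=> h; apply: tree_ptime_comp h _.
exists [:: Case (Var 0) ELeaf (Var 1)], (fun=> 3); split.
- by move=> x; apply: (@eval_case_branch _ _ _ _ _ (l x) (r x) _ 1 1);
    [exact: (eval_var _ _ 0)|exact: (eval_var _ _ 1)].
- exact: poly_bounded_const.
- apply: poly_bounded_le (poly_bounded_size _) => x /=; lia.
Qed.

End TreePtime.

(** The leaf case continues on the same input, the branch case with the two subtrees added to it.
    The inputs of the latter are indexed by a type [Z] of their own, since they exist only for those
    [x] where [a x] is a branch. *)
Lemma tree_ptime_case (X Z : Type) (i a o o1 : X -> tree) (iz oz : Z -> tree) :
  tree_ptime i a -> tree_ptime i o1 -> tree_ptime iz oz ->
  (forall x, a x = Leaf -> o x = o1 x) ->
  (forall x l r, a x = Branch l r -> exists2 z, iz z = Branch (i x) (Branch l r) & oz z = o x) ->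
  tree_ptime i o.
Proof.
move=> [A [TA [runA bA ba]]] [B1 [T1 [run1 b1 bo1]]] [B2 [T2 [run2 [c2 b2] [d2 bo2]]]] oL oB.
have [C [r1 [r2 [r3 emb]]]] := embeds_three A B1 B2.
pose e := Case (Call (r1 0) (Var 0)) (Call (r2 0) (Var 0))
  (Call (r3 0) (EBranch (Var 2) (EBranch (Var 0) (Var 1)))).
have [eA e1 e2] := emb e.
(* If [a x] is [Branch l r], this is one more than the size of the input [Branch (i x) (Branch l r)]
   of the branch case. *)
pose s x := (tree_size (i x) + tree_size (a x)).+2.
have bs : poly_bounded i s.
  do 2! apply: poly_boundedS; apply: poly_bounded_add => //; exact: poly_bounded_size.
have key x : exists n, [/\ runs (e :: C) (i x) (o x) n,
    n <= (1 + TA x).+1 + ((1 + T1 x).+1 + s x ^ c2 + 6) &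
    tree_size (o x) <= tree_size (o1 x) + s x ^ d2].
  have runAx := runA x.
  case E : (a x) runAx => [|l r] runAx.
    exists ((1 + TA x).+1 + (1 + T1 x).+1).+1; split.
    - apply: eval_case_leaf.
        by apply: (embeds_call eA runAx); exact: eval_var.
      by rewrite oL//; apply: (embeds_call e1 (run1 x)); exact: eval_var.
    - lia.
    - rewrite oL//; lia.
  have [z iz_z oz_z] := oB _ _ _ E.
  exists ((1 + TA x).+1 + (5 + T2 z).+1).+1; split.
  - apply: eval_case_branch.
      by apply: (embeds_call eA runAx); exact: eval_var.
    apply: (embeds_call e2); first by rewrite -oz_z; exact: run2.
    rewrite iz_z; apply: (@eval_branch _ _ _ _ _ _ 1 3); first exact: eval_var.
    by apply: (@eval_branch _ _ _ _ _ _ 1 1); exact: eval_var.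
  - have := b2 z; rewrite iz_z /= -/(tree_size _).
    have -> : (tree_size (i x) + (tree_size l + tree_size r).+1).+2 = s x by rewrite /s E.
    lia.
  - have := bo2 z; rewrite iz_z oz_z /=.
    have -> : (tree_size (i x) + (tree_size l + tree_size r).+1).+2 = s x by rewrite /s E.
    lia.
have [T hT] := boolp.choice key.
exists (e :: C), T; split.
- by move=> x; have [] := hT x.
- apply: (@poly_bounded_le _ _ _ (fun x => (1 + TA x).+1 + ((1 + T1 x).+1 + s x ^ c2 + 6))).
    by move=> x; have [] := hT x.
  by do ![assumption | exact: poly_bounded_exp bs | exact: poly_bounded_const |
    apply: poly_bounded_add | apply: poly_boundedS].
- apply: (@poly_bounded_le _ _ _ (fun x => tree_size (o1 x) + s x ^ d2)).
    by move=> x; have [] := hT x.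
  by apply: poly_bounded_add => //; exact: poly_bounded_exp.
Qed.

Structure encType := EncType { enc_sort :> Type; enc : enc_sort -> tree }.
Canonical bool_encType := EncType enc_bool.
Canonical nat_encType := EncType enc_nat.
Canonical prod_encType (T U : encType) := EncType (enc_pair (@enc T) (@enc U)).
Canonical seq_encType (T : encType) := EncType (enc_seq (@enc T)).

Definition esize (T : encType) (x : T) : nat := tree_size (enc x).

Definition ptime (X Y : encType) (f : X -> Y) : Prop :=
  tree_ptime (@enc X) (fun x => enc (f x)).

Lemma esize_cons (T : encType) (x : T) s : esize (x :: s) = (esize x + esize s).+1.
Proof. by []. Qed.

Lemma esize_pair (T U : encType) (x : T) (y : U) :
  esize (x, y) = (esize x + esize y).+1.
Proof. by []. Qed.

Lemma esize_gt0 (T : encType) (x : T) : 0 < esize x.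
Proof. exact: tree_size_gt0. Qed.

Lemma size_le_esize (T : encType) (s : seq T) : size s < esize s.
Proof. by elim: s => //= x s IH; rewrite esize_cons; lia. Qed.

(* The parameter [x] may change along the list, as carries and counters do.  The
   bound on the growth of the result keeps the intermediate values polynomial. *)
Lemma ptime_rec (X Y S : encType) (R : X -> seq Y -> S)
    (nx : X * Y -> X) (F : (X * Y) * (seq Y * S) -> S) (K : nat)
    (B : X * (Y * seq Y) -> nat) :
  ptime (fun x => R x [::]) -> ptime nx -> ptime F -> poly_bounded (@enc _) B ->
  (forall x y l, R x (y :: l) = F ((x, y), (l, R (nx (x, y)) l))) ->
  (forall x y, esize (nx (x, y)) <= esize x + K * esize y) ->
  (forall x y l, esize (R x (y :: l)) <=
     esize (R (nx (x, y)) l) + B (x, (y, l))) ->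
  ptime (fun p : X * seq Y => R p.1 p.2).
Proof.
move=> [A [T1 [run1 [c1 b1] [d1 bo1]]]] [A' [T2 [run2 [c2 b2] _]]] [C [T3 [run3 [c3 b3] _]]].
move=> [c Bc] Rcons nx_size R_size.
have {}R_size x y l : esize (R x (y :: l)) <=
    esize (R (nx (x, y)) l) + (esize x + esize y + esize l).+1 ^ (2 * c).
  apply: leq_trans (R_size x y l) _; rewrite leq_add2l.
  apply: leq_trans (Bc _) _; rewrite -/(esize (x, (y, l))) !esize_pair expnM.
  case: (c) => // k; rewrite leq_exp2r// -mulnn.
  have := esize_gt0 x; have := esize_gt0 y; have := esize_gt0 l; nia.
move: (2 * c) R_size => {Bc}c R_size.
have [D [r1 [r2 [r3 emb]]]] := embeds_three A A' C.
pose e := Case (Var 0) ELeaf (Case (Var 1) (Call (r1 0) (Var 0))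
  (Call (r3 0) (EBranch (EBranch (Var 2) (Var 0)) (EBranch (Var 1)
    (Call 0 (EBranch (Call (r2 0) (EBranch (Var 2) (Var 0))) (Var 1))))))).
have [eA eB eC] := emb e.
(* The constants 6 and 18 count the steps that the body [e] itself takes for an empty and for a
   nonempty list. *)
pose fix T (x : X) (l : seq Y) : nat :=
  if l is y :: l' then
    (T (nx (x, y)) l') + T2 (x, y) + T3 ((x, y), (l', R (nx (x, y)) l')) + 18
  else T1 x + 6.
have runT x l : runs (e :: D) (enc (x, l)) (enc (R x l)) (T x l).
  elim: l x => [|y l IH] x.
    rewrite /= (_ : T1 x + 6 = (1 + (1 + (1 + T1 x).+1).+1).+1); last by lia.
    apply: (@eval_case_branch _ _ _ _ _ (enc x) Leaf); first exact: (eval_var _ _ 0).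
    apply: eval_case_leaf; first exact: (eval_var _ _ 1).
    by apply: (embeds_call eA (run1 x)); exact: (eval_var _ _ 0).
  rewrite /= Rcons; set s := R _ l; set t3 := T3 _.
  rewrite (_ : _ + 18 = (1 + (1 + (((1 + 1).+1 + (1 + ((((1 + 1).+1 + T2 (x, y)).+1 + 1).+1 +
    T (nx (x, y)) l).+1).+1).+1 + t3).+1).+1).+1); last by lia.
  apply: (@eval_case_branch _ _ _ _ _ (enc x) (enc (y :: l))); first exact: (eval_var _ _ 0).
  apply: (@eval_case_branch _ _ _ _ _ (enc y) (enc l)); first exact: (eval_var _ _ 1).
  apply: (embeds_call eC (run3 _)); apply: eval_branch.
    by apply: eval_branch; [exact: (eval_var _ _ 2)|exact: (eval_var _ _ 0)].
  apply: eval_branch; first exact: (eval_var _ _ 1).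
  apply: eval_call (IH _); apply: eval_branch; last exact: (eval_var _ _ 1).
  apply: (embeds_call eB (run2 _)).
  by apply: eval_branch; [exact: (eval_var _ _ 2)|exact: (eval_var _ _ 0)].
(* A potential that never increases along the recursion: the growth of the parameter by
   [K * esize y] is paid by the removal of [y] from the list. It bounds the size of every later
   parameter and list, so all levels can be estimated in terms of an initial bound [M]. *)
pose mu (x : X) (l : seq Y) := esize x + K.+1 * esize l.
have muS x y l : mu (nx (x, y)) l <= mu x (y :: l).
  by have := nx_size x y; rewrite /mu esize_cons mulnS mulnDr [K.+1 * esize y]mulSn; lia.
have muC x y l : esize x + esize y + esize l <= mu x (y :: l).
  rewrite /mu esize_cons mulSn; lia.
have leX M N k : M <= N -> M.+1 ^ k <= N.+1 ^ k.
  by move=> MN; case: k => // k; rewrite leq_exp2r.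
have sizeR M x l : mu x l <= M ->
    esize (R x l) <= M.+1 ^ d1 + size l * M.+1 ^ c.
  elim: l x => [|y l IH] x hM.
    rewrite mul0n addn0; apply: leq_trans (bo1 x) (leX _ _ _ _).
    by move: hM; rewrite /mu /esize; lia.
  apply: leq_trans (R_size x y l) _.
  have /= := IH _ (leq_trans (muS x y l) hM).
  have := leX _ _ c (leq_trans (muC x y l) hM).
  by rewrite mulSn; lia.
(* [Rb M] bounds every intermediate result, and [Q M] the time spent on one level. *)
pose Rb M := M.+1 ^ d1 + M * M.+1 ^ c.
pose Q M := M.+1 ^ c1 + M.+1 ^ c2 + (M + Rb M).+4 ^ c3 + 18.
have timeT M x l : mu x l <= M -> T x l <= (size l).+1 * Q M.
  elim: l x => [|y l IH] x hM /=.
    have := leq_trans (b1 x) (leX (esize x) M c1 _).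
    by rewrite mul1n /Q; move: hM; rewrite /mu /esize; lia.
  have hM' := leq_trans (muS x y l) hM.
  have /= {IH} := IH _ hM'.
  have {sizeR} := sizeR _ _ _ hM'.
  have hl : size l <= M by have := size_le_esize l; have := muC x y l; lia.
  have := b2 (x, y); have := b3 (x, y, (l, R (nx (x, y)) l)).
  rewrite -/(esize (x, y)) -/(esize (x, y, (l, R (nx (x, y)) l))) !esize_pair.
  set s := esize (R _ _) => h3 h2 hs hT.
  have hxyl := leq_trans (muC x y l) hM.
  have {}h2 := leq_trans h2 (leX _ M c2 _).
  have {}hs : s <= Rb M.
    by apply: leq_trans hs _; rewrite /Rb leq_add2l leq_mul2r hl orbT.
  have {}h3 := leq_trans h3 (leX _ (M + Rb M).+3 c3 _).
  rewrite mulSn; move: hT; set q := (size l).+1 * Q M => hT.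
  have l0 := esize_gt0 l.
  have {}h2 := h2 ltac:(lia); have {}h3 := h3 ltac:(lia).
  rewrite /Q; lia.
have bmu : poly_bounded (@enc (prod_encType X (seq_encType Y))) (fun p => mu p.1 p.2).
  apply: (@poly_bounded_le _ _ _ (fun p => K.+2 * esize p)).
    by case=> x l; rewrite /mu esize_pair /=; nia.
  by apply: poly_bounded_mul; [exact: poly_bounded_const|exact: poly_bounded_size].
have bsz : poly_bounded (@enc (prod_encType X (seq_encType Y))) (fun p => size p.2).
  apply: (poly_bounded_le _ (poly_bounded_size _)) => -[x l].
  by have := size_le_esize l; rewrite -/(esize (x, l)) esize_pair /=; lia.
have bX k : poly_bounded (@enc (prod_encType X (seq_encType Y))) (fun p => (mu p.1 p.2).+1 ^ k).
  by apply: poly_bounded_exp; exact: poly_boundedS.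
exists (e :: D), (fun p => T p.1 p.2); split.
- by case=> x l; exact: runT.
- apply: (@poly_bounded_le _ _ _ (fun p : X * seq Y => (size p.2).+1 * Q (mu p.1 p.2))).
    by move=> p; exact: timeT.
  apply: poly_bounded_mul; first exact: poly_boundedS.
  apply: poly_bounded_add; last exact: poly_bounded_const.
  apply: poly_bounded_add; first exact: poly_bounded_add.
  apply: poly_bounded_exp; do 4! apply: poly_boundedS.
  by apply: poly_bounded_add => //; apply: poly_bounded_add => //; exact: poly_bounded_mul.
- apply: (@poly_bounded_le _ _ _ (fun p : X * seq Y =>
      (mu p.1 p.2).+1 ^ d1 + size p.2 * (mu p.1 p.2).+1 ^ c)).
    by move=> p; exact: sizeR.
  by apply: poly_bounded_add => //; exact: poly_bounded_mul.
Qed.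

(** * Binary arithmetic *)

Section Closure.
Variables X Y Z : encType.

Lemma ptime_ext (f g : X -> Y) : f =1 g -> ptime f -> ptime g.
Proof. by move=> fg; apply: tree_ptime_ext => x; rewrite fg. Qed.

Lemma ptime_recode (f : X -> Y) (g : X -> Z) :
  (forall x, enc (f x) = enc (g x)) -> ptime f -> ptime g.
Proof. exact: tree_ptime_ext. Qed.

Lemma ptime_id : ptime (fun x : X => x).
Proof. exact: tree_ptime_id. Qed.

Lemma ptime_const (y : Y) : ptime (fun _ : X => y).
Proof. exact: tree_ptime_const. Qed.

Lemma ptime_comp (f : X -> Y) (g : Y -> Z) : ptime f -> ptime g -> ptime (fun x => g (f x)).
Proof. by move=> pf pg; apply: tree_ptime_comp pf _; exact: (tree_ptime_dom f pg). Qed.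

Lemma ptime_pair (f : X -> Y) (g : X -> Z) : ptime f -> ptime g -> ptime (fun x => (f x, g x)).
Proof. exact: tree_ptime_branch. Qed.

Lemma ptime_fst (f : X -> Y * Z) : ptime f -> ptime (fun x => (f x).1).
Proof. exact: tree_ptime_left. Qed.

Lemma ptime_snd (f : X -> Y * Z) : ptime f -> ptime (fun x => (f x).2).
Proof. exact: tree_ptime_right. Qed.

Lemma ptime_cons (f : X -> Y) (g : X -> seq Y) : ptime f -> ptime g -> ptime (fun x => f x :: g x).
Proof. exact: tree_ptime_branch. Qed.

Lemma ptime_if (b : X -> bool) (f g : X -> Y) :
  ptime b -> ptime f -> ptime g -> ptime (fun x => if b x then f x else g x).
Proof.
move=> pb pf pg; apply: (tree_ptime_case (iz := fun x => Branch (enc x) (enc (b x)))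
  (oz := fun x => enc (f x)) pb pg).
- exact: (tree_ptime_comp (tree_ptime_left (tree_ptime_id _)) pf).
- by move=> x; case: (b x).
- by move=> x l r; case E: (b x) => // -[<- <-]; exists x; rewrite /= ?E.
Qed.

Lemma ptime_match (l : X -> seq Y) (g : X -> Z) (f : X * (Y * seq Y) -> Z) :
  ptime l -> ptime g -> ptime f ->
  ptime (fun x => if l x is y :: l' then f (x, (y, l')) else g x).
Proof.
move=> pl pg pf; apply: (tree_ptime_case pl pg pf).
- by move=> x; case: (l x).
- by move=> x a b; case: (l x) => // y l' [<- <-]; exists (x, (y, l')).
Qed.

Lemma ptime_esize (f : X -> Y) : ptime f -> poly_bounded (@enc X) (fun x => esize (f x)).
Proof. by case=> A [T []]. Qed.

End Closure.

(** The parameter never changes here, hence [K := 0]. The bound [B] may depend on the element and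
    the rest of the list but not on the accumulator, so that growth adds up instead of
    compounding. *)
Lemma ptime_foldr (X Y Z : encType) (l : X -> seq Y) (s0 : X -> Z) (f : X -> Y -> Z -> Z)
    (B : X * (Y * seq Y) -> nat) :
  ptime l -> ptime s0 -> poly_bounded (@enc _) B ->
  ptime (fun p : X * (Y * Z) => f p.1 p.2.1 p.2.2) ->
  (forall x y l', esize (f x y (foldr (f x) (s0 x) l')) <=
     esize (foldr (f x) (s0 x) l') + B (x, (y, l'))) ->
  ptime (fun x => foldr (f x) (s0 x) (l x)).
Proof.
move=> pl ps bB pf hc.
suff h : ptime (fun p : X * seq Y => foldr (f p.1) (s0 p.1) p.2).
  exact: (ptime_comp (f := fun x => (x, l x)) (ptime_pair (@ptime_id X) pl) h).
apply: (ptime_rec (R := fun x l => foldr (f x) (s0 x) l) (nx := fst) (K := 0)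
  (F := fun p => f p.1.1 p.1.2 p.2.2) ps _ _ bB _ _ hc) => //.
- exact: ptime_fst (@ptime_id _).
- apply: (ptime_comp (f := fun p : (X * Y) * (seq Y * Z) => (p.1.1, (p.1.2, p.2.2))) _ pf).
  by apply: ptime_pair; [|apply: ptime_pair]; do ![apply: ptime_fst|apply: ptime_snd|apply: ptime_id].
- by move=> x y; rewrite mul0n addn0.
Qed.

Lemma ptime_comp2 (X Y Z T : encType) (f : X -> Y) (g : X -> Z) (h : Y -> Z -> T) :
  ptime (fun p : Y * Z => h p.1 p.2) -> ptime f -> ptime g -> ptime (fun x => h (f x) (g x)).
Proof.
by move=> ph pf pg; exact: (ptime_comp (Y := prod_encType Y Z) (ptime_pair pf pg) ph).
Qed.

Lemma ptime_program (X Y : encType) (f : X -> Y) : ptime f ->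
  exists (A : program) (c : nat), forall x, exists n,
    runs A (enc x) (enc (f x)) n /\ n <= (tree_size (enc x)).+1 ^ c.
Proof.
by case=> A [T [run [c bT] _]]; exists A, c => x; exists (T x); split.
Qed.

(* Higher-order unification in the lemmas below fails if it unfolds [ptime]. *)
#[global] Opaque ptime.

Ltac ptime_step := lazymatch goal with
  | |- ptime (fun x => x) => apply: ptime_id
  | |- ptime (fun x => (_, _)) => apply: ptime_pair
  | |- ptime (fun x => _.1) => apply: ptime_fst
  | |- ptime (fun x => _.2) => apply: ptime_snd
  | |- ptime fst => exact: ptime_fst (@ptime_id _)
  | |- ptime snd => exact: ptime_snd (@ptime_id _)
  | |- ptime (fun x => _ :: _) => apply: ptime_cons
  | |- ptime (fun x => if _ then _ else _) => apply: ptime_if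
  | _ => first [assumption | apply: ptime_const]
  end.
Ltac ptime_tac := repeat ptime_step.

Ltac poly_step := lazymatch goal with
  | |- poly_bounded _ (fun x => _ + _) => apply: poly_bounded_add
  | |- poly_bounded _ (fun x => _ * _) => apply: poly_bounded_mul
  | |- poly_bounded _ (fun x => esize _) => apply: ptime_esize
  | _ => first [assumption | exact: poly_bounded_const]
  end.
Ltac poly_tac := repeat poly_step.

Section Bool.
Variable X : encType.
Implicit Types b c : X -> bool.

Lemma ptime_negb b : ptime b -> ptime (fun x => ~~ b x).
Proof. move=> pb; apply: (ptime_ext (f := fun x => if b x then false else true)) => //; ptime_tac. Qed.

Lemma ptime_andb b c : ptime b -> ptime c -> ptime (fun x => b x && c x).
Proof. move=> pb pc; apply: (ptime_ext (f := fun x => if b x then c x else false)) => //; ptime_tac. Qed.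

Lemma ptime_orb b c : ptime b -> ptime c -> ptime (fun x => b x || c x).
Proof. move=> pb pc; apply: (ptime_ext (f := fun x => if b x then true else c x)) => //; ptime_tac. Qed.

Lemma ptime_xorb b c : ptime b -> ptime c -> ptime (fun x => b x (+) c x).
Proof.
move=> pb pc; apply: (ptime_ext (f := fun x => if b x then ~~ c x else c x)).
  by move=> x; case: (b x).
by apply: ptime_if => //; exact: ptime_negb.
Qed.

End Bool.

(* Numbers are read and written through the list of their binary digits, least
   significant first. *)
Definition bits (n : nat) : seq bool :=
  if bin_of_nat n is BinNums.Npos p then pos_bits p else [::].

Definition of_bits (s : seq bool) : nat := foldr (fun (b : bool) n => b + n.*2) 0 s.

Lemma bitsK n : of_bits (bits n) = n.
Proof.
rewrite /bits -[RHS]bin_of_natK; case: (bin_of_nat n) => //= p.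
elim: p => //= p; rewrite /of_bits /= => ->; last by rewrite NatTrec.doubleE.
by rewrite NatTrec.doubleE.
Qed.

(** Zero is the exception: a lone digit 0 would be a leading zero, which the encoding does not
    have. *)
Lemma bits_double (b : bool) n : bits (b + n.*2) = if (n == 0) && ~~ b then [::] else b :: bits n.
Proof.
rewrite -{1}(bin_of_natK n) /bits.
case E: (bin_of_nat n) => [|p] /=.
  by rewrite -(bin_of_natK n) E /=; case: b.
have -> : (n == 0) = false.
  apply/negbTE; apply/eqP => n0; move: E; rewrite n0; by [].
rewrite /= (_ : b + _ = nat_of_bin (BinNums.Npos (if b then BinNums.xI p else BinNums.xO p))).
  by rewrite nat_of_binK; case: b.
by case: b; rewrite /= NatTrec.doubleE.
Qed.

Lemma bits_eq_nil n : (bits n == [::]) = (n == 0).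
Proof.
apply/eqP/eqP => [h|->//]; by rewrite -(bitsK n) h.
Qed.

Section Nat.
Variable X : encType.
Implicit Types f g : X -> nat.

Lemma ptime_bits f : ptime f -> ptime (fun x => bits (f x)).
Proof. exact: ptime_recode. Qed.

Lemma ptime_of_canonical_bits (s : X -> seq bool) f :
  (forall x, bits (f x) = s x) -> ptime s -> ptime f.
Proof. by move=> h ps; apply: (ptime_recode _ ps) => x; rewrite -h. Qed.

Lemma ptime_eq0 f : ptime f -> ptime (fun x => f x == 0).
Proof.
move=> /ptime_bits pf.
apply: (ptime_ext (f := fun x => if bits (f x) is _ :: _ then false else true)).
  by move=> x; rewrite -bits_eq_nil; case: (bits _).
by apply: (ptime_match (f := fun=> false) pf); ptime_tac.
Qed.

Lemma bits_rec n : bits n = if n == 0 then [::] else odd n :: bits n./2.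
Proof.
have -> : (n == 0) = (n./2 == 0) && ~~ odd n.
  by rewrite -[in LHS](odd_double_half n) addn_eq0 double_eq0 eqb0 andbC.
by rewrite -{1}(odd_double_half n) bits_double.
Qed.

Lemma ptime_odd f : ptime f -> ptime (fun x => odd (f x)).
Proof.
move=> /ptime_bits pf.
apply: (ptime_ext (f := fun x => if bits (f x) is b :: _ then b else false)).
  by move=> x; rewrite bits_rec; case: eqP => // ->.
by apply: (ptime_match (f := fun p => p.2.1) pf); ptime_tac.
Qed.

Lemma ptime_half f : ptime f -> ptime (fun x => (f x)./2).
Proof.
move=> /ptime_bits pf.
apply: (ptime_of_canonical_bits (s := fun x => if bits (f x) is _ :: s then s else [::])).
  by move=> x; rewrite [in RHS]bits_rec; case: eqP => // ->.
by apply: (ptime_match (f := fun p => p.2.2) pf); ptime_tac.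
Qed.

Lemma ptime_digit (b : X -> bool) f : ptime b -> ptime f -> ptime (fun x => b x + (f x).*2).
Proof.
move=> pb pf; apply: ptime_of_canonical_bits => [x|]; first exact: bits_double.
ptime_tac; first by apply: ptime_andb; [exact: ptime_eq0|exact: ptime_negb].
Qed.

End Nat.

Lemma esize_bool (b : bool) : esize b <= 3.
Proof. by case: b. Qed.

Lemma esize_digit (b : bool) n : esize (b + n.*2) <= esize n + 4.
Proof.
rewrite /esize /enc /= /enc_nat -/(bits _) bits_double -/(bits _).
by case: ifP => _ /=; last (by case: b => /=; lia); have := tree_size_gt0 (enc_nat n); lia.
Qed.

Lemma esize_half n : (if odd n then 4 else 0) + esize n./2 <= esize n.
Proof.
rewrite /esize /enc /= /enc_nat -/(bits _) -/(bits _) [in leqRHS]bits_rec.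
by case: eqP => [->|] //=; case: (odd n) => /=; lia.
Qed.


Lemma esize_lt k n : n < 2 ^ k -> esize n <= 4 * k + 1.
Proof.
elim: k n => [|k IH] n h; first by case: n h.
rewrite -(odd_double_half n); apply: leq_trans (esize_digit _ _) _.
have : esize n./2 <= 4 * k + 1.
  by apply: IH; move: h; rewrite expnS; have := odd_double_half n; lia.
lia.
Qed.

Lemma esize_leq n k : n <= k -> esize n <= 4 * k + 1.
Proof. by move=> nk; apply/esize_lt/(leq_ltn_trans nk)/ltn_expl. Qed.

Lemma of_bits_lt s : of_bits s < 2 ^ size s.
Proof.
elim: s => //= b s; rewrite /of_bits /= -/(of_bits s) expnS.
by case: b; lia.
Qed.

Lemma ltn_expn_esize n : n < 2 ^ esize n.
Proof.
rewrite -{1}(bitsK n); apply: leq_trans (of_bits_lt _) _.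
by rewrite leq_exp2l// ltnW// (leq_trans (size_le_esize (bits n))).
Qed.

Section Arithmetic.
Variable X : encType.
Implicit Types f g : X -> nat.

(** The last stage of an addition: the digits of one summand are exhausted and a carry is left to be
    added to the other. *)
Lemma ptime_add_bool : ptime (fun p : bool * nat => p.2 + p.1).
Proof.
suff h : ptime (fun p : bool * seq bool => of_bits p.2 + p.1).
  apply: (ptime_ext (f := fun p : bool * nat => of_bits (bits p.2) + p.1)).
    by move=> p; rewrite bitsK.
  apply: (ptime_comp (f := fun p : bool * nat => (p.1, bits p.2)) _ h).
  by ptime_tac; apply: ptime_bits; ptime_tac.
apply: (ptime_rec (X := bool_encType) (R := fun (c : bool) l => of_bits l + c)
  (nx := fun p => p.2 && p.1) (F := fun p => (p.1.2 (+) p.1.1) + p.2.2.*2) (K := 0) (B := fun=> 4)).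
- apply: (ptime_ext (f := fun c : bool => c + 0.*2)); first by move=> c; rewrite addn0.
  by apply: (ptime_digit (f := fun=> 0)); ptime_tac.
- by apply: ptime_andb; ptime_tac.
- by apply: ptime_digit; ptime_tac; apply: ptime_xorb; ptime_tac.
- exact: poly_bounded_const.
- by move=> c y l; rewrite /of_bits /= -/(of_bits l); case: c; case: y => /=; lia.
- by move=> c y; rewrite mul0n addn0; case: y; case: c.
- move=> c y l.
  rewrite /= (_ : of_bits (y :: l) + c = (y (+) c) + (of_bits l + (y && c)).*2); last first.
    by rewrite /of_bits /= -/(of_bits l); case: c; case: y => /=; lia.
  exact: esize_digit.
Qed.

(** Ripple-carry addition along the digits of the first summand. The parameter holds the carry and
    the rest of the second summand, which is halved at every digit; the new carry is the majority of
    the two digits and the old carry. *)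
Lemma ptime_add f g : ptime f -> ptime g -> ptime (fun x => f x + g x).
Proof.
suff h : ptime (fun p : (bool * nat) * seq bool => of_bits p.2 + p.1.2 + p.1.1).
  move=> pf pg; apply: (ptime_ext (f := fun x => of_bits (bits (f x)) + g x + false)).
    by move=> x; rewrite bitsK addn0.
  apply: (ptime_comp (f := fun x => ((false, g x), bits (f x))) _ h).
  by ptime_tac; exact: ptime_bits.
apply: (ptime_rec (X := prod_encType bool_encType nat_encType)
  (R := fun (p : bool * nat) l => of_bits l + p.2 + p.1)
  (nx := fun p => (if odd p.1.2 then p.2 || p.1.1 else p.2 && p.1.1, p.1.2./2))
  (F := fun p => (p.1.2 (+) (p.1.1.1 (+) odd p.1.1.2)) + p.2.2.*2) (K := 3) (B := fun=> 4)).
- apply: (ptime_ext (f := fun p : bool * nat => p.2 + p.1)) => //.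
  exact: ptime_add_bool.
- ptime_tac; first (by apply: ptime_odd; ptime_tac); last by apply: ptime_half; ptime_tac.
    by apply: ptime_orb; ptime_tac.
  by apply: ptime_andb; ptime_tac.
- apply: ptime_digit; ptime_tac; apply: ptime_xorb; ptime_tac; apply: ptime_xorb; ptime_tac.
  by apply: ptime_odd; ptime_tac.
- exact: poly_bounded_const.
- case=> c b y l; rewrite /of_bits /= -/(of_bits l).
  by have := odd_double_half b; case: c; case: y; case: (odd b) => /=; lia.
- case=> c b y; rewrite !esize_pair /=; set m := if _ then _ else _.
  by have := esize_bool m; have := esize_half b; have := esize_gt0 y; have := esize_gt0 c; case: odd; lia.
- case=> c b y l /=; set m := if _ then _ else _.
  have -> : of_bits (y :: l) + b + c = (y (+) (c (+) odd b)) + (of_bits l + b./2 + m).*2.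
    rewrite {}/m /of_bits /= -/(of_bits l).
    by have := odd_double_half b; case: c; case: y; case: (odd b) => /=; lia.
  exact: esize_digit.
Qed.

(** The flag is a borrow: it is passed on when the digit on the left plus the incoming flag exceeds
    the digit on the right. At the end the flag alone is compared with what remains on the right. *)
Lemma ptime_leq f g : ptime f -> ptime g -> ptime (fun x => f x <= g x).
Proof.
suff h : ptime (fun p : (bool * nat) * seq bool => of_bits p.2 + p.1.1 <= p.1.2).
  move=> pf pg; apply: (ptime_ext (f := fun x => of_bits (bits (f x)) + false <= g x)).
    by move=> x; rewrite bitsK addn0.
  apply: (ptime_comp (f := fun x => ((false, g x), bits (f x))) _ h).
  by ptime_tac; exact: ptime_bits.
apply: (ptime_rec (X := prod_encType bool_encType nat_encType)
  (R := fun (p : bool * nat) l => of_bits l + p.1 <= p.2)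
  (nx := fun p => (if odd p.1.2 then p.2 && p.1.1 else p.2 || p.1.1, p.1.2./2))
  (F := fun p => p.2.2) (K := 3) (B := fun=> 3)).
- apply: (ptime_ext (f := fun p : bool * nat => ~~ p.1 || ~~ (p.2 == 0))).
    by case=> [[] [|n]].
  by apply: ptime_orb; apply: ptime_negb; ptime_tac; apply: ptime_eq0; ptime_tac.
- ptime_tac; first (by apply: ptime_odd; ptime_tac); last by apply: ptime_half; ptime_tac.
    by apply: ptime_andb; ptime_tac.
  by apply: ptime_orb; ptime_tac.
- by ptime_tac.
- exact: poly_bounded_const.
- case=> c b y l; rewrite /of_bits /= -/(of_bits l).
  by have := odd_double_half b; case: c; case: y; case: (odd b) => /=; lia.
- case=> c b y; rewrite !esize_pair /=; set m := if _ then _ else _.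
  by have := esize_bool m; have := esize_half b; have := esize_gt0 y; have := esize_gt0 c; case: odd; lia.
- by move=> x y l; apply: leq_trans (esize_bool _) (leq_addl _ _).
Qed.

Lemma ptime_eqn f g : ptime f -> ptime g -> ptime (fun x => f x == g x).
Proof.
move=> pf pg; apply: (ptime_ext (f := fun x => (f x <= g x) && (g x <= f x))).
  by move=> x; rewrite eqn_leq.
by apply: ptime_andb; exact: ptime_leq.
Qed.

End Arithmetic.

Lemma ptime_mul (X : encType) (f g : X -> nat) : ptime f -> ptime g -> ptime (fun x => f x * g x).
Proof.
move=> pf pg.
pose F (x : X) (y : bool) s := (if y then g x else 0) + s.*2.
have FE x l : foldr (F x) 0 l = of_bits l * g x.
  elim: l => //= y l ->; rewrite /F /of_bits /= -/(of_bits l) mulnDl -!muln2.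
  by case: y; lia.
apply: (ptime_ext (f := fun x => foldr (F x) 0 (bits (f x)))).
  by move=> x; rewrite FE bitsK.
apply: (ptime_foldr (B := fun p => 4 * (esize p.2.2 + esize (g p.1)) + 1)).
- exact: ptime_bits.
- by ptime_tac.
- poly_tac; first by ptime_tac.
  by apply: (ptime_comp (g := g)); ptime_tac.
- rewrite /F; apply: ptime_add; first by ptime_tac; apply: (ptime_comp (g := g)); ptime_tac.
  by apply: (ptime_digit (b := fun=> false)); ptime_tac.
(* The growth in one step is bounded by the size of the whole partial product, which has at most
   [(size l).+1 + esize (g x)] digits. *)
- move=> x y l; apply: leq_trans _ (leq_addl _ _).
  rewrite -[F x y _]/(foldr (F x) 0 (y :: l)) FE.
  have h : of_bits (y :: l) * g x < 2 ^ ((size l).+1 + esize (g x)).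
    rewrite expnD; have := of_bits_lt (y :: l); have := ltn_expn_esize (g x).
    move=> h1 h2; apply: leq_ltn_trans (leq_mul (leqnn _) (ltnW h1)) _.
    by rewrite ltn_pmul2r// expn_gt0.
  apply: leq_trans (esize_lt h) _; rewrite leq_add2r leq_mul2l leq_add2r.
  exact: size_le_esize.
Qed.

Ltac ptime_step ::= lazymatch goal with
  | |- ptime (fun x => x) => apply: ptime_id
  | |- ptime (fun x => (_, _)) => apply: ptime_pair
  | |- ptime (fun x => _.1) => apply: ptime_fst
  | |- ptime (fun x => _.2) => apply: ptime_snd
  | |- ptime fst => exact: ptime_fst (@ptime_id _)
  | |- ptime snd => exact: ptime_snd (@ptime_id _)
  | |- ptime (fun x => _ :: _) => apply: ptime_cons
  | |- ptime (fun x => if _ then _ else _) => apply: ptime_if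
  | |- ptime (fun x => ~~ _) => apply: ptime_negb
  | |- ptime (fun x => _ && _) => apply: ptime_andb
  | |- ptime (fun x => _ || _) => apply: ptime_orb
  | |- ptime (fun x => _ + _) => apply: ptime_add
  | |- ptime (fun x => _ * _) => apply: ptime_mul
  | |- ptime (fun x => _ <= _) => apply: ptime_leq
  | |- ptime (fun x => _ == _) => apply: ptime_eqn
  | _ => first [assumption | apply: ptime_const]
  end.

(** Counters run along lists, so their growth per step has to be bounded by a constant. An increment
    lengthens a number by at most one digit; the induction follows the carry into the half. *)
Lemma esizeS n : esize n.+1 <= esize n + 4.
Proof.
have encE (m : nat) : esize m = if m == 0 then 1 else ((if odd m then 3 else 1) + esize m./2).+1.
  rewrite /esize /enc /= /enc_nat -!/(bits _) [in LHS]bits_rec.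
  by case: eqP => //= _; case: (odd m).
elim/ltn_ind: n => -[|n] IH; first by [].
rewrite [esize n.+2]encE [esize n.+1]encE /= negbK.
have := IH n./2; have := odd_double_half n; rewrite uphalf_half.
by case: (odd n) => /=; rewrite ?add0n ?add1n; lia.
Qed.

(** * The algorithm *)

Section Lists.
Variables X Y Z : encType.

Lemma ptime_has (p : X -> Y -> bool) (l : X -> seq Y) :
  ptime (fun q : X * Y => p q.1 q.2) -> ptime l -> ptime (fun x => has (p x) (l x)).
Proof.
move=> pp pl; apply: (ptime_ext (f := fun x => foldr (fun y r => p x y || r) false (l x))).
  by move=> x; elim: (l x) => //= y s ->.
apply: (ptime_foldr (B := fun=> 3)) => //; first exact: ptime_const.
- exact: poly_bounded_const.
- apply: ptime_orb; last by ptime_tac.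
  by apply: (ptime_comp2 (h := p)) => //; ptime_tac.
- by move=> x y l'; apply: leq_trans (esize_bool _) (leq_addl _ _).
Qed.

Lemma ptime_filter (p : X -> Y -> bool) (l : X -> seq Y) :
  ptime (fun q : X * Y => p q.1 q.2) -> ptime l ->
  ptime (fun x => [seq y <- l x | p x y]).
Proof.
move=> pp pl; apply: (ptime_ext (f := fun x =>
  foldr (fun y r => if p x y then y :: r else r) [::] (l x))).
  by move=> x; elim: (l x) => //= y s ->.
apply: (ptime_foldr (B := fun q => esize q.2.1 + 1)) => //; first exact: ptime_const.
- by poly_tac; ptime_tac.
- ptime_tac; apply: (ptime_comp2 (h := p)) => //; ptime_tac.
- by move=> x y l'; case: ifP => _ //=; rewrite ?esize_cons; lia.
Qed.

Lemma ptime_map (f : X -> Y -> Z) (l : X -> seq Y) :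
  ptime (fun q : X * Y => f q.1 q.2) -> ptime l ->
  ptime (fun x => [seq f x y | y <- l x]).
Proof.
move=> pf pl; apply: (ptime_ext (f := fun x => foldr (fun y r => f x y :: r) [::] (l x))).
  by move=> x; elim: (l x) => //= y s ->.
apply: (ptime_foldr (B := fun q => esize (f q.1 q.2.1) + 1)) => //; first exact: ptime_const.
- by poly_tac; apply: (ptime_comp2 (h := f)) => //; ptime_tac.
- ptime_tac; apply: (ptime_comp2 (h := f)) => //; ptime_tac.
- by move=> x y l' /=; rewrite esize_cons; lia.
Qed.

Lemma ptime_cat (l1 l2 : X -> seq Y) :
  ptime l1 -> ptime l2 -> ptime (fun x => l1 x ++ l2 x).
Proof.
move=> p1 p2; apply: (ptime_ext (f := fun x => foldr cons (l2 x) (l1 x))).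
  by move=> x; elim: (l1 x) => //= y s ->.
apply: (ptime_foldr (f := fun=> cons) (B := fun q => esize q.2.1 + 1)) => //.
- by poly_tac; ptime_tac.
- by ptime_tac.
- by move=> x y l' /=; rewrite esize_cons; lia.
Qed.

Lemma ptime_count (p : X -> Y -> bool) (l : X -> seq Y) :
  ptime (fun q : X * Y => p q.1 q.2) -> ptime l -> ptime (fun x => count (p x) (l x)).
Proof.
move=> pp pl; have E x s : foldr (fun y r => p x y + r) 0 s = count (p x) s.
  by elim: s => //= y s ->.
apply: (ptime_ext (f := fun x => foldr (fun y r => p x y + r) 0 (l x))) => [x|]; first exact: E.
apply: (ptime_foldr (B := fun q => 4 * esize q.2.2 + 1)) => //; first exact: ptime_const.
- by poly_tac; ptime_tac.
- apply: (ptime_ext (f := fun q : X * (Y * nat) => (if p q.1 q.2.1 then 1 else 0) + q.2.2)).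
    by move=> q; case: (p _ _).
  ptime_tac; apply: (ptime_comp2 (h := p)) => //; ptime_tac.
- move=> x y l' /=; rewrite E; apply: leq_trans _ (leq_addl _ _); apply: esize_leq.
  by have := size_le_esize l'; have := count_size (p x) l'; case: (p x y) => /=; lia.
Qed.

End Lists.

Lemma ptime_memn (X : encType) (f : X -> nat) (l : X -> seq nat) :
  ptime f -> ptime l -> ptime (fun x => f x \in l x).
Proof.
move=> pf pl; apply: (ptime_ext (f := fun x => has (fun y => y == f x) (l x))).
  by move=> x; rewrite -has_pred1.
apply: ptime_has => //; ptime_tac; apply: (ptime_comp (g := f)) => //; ptime_tac.
Qed.

(* The second component of a vertex of the split digraph tells the entrance
   [(w, false)] of the node [w] from its exit [(w, true)]. *)
Notation vertex := (nat * bool)%type.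
Definition swap (a : vertex * vertex) : vertex * vertex := (a.2, a.1).

Lemma ptime_eqb (X : encType) (f g : X -> bool) :
  ptime f -> ptime g -> ptime (fun x => f x == g x).
Proof.
move=> pf pg; apply: (ptime_ext (f := fun x => if f x then g x else ~~ g x)).
  by move=> x; case: (f x); case: (g x).
ptime_tac.
Qed.

Lemma ptime_eqv (X : encType) (f g : X -> vertex) :
  ptime f -> ptime g -> ptime (fun x => f x == g x).
Proof.
move=> pf pg.
apply: (ptime_ext (f := fun x => ((f x).1 == (g x).1) && ((f x).2 == (g x).2))) => //.
by apply: ptime_andb; [apply: ptime_eqn|apply: ptime_eqb]; ptime_tac.
Qed.

Lemma ptime_memv (X : encType) (f : X -> vertex) (l : X -> seq vertex) :
  ptime f -> ptime l -> ptime (fun x => f x \in l x).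
Proof.
move=> pf pl; apply: (ptime_ext (f := fun x => has (fun y => y == f x) (l x))).
  by move=> x; rewrite -has_pred1.
apply: ptime_has => //; apply: ptime_eqv; ptime_tac.
by apply: (ptime_comp (g := f)) => //; ptime_tac.
Qed.

Section Search.
Variables (W B : eqType) (tl hd : B -> W).

(* A search tree is the list of its arcs, the latest first. *)
Definition reached (s : W) (T : seq B) : seq W := s :: map hd T.

Definition grow (s : W) (D T : seq B) : seq B :=
  foldr (fun a T => if (tl a \in reached s T) && (hd a \notin reached s T)
                    then a :: T else T) T D.

(** The list [D] doubles as the clock. A pass that adds nothing has found a closed set, and every
    other pass adds an arc of [D], so [size D + 1] passes suffice. *)
Definition search (s : W) (D : seq B) : seq B :=
  grow s D (foldr (fun _ => grow s D) [::] D).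

(** The arc that reached the tail of [a] was found before [a] and stands after it in the list, so
    one traversal retraces the path. *)
Fixpoint back_path (t : W) (T : seq B) : seq B :=
  if T is a :: T' then
    if hd a == t then a :: back_path (tl a) T' else back_path t T'
  else [::].

End Search.

Definition arc_search := search (@fst vertex vertex) (@snd vertex vertex).
Definition arc_reached := reached (@snd vertex vertex).
Definition arc_path := back_path (@fst vertex vertex) (@snd vertex vertex).

(** Parallel arcs are equal entries of the list. A path uses one of them, so only one occurrence is
    reversed. *)
Fixpoint swap_first (a : vertex * vertex) (D : seq (vertex * vertex)) :=
  if D is b :: D' then if b == a then swap a :: D' else b :: swap_first a D' else [::].

Definition augment (s t : vertex) (D : seq (vertex * vertex)) :=
  let T := arc_search s D in
  if t \in arc_reached s T then foldr swap_first D (arc_path t T) else D.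

Definition residual (s t : vertex) (D : seq (vertex * vertex)) :=
  foldr (fun _ => augment s t) D D.

Definition source_side (s t : vertex) (D : seq (vertex * vertex)) : seq vertex :=
  arc_reached s (arc_search s (residual s t D)).

Definition edge_arcs (es : seq (nat * nat)) : seq (vertex * vertex) :=
  foldr (fun e r => [:: ((e.1, true), (e.2, false)), ((e.2, true), (e.1, false)) & r]) [::] es.

(** The list [l] is a unary clock: [c] is written in binary, so a loop of [c] rounds could take
    exponential time. The result consists of [minn c (size l)] copies. *)
Definition copies (a : vertex * vertex) (c : nat) (l : seq (nat * nat)) :=
  (foldr (fun _ st => (st.1.+1, if st.1 < c then a :: st.2 else st.2)) (0, [::]) l).2.

Fixpoint node_arcs (l : seq (nat * nat)) (k : nat) (cs : seq nat) : seq (vertex * vertex) :=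
  if cs is c :: cs' then copies ((k, false), (k, true)) c l ++ node_arcs l k.+1 cs' else [::].

(* Cuts of more than [size es] arcs are never minimum, so the capacities can be
   truncated at [(size es).+1]. *)
Definition split_arcs (es : seq (nat * nat)) (cs : seq nat) : seq (vertex * vertex) :=
  edge_arcs es ++ node_arcs ((0, 0) :: es) 0 cs.

(** The nodes with a reached exit form the inner part of the cut, all reached nodes its outer part.
    A cut with [a] in its outer part is dropped; if [a] is in the inner part, its complement is
    accounted for when [u] and [v] are exchanged. *)
Definition cut_side (es : seq (nat * nat)) (cs : seq nat) (a u v : nat) : seq (seq nat) :=
  let R := source_side (u, true) (v, false) (split_arcs es cs) in
  if a \in [seq w.1 | w <- R] then [::] else [:: [seq w.1 | w <- [seq w <- R | w.2]]].

Definition subseteq (A B : seq nat) : bool := ~~ has (fun x => x \notin B) A.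

Definition insert (S : seq nat) (L : seq (seq nat)) : seq (seq nat) :=
  if has (fun T => subseteq T S) L then L else S :: [seq T <- L | ~~ subseteq S T].

Definition add_side (es : seq (nat * nat)) (cs : seq nat) (a u v : nat) (L : seq (seq nat)) :=
  foldr insert L (cut_side es cs a u v).

Definition minimal_sides (es : seq (nat * nat)) (cs : seq nat) (a : nat) (ds : seq (nat * nat)) :=
  foldr (fun d L => add_side es cs a d.1 d.2 (add_side es cs a d.2 d.1 L)) [::] ds.

(* A labelled link [(j, (e, (p, q)))] has label [j], ends [e] and cost [p / q]. *)
Notation llink := (nat * ((nat * nat) * (nat * nat)))%type.

Definition hit (x : llink) (S : seq nat) : bool := (x.2.1.1 \in S) || (x.2.1.2 \in S).

Definition hits (x : llink) (U : seq (seq nat)) : nat := count (hit x) U.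

(** Compares the cost per side hit, that is [p / q] divided by the number of hits, with all
    denominators cleared. *)
Definition cheaper (U : seq (seq nat)) (x y : llink) : bool :=
  x.2.2.1 * hits y U * y.2.2.2 <= y.2.2.1 * hits x U * x.2.2.2.

Definition best (U : seq (seq nat)) (L : seq llink) : seq llink :=
  foldr (fun x b => if hits x U == 0 then b else
    if b is y :: _ then if cheaper U x y then [:: x] else b else [:: x]) [::] L.

Definition greedy_step (L : seq llink) (st : seq (seq nat) * seq nat) :=
  if best st.1 L is x :: _ then ([seq S <- st.1 | ~~ hit x S], x.1 :: st.2) else st.

Definition greedy (L : seq llink) (U : seq (seq nat)) : seq nat :=
  (foldr (fun _ => greedy_step L) (U, [::]) U).2.

Fixpoint label (k : nat) (l : seq ((nat * nat) * (nat * nat))) : seq llink :=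
  if l is x :: l' then (k, x) :: label k.+1 l' else [::].

Notation raw_instance := (
  seq (nat * nat) * (seq nat * (nat * (seq ((nat * nat) * (nat * nat)) * seq (nat * nat)))))%type.

Definition solve (P : raw_instance) : seq bool :=
  let L := label 0 P.2.2.2.1 in
  let C := greedy L (minimal_sides P.1 P.2.1 P.2.2.1 P.2.2.2.2) in
  [seq x.1 \in C | x <- L].

(** * Running times of the subroutines *)

Local Notation arcs := (seq (vertex * vertex)).

Lemma esize_swap a : esize (swap a) = esize a.
Proof. by case: a => a b; rewrite !esize_pair addnC. Qed.

Lemma esize_swap_first a D : esize (swap_first a D) = esize D.
Proof.
elim: D => //= b D IH.
by case: eqP => [->|_]; rewrite !esize_cons ?IH// esize_swap.
Qed.

(** Reversing arcs preserves the size of the network, so repeated augmentation cannot blow it up. *)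
Lemma esize_augment s t D : esize (augment s t D) = esize D.
Proof.
rewrite /augment; case: ifP => // _.
by elim: (arc_path _ _) => //= a p IH; rewrite esize_swap_first.
Qed.

Lemma ptime_reached (X : encType) (s : X -> vertex) (T : X -> arcs) :
  ptime s -> ptime T -> ptime (fun x => arc_reached (s x) (T x)).
Proof.
move=> ps pT; apply: ptime_cons => //.
by apply: (ptime_map (f := fun _ => snd)) => //; ptime_tac.
Qed.

Lemma ptime_grow : ptime (fun p : (vertex * arcs) * arcs => grow fst snd p.1.1 p.1.2 p.2).
Proof.
apply: (ptime_foldr (f := fun (p : (vertex * arcs) * arcs) a T =>
  if (a.1 \in arc_reached p.1.1 T) && (a.2 \notin arc_reached p.1.1 T) then a :: T else T)
  (l := fun p : (vertex * arcs) * arcs => p.1.2) (s0 := snd)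
  (B := fun q => esize q.2.1 + 1)); try by ptime_tac.
- by poly_tac; ptime_tac.
- by ptime_tac; apply: ptime_memv; ptime_tac; apply: ptime_reached; ptime_tac.
- by move=> x y l /=; case: ifP => _; rewrite ?esize_cons; lia.
Qed.

Lemma esize_grow s (D T : arcs) : esize (grow fst snd s D T) <= esize T + esize D.
Proof.
rewrite /grow; elim: D => [|a D] /=; first by lia.
set T' := foldr _ _ _ => IH; rewrite esize_cons.
by case: ifP => _; rewrite ?esize_cons; lia.
Qed.

Lemma ptime_search : ptime (fun p : vertex * arcs => arc_search p.1 p.2).
Proof.
have pg : ptime (fun q : (vertex * arcs) * arcs => grow fst snd q.1.1 q.1.2 q.2).
  exact: ptime_grow.
rewrite /arc_search /search.
apply: (ptime_comp (f := fun p : vertex * arcs =>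
  (p, foldr (fun _ => grow fst snd p.1 p.2) [::] p.2)) _ pg).
apply: ptime_pair; first by ptime_tac.
apply: (ptime_foldr (f := fun (p : vertex * arcs) _ T => grow fst snd p.1 p.2 T) (s0 := fun=> [::])
  (B := fun q => esize q.1.2)); try by ptime_tac.
- by poly_tac; ptime_tac.
- by apply: (ptime_comp (f := fun q : (vertex * arcs) * ((vertex * vertex) * arcs) => (q.1, q.2.2)) _ pg);
    ptime_tac.
- by move=> x y l; exact: esize_grow.
Qed.

Lemma ptime_path : ptime (fun p : vertex * arcs => arc_path p.1 p.2).
Proof.
apply: (ptime_rec (R := arc_path) (nx := fun p => if p.2.2 == p.1 then p.2.1 else p.1)
  (F := fun p => if p.1.2.2 == p.1.1 then p.1.2 :: p.2.2 else p.2.2) (K := 1)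
  (B := fun q => esize q.2.1 + 1)).
- by ptime_tac.
- by ptime_tac; apply: ptime_eqv; ptime_tac.
- by ptime_tac; apply: ptime_eqv; ptime_tac.
- by poly_tac; ptime_tac.
- by move=> t a T; rewrite /arc_path /=; case: eqP.
- by move=> t [a b] /=; rewrite esize_pair; case: eqP => _; lia.
- by move=> t a T; rewrite /arc_path /=; case: eqP => _; rewrite ?esize_cons; lia.
Qed.

Lemma ptime_swap_first : ptime (fun p : (vertex * vertex) * arcs => swap_first p.1 p.2).
Proof.
apply: (ptime_rec (R := swap_first) (nx := fst)
  (F := fun p => if p.1.2 == p.1.1 then swap p.1.1 :: p.2.1 else p.1.2 :: p.2.2) (K := 0)
  (B := fun q => esize q.2.1 + 1)).
- by ptime_tac.
- by ptime_tac.
- ptime_tac.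
  + apply: (ptime_ext (f := fun x : ((vertex * vertex) * (vertex * vertex)) * (arcs * arcs) =>
      (x.1.2.1 == x.1.1.1) && (x.1.2.2 == x.1.1.2))) => //.
    by apply: ptime_andb; apply: ptime_eqv; ptime_tac.
  + by rewrite /swap; ptime_tac.
- by poly_tac; ptime_tac.
- by [].
- by move=> x y; rewrite mul0n addn0.
- by move=> a b D; rewrite !esize_swap_first esize_cons /=; lia.
Qed.

Lemma ptime_augment : ptime (fun p : (vertex * vertex) * arcs => augment p.1.1 p.1.2 p.2).
Proof.
have ps : ptime (fun p : (vertex * vertex) * arcs => arc_search p.1.1 p.2).
  by apply: (ptime_comp (f := fun p => (p.1.1, p.2)) _ ptime_search); ptime_tac.
apply: ptime_if; last by ptime_tac.
  by apply: ptime_memv; first ptime_tac; apply: ptime_reached; ptime_tac.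
apply: (ptime_foldr (f := fun _ => swap_first) (s0 := snd) (B := fun=> 0)); last first.
- by move=> x y l; rewrite esize_swap_first addn0.
- by apply: (ptime_comp (f := fun p => (p.2.1, p.2.2)) _ ptime_swap_first); ptime_tac.
- exact: poly_bounded_const.
- by ptime_tac.
- by apply: (ptime_comp2 (h := arc_path) ptime_path); ptime_tac.
Qed.

Lemma ptime_source_side :
  ptime (fun p : (vertex * vertex) * arcs => source_side p.1.1 p.1.2 p.2).
Proof.
apply: ptime_reached; first by ptime_tac.
apply: (ptime_comp2 (h := arc_search) ptime_search); first by ptime_tac.
apply: (ptime_foldr (f := fun (p : (vertex * vertex) * arcs) _ => augment p.1.1 p.1.2)
  (l := snd) (s0 := snd) (B := fun=> 0)); last first.
- by move=> x y l; rewrite esize_augment addn0.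
- by apply: (ptime_comp (f := fun p => (p.1.1, p.2.2)) _ ptime_augment); ptime_tac.
- exact: poly_bounded_const.
- by ptime_tac.
- by ptime_tac.
Qed.

Lemma ptimeS (X : encType) (f : X -> nat) : ptime f -> ptime (fun x => (f x).+1).
Proof.
move=> pf; apply: (ptime_ext (f := fun x => f x + 1)); first by move=> x; rewrite addn1.
by ptime_tac.
Qed.

Lemma ptime_edge_arcs : ptime edge_arcs.
Proof.
apply: (ptime_foldr (f := fun _ e r => [:: ((e.1, true), (e.2, false)), ((e.2, true), (e.1, false)) & r])
  (l := fun x => x) (s0 := fun=> [::]) (B := fun q => 2 * esize q.2.1 + 20)); try by ptime_tac.
- by poly_tac; ptime_tac.
- by move=> x [u v] l; rewrite !(esize_cons, esize_pair) /=; have := esize_bool true;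
    have := esize_bool false; lia.
Qed.

Lemma ptime_copies :
  ptime (fun p : ((vertex * vertex) * nat) * seq (nat * nat) => copies p.1.1 p.1.2 p.2).
Proof.
apply: ptime_snd; apply: (ptime_foldr (l := snd) (s0 := fun=> (0, [::]))
  (f := fun (p : ((vertex * vertex) * nat) * seq (nat * nat)) _ st =>
    (st.1.+1, if st.1 < p.1.2 then p.1.1 :: st.2 else st.2))
  (B := fun q => esize q.1.1.1 + 10)); try by ptime_tac.
- by poly_tac; ptime_tac.
- by ptime_tac; apply: ptimeS; ptime_tac.
- move=> x y l; set st := foldr _ _ _; case: st => k r; rewrite !esize_pair /=.
  by have := esizeS k; case: ifP => _; rewrite ?esize_cons; lia.
Qed.

Lemma esize_cat (T : encType) (s1 s2 : seq T) : esize (s1 ++ s2) <= esize s1 + esize s2.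
Proof. by elim: s1 => [|x s1 IH] /=; rewrite ?esize_cons; lia. Qed.

Lemma ptime_node_arcs :
  ptime (fun p : (seq (nat * nat) * nat) * seq nat => node_arcs p.1.1 p.1.2 p.2).
Proof.
have pc : ptime (fun q : (seq (nat * nat) * nat) * (nat * seq nat) =>
    copies ((q.1.2, false), (q.1.2, true)) q.2.1 q.1.1).
  by apply: (ptime_comp (f := fun q => (((q.1.2, false), (q.1.2, true)), q.2.1, q.1.1)) _ ptime_copies);
    ptime_tac.
apply: (ptime_rec (R := fun (p : seq (nat * nat) * nat) => node_arcs p.1 p.2)
  (nx := fun p => (p.1.1, p.1.2.+1)) (K := 4)
  (F := fun p => copies ((p.1.1.2, false), (p.1.1.2, true)) p.1.2 p.1.1.1 ++ p.2.2)
  (B := fun q => esize (copies ((q.1.2, false), (q.1.2, true)) q.2.1 q.1.1))); try by ptime_tac.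
- by ptime_tac; apply: ptimeS; ptime_tac.
- apply: ptime_cat; last by ptime_tac.
  by apply: (ptime_comp (f := fun p => (p.1.1, (p.1.2, p.2.1))) _ pc); ptime_tac.
- by poly_tac.
- move=> [l k] c; rewrite !esize_pair /=; have := esizeS k; have := esize_gt0 c; lia.
- by move=> [l k] c cs /=; rewrite addnC; exact: esize_cat.
Qed.

Lemma ptime_split_arcs :
  ptime (fun p : seq (nat * nat) * seq nat => split_arcs p.1 p.2).
Proof.
apply: ptime_cat; first by apply: (ptime_comp (g := edge_arcs) _ ptime_edge_arcs); ptime_tac.
by apply: (ptime_comp (f := fun p => (((0, 0) :: p.1, 0), p.2)) _ ptime_node_arcs); ptime_tac.
Qed.

Notation query := (((seq (nat * nat) * seq nat) * nat) * (nat * nat))%type.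

Lemma ptime_cut_side :
  ptime (fun p : query => cut_side p.1.1.1 p.1.1.2 p.1.2 p.2.1 p.2.2).
Proof.
have pR : ptime (fun p : query =>
    source_side (p.2.1, true) (p.2.2, false) (split_arcs p.1.1.1 p.1.1.2)).
  apply: (ptime_comp (f := fun p : query => (((p.2.1, true), (p.2.2, false)),
    split_arcs p.1.1.1 p.1.1.2)) _ ptime_source_side).
  ptime_tac.
  by apply: (ptime_comp (f := fun p : query => p.1.1) _ ptime_split_arcs); ptime_tac.
apply: ptime_if; [|by ptime_tac|ptime_tac].
- apply: ptime_memn; first by ptime_tac.
  by apply: (ptime_map (f := fun _ => fst)) => //; ptime_tac.
- apply: (ptime_map (f := fun _ => fst)); first by ptime_tac.
  by apply: (ptime_filter (p := fun _ => snd)) => //; ptime_tac.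
Qed.

Lemma ptime_subseteq (X : encType) (A B : X -> seq nat) :
  ptime A -> ptime B -> ptime (fun x => subseteq (A x) (B x)).
Proof.
move=> pA pB; apply: ptime_negb; apply: ptime_has => //; ptime_tac.
by apply: ptime_memn; ptime_tac; apply: (ptime_comp (g := B)); ptime_tac.
Qed.

Lemma ptime_insert : ptime (fun p : seq nat * seq (seq nat) => insert p.1 p.2).
Proof.
apply: ptime_if; [|by ptime_tac|ptime_tac].
  by apply: ptime_has; ptime_tac; apply: ptime_subseteq; ptime_tac.
by apply: ptime_filter; ptime_tac; apply: ptime_subseteq; ptime_tac.
Qed.

Lemma esize_filter (T : encType) (p : pred T) s : esize (filter p s) <= esize s.
Proof. by elim: s => //= x s IH; case: ifP; rewrite !esize_cons; lia. Qed.

Lemma esize_insert S L : esize (insert S L) <= esize L + esize S + 1.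
Proof.
rewrite /insert; case: ifP => _; first by lia.
by rewrite esize_cons addn1 ltnS addnC leq_add2r; exact: esize_filter.
Qed.

Lemma esize_add_side es cs a u v L :
  esize (add_side es cs a u v L) <= esize L + esize (cut_side es cs a u v).
Proof.
rewrite /add_side; elim: (cut_side _ _ _ _ _) => [|S l] /=; first by lia.
set L' := foldr _ _ _ => IH; rewrite esize_cons.
by have := esize_insert S L'; lia.
Qed.

Lemma ptime_add_side : ptime (fun p : query * seq (seq nat) =>
  add_side p.1.1.1.1 p.1.1.1.2 p.1.1.2 p.1.2.1 p.1.2.2 p.2).
Proof.
apply: (ptime_foldr (f := fun _ => insert) (s0 := snd)
  (B := fun q => esize q.2.1 + 1)); try by ptime_tac.
- by apply: (ptime_comp (f := fun p : query * seq (seq nat) => p.1) _ ptime_cut_side); ptime_tac.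
- by poly_tac; ptime_tac.
- by apply: (ptime_comp (f := snd) _ ptime_insert); ptime_tac.
- by move=> x S l; rewrite addnA; exact: esize_insert.
Qed.

Lemma ptime_minimal_sides :
  ptime (fun p : ((seq (nat * nat) * seq nat) * nat) * seq (nat * nat) =>
    minimal_sides p.1.1.1 p.1.1.2 p.1.2 p.2).
Proof.
pose ctx := (((seq (nat * nat) * seq nat) * nat) * seq (nat * nat))%type.
apply: (ptime_foldr (l := snd) (s0 := fun=> [::])
  (f := fun (p : ctx) d L => add_side p.1.1.1 p.1.1.2 p.1.2 d.1 d.2
     (add_side p.1.1.1 p.1.1.2 p.1.2 d.2 d.1 L))
  (B := fun q => esize (cut_side q.1.1.1.1 q.1.1.1.2 q.1.1.2 q.2.1.1 q.2.1.2) +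
    esize (cut_side q.1.1.1.1 q.1.1.1.2 q.1.1.2 q.2.1.2 q.2.1.1))); try by ptime_tac.
- poly_tac.
    by apply: (ptime_comp (f := fun q => (q.1.1, q.2.1)) _ ptime_cut_side); ptime_tac.
  by apply: (ptime_comp (f := fun q => (q.1.1, (q.2.1.2, q.2.1.1))) _ ptime_cut_side); ptime_tac.
- apply: (ptime_comp (f := fun q : ctx * ((nat * nat) * seq (seq nat)) => ((q.1.1, q.2.1),
    add_side q.1.1.1.1 q.1.1.1.2 q.1.1.2 q.2.1.2 q.2.1.1 q.2.2)) _ ptime_add_side).
  ptime_tac.
  apply: (ptime_comp (f := fun q : ctx * ((nat * nat) * seq (seq nat)) =>
    ((q.1.1, (q.2.1.2, q.2.1.1)), q.2.2)) _ ptime_add_side).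
  by ptime_tac.
- move=> x d l /=; set L := foldr _ _ _.
  apply: leq_trans (esize_add_side _ _ _ _ _ _) _.
  by rewrite addnA addnAC leq_add2r; exact: esize_add_side.
Qed.

Notation sides := (seq (seq nat)).

Lemma ptime_hit (X : encType) (x : X -> llink) (S : X -> seq nat) :
  ptime x -> ptime S -> ptime (fun p => hit (x p) (S p)).
Proof. by move=> px pS; apply: ptime_orb; apply: ptime_memn; ptime_tac. Qed.

Lemma ptime_hits (X : encType) (x : X -> llink) (U : X -> sides) :
  ptime x -> ptime U -> ptime (fun p => hits (x p) (U p)).
Proof.
move=> px pU; apply: ptime_count => //; apply: ptime_hit; ptime_tac.
by apply: (ptime_comp (g := x)); ptime_tac.
Qed.

Lemma ptime_cheaper (X : encType) (U : X -> sides) (x y : X -> llink) :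
  ptime U -> ptime x -> ptime y -> ptime (fun p => cheaper (U p) (x p) (y p)).
Proof. by move=> pU px py; rewrite /cheaper; ptime_tac; exact: ptime_hits. Qed.

Lemma ptime_best : ptime (fun p : sides * seq llink => best p.1 p.2).
Proof.
apply: (ptime_foldr (l := snd) (s0 := fun=> [::])
  (f := fun (p : sides * seq llink) x b => if hits x p.1 == 0 then b else
    if b is y :: _ then if cheaper p.1 x y then [:: x] else b else [:: x])
  (B := fun q => esize q.2.1 + 1)); try by ptime_tac.
- by poly_tac; ptime_tac.
- ptime_tac; first by apply: ptime_hits; ptime_tac.
  apply: (ptime_match (l := fun q : (sides * seq llink) * (llink * seq llink) => q.2.2)
    (f := fun r => if cheaper r.1.1.1 r.1.2.1 r.2.1 then [:: r.1.2.1] else r.1.2.2)); try by ptime_tac.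
  by ptime_tac; apply: ptime_cheaper; ptime_tac.
- move=> x y l /=; move: (foldr _ _ _) => b; case: ifP => _; first by lia.
  case: b => [|z b]; first by rewrite !esize_cons; lia.
  by have := esize_gt0 b; case: ifP => _; rewrite !esize_cons ?[esize [::]]/esize /=; lia.
Qed.

Lemma best_sub U L : {subset best U L <= L}.
Proof.
elim: L => //= x L IH y; have IH' : y \in best U L -> y \in x :: L.
  by move=> /IH; rewrite inE orbC => ->.
case: ifP => // _; case E: (best U L) => [|z b].
  by rewrite !inE => ->.
case: ifP => _; last by rewrite -E.
by rewrite !inE => ->.
Qed.

Lemma esize_mem (x : llink) (L : seq llink) : x \in L -> esize x <= esize L.
Proof.
by elim: L => //= y L IH; rewrite inE esize_cons => /orP[/eqP ->|/IH]; lia.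
Qed.

(** The label that is added is part of [L], which bounds the growth per round independently of the
    state. *)
Lemma esize_greedy_step L st : esize (greedy_step L st) <= esize st + esize L.
Proof.
rewrite /greedy_step; case E: (best _ _) => [|x b]; first by lia.
have xL : x \in L by apply: (@best_sub st.1); rewrite E mem_head.
case: st {E} => U C; rewrite !esize_pair /= esize_cons.
have hU : esize [seq S <- U | ~~ hit x S] <= esize U by exact: esize_filter.
have hx : (esize x.1).+1 <= esize x by case: (x) => j e; rewrite esize_pair /=; have := esize_gt0 e; lia.
have := esize_mem xL; lia.
Qed.

Lemma ptime_greedy : ptime (fun p : seq llink * sides => greedy p.1 p.2).
Proof.
apply: ptime_snd; apply: (ptime_foldr (l := snd)
  (f := fun (p : seq llink * sides) _ => greedy_step p.1)
  (s0 := fun p => (p.2, [::])) (B := fun q => esize q.1.1)); try by ptime_tac.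
- by poly_tac; ptime_tac.
- apply: (ptime_match (l := fun q : (seq llink * sides) * (seq nat * (sides * seq nat)) =>
      best q.2.2.1 q.1.1)
    (f := fun r => ([seq S <- r.1.2.2.1 | ~~ hit r.2.1 S], r.2.1.1 :: r.1.2.2.2))).
  + by apply: (ptime_comp (f := fun q => (q.2.2.1, q.1.1)) _ ptime_best); ptime_tac.
  + by ptime_tac.
  + ptime_tac; apply: ptime_filter; ptime_tac.
    by apply: ptime_hit; ptime_tac.
- by move=> x y l; exact: esize_greedy_step.
Qed.

Lemma ptime_label : ptime (label 0).
Proof.
suff h : ptime (fun p : nat * seq ((nat * nat) * (nat * nat)) => label p.1 p.2).
  by apply: (ptime_comp (f := fun l => (0, l)) _ h); ptime_tac.
apply: (ptime_rec (R := label) (nx := fun p => p.1.+1) (K := 4)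
  (F := fun p => p.1 :: p.2.2) (B := fun q => esize q.1 + esize q.2.1 + 2)); try by ptime_tac.
- by apply: ptimeS; ptime_tac.
- by poly_tac; ptime_tac.
- by move=> k x /=; have := esizeS k; have := esize_gt0 x; lia.
- by move=> k x l /=; rewrite esize_cons esize_pair; lia.
Qed.

Lemma ptime_solve : ptime solve.
Proof.
have pL : ptime (fun P : raw_instance => label 0 P.2.2.2.1).
  by apply: (ptime_comp (f := fun P : raw_instance => P.2.2.2.1) _ ptime_label); ptime_tac.
have pC : ptime (fun P : raw_instance =>
    greedy (label 0 P.2.2.2.1) (minimal_sides P.1 P.2.1 P.2.2.1 P.2.2.2.2)).
  apply: (ptime_comp2 (h := greedy) ptime_greedy) => //.
  by apply: (ptime_comp (f := fun P : raw_instance => (P.1, P.2.1, P.2.2.1, P.2.2.2.2)) _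
    ptime_minimal_sides); ptime_tac.
apply: (ptime_map (f := fun P x => x.1 \in
  greedy (label 0 P.2.2.2.1) (minimal_sides P.1 P.2.1 P.2.2.1 P.2.2.2.2))) => //.
apply: ptime_memn; first by ptime_tac.
by apply: (ptime_comp (f := fst) _ pC); ptime_tac.
Qed.

(** * Minimum cuts by reversing paths *)

Lemma foldr_iter (T U : Type) (f : T -> T) x (l : seq U) :
  foldr (fun=> f) x l = iter (size l) f x.
Proof. by elim: l => //= _ l ->. Qed.

Lemma uniq_map_inj (T U : eqType) (f : T -> U) s : uniq (map f s) -> {in s &, injective f}.
Proof.
elim: s => //= x s IH /andP[xs us] y z; rewrite !inE.
case/orP=> [/eqP ->|ys] /orP[/eqP ->|zs] // E; last exact: IH.
  by move: xs; rewrite E map_f.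
by move: xs; rewrite -E map_f.
Qed.

Section SearchTheory.
Variables (W B : eqType) (tl hd : B -> W).
Implicit Types (S : pred W) (D T : seq B) (a : B).

Definition out S D : nat := count (fun a => S (tl a) && ~~ S (hd a)) D.
Definition into S D : nat := count (fun a => ~~ S (tl a) && S (hd a)) D.

Variables (s : W) (D : seq B).
Local Notation reach := (reached hd s).

Fixpoint search_tree T : bool :=
  if T is a :: T' then
    [&& a \in D, tl a \in reach T', hd a \notin reach T' & search_tree T']
  else true.

Definition closed_under T : Prop := {in D, forall a, tl a \in reach T -> hd a \in reach T}.

Lemma grow_tree D' T :
  {subset D' <= D} -> search_tree T -> search_tree (grow tl hd s D' T).
Proof.
rewrite /grow; elim: D' => //= a D' IH sD hT.
have {}IH := IH (fun x xD' => sD x (mem_behead (s := a :: D') xD')) hT.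
by case: ifP => //= /andP[-> ->]; rewrite sD ?mem_head.
Qed.

Lemma grow_size D' T : size T <= size (grow tl hd s D' T).
Proof.
rewrite /grow; elim: D' => //= a D'; case: ifP => //= _; exact: leqW.
Qed.

Lemma grow_stable D' T : size (grow tl hd s D' T) <= size T ->
  grow tl hd s D' T = T /\ {in D', forall a, tl a \in reach T -> hd a \in reach T}.
Proof.
elim: D' => [|a D' IH] //=; have := grow_size D' T; rewrite -/(grow tl hd s D' T) => h.
case: ifP => [_ /=|cond le]; first by move=> h2; have := leq_ltn_trans h h2; rewrite ltnn.
have [E cl] := IH le; split=> // b; rewrite inE => /orP[/eqP ->|]; last exact: cl.
by rewrite E in cond; move=> ht; move: cond; rewrite ht /= => /negbFE.
Qed.

Lemma grow_closed D' T : {subset D' <= D} -> closed_under T -> grow tl hd s D' T = T.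
Proof.
move=> sD cl; rewrite /grow; elim: D' sD => //= a D' IH sD.
rewrite IH => [|x xD']; last by apply: sD; rewrite inE xD' orbT.
by case: ifP => // /andP[/(cl a (sD a (mem_head _ _))) ->].
Qed.

Lemma search_tree_uniq T : search_tree T -> uniq T /\ {subset T <= D}.
Proof.
elim: T => //= a T IH /and4P[aD _ hT /IH[uT sT]]; split.
  rewrite uT andbT; apply: contra hT => aT.
  by rewrite inE map_f ?orbT.
by move=> x; rewrite inE => /orP[/eqP ->|/sT].
Qed.

Lemma searchE : search tl hd s D = iter (size D).+1 (grow tl hd s D) [::].
Proof. by rewrite /search foldr_iter. Qed.

Lemma search_treeP : search_tree (search tl hd s D).
Proof. by rewrite searchE; elim: (size D).+1 => //= n IH; exact: grow_tree. Qed.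

Lemma search_closed : closed_under (search tl hd s D).
Proof.
have key n : n <= size (iter n (grow tl hd s D) [::]) \/
    closed_under (iter n (grow tl hd s D) [::]).
  elim: n => [|n IH] /=; first by left.
  set T := iter n _ _ in IH *.
  case: (leqP (size (grow tl hd s D T)) (size T)) => [/grow_stable[-> cl]|lt]; first by right.
  case: IH => [le|cl]; first by left; exact: leq_ltn_trans le lt.
  by right; rewrite grow_closed.
rewrite searchE; case: (key (size D).+1) => //.
have := search_treeP; rewrite searchE => /search_tree_uniq[uT sT] h.
by have := leq_trans h (uniq_leq_size uT sT); rewrite ltnn.
Qed.

Lemma reached_sub S T : search_tree T -> S s -> out S D = 0 -> {subset reach T <= S}.
Proof.
move=> hT Ss /eqP; rewrite eqn0Ngt -has_count => /hasPn h.
elim: T hT => [_ x|a T IH /= /and4P[aD ta _ /IH{}IH] x].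
  by rewrite !inE => /eqP ->.
rewrite !inE orbCA => /orP[/eqP ->|xT]; last by apply: IH; rewrite inE.
by move: (h a aD); rewrite -[S (tl a)]/(tl a \in S) IH //= negbK.
Qed.

(** The balance over every vertex set is all that is ever used of a path: it leaves [S] as often as
    it enters [S], up to a correction for the two ends. Being a subsequence of the tree makes its
    arcs distinct. *)
Lemma back_pathP T t : search_tree T -> t \in reach T ->
  subseq (back_path tl hd t T) T /\
  forall S, out S (back_path tl hd t T) + S t = into S (back_path tl hd t T) + S s.
Proof.
elim: T t => [|a T IH] t /=; first by rewrite !inE => _ /eqP ->.
case/and4P=> aD ta na hT; case: eqVneq => [<- _|ne ht].
  have [sub bal] := IH _ hT ta; split=> [|S]; first by rewrite /= eqxx.
  have := bal S; rewrite /out /into /=; case: (S (tl a)); case: (S (hd a)) => /=; lia.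
have tT : t \in reach T.
  by move: ht; rewrite !inE [t == hd a]eq_sym (negbTE ne).
have [sub bal] := IH t hT tT; split=> //.
exact: subseq_trans sub (subseq_cons _ _).
Qed.

End SearchTheory.

Section SwapPath.
Local Notation aout := (@out _ _ (@fst vertex vertex) (@snd vertex vertex)).
Local Notation ainto := (@into _ _ (@fst vertex vertex) (@snd vertex vertex)).

Lemma count_swap_first (P : pred (vertex * vertex)) a (D : arcs) :
  a \in D -> count P (swap_first a D) + P a = count P D + P (swap a).
Proof.
elim: D => //= b D IH; rewrite inE eq_sym; case: eqP => [->|_] /=; first lia.
by move/IH; lia.
Qed.

Lemma mem_swap_first a b (D : arcs) : b != a -> b \in D -> b \in swap_first a D.
Proof.
move=> ba; elim: D => //= c D IH; rewrite inE => /orP[/eqP <-|bD].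
  by rewrite (negbTE ba) mem_head.
by case: eqP => _; rewrite inE ?bD ?IH ?orbT.
Qed.

(** The arcs of [p] are distinct, so reversing some of them leaves the others in place to be
    reversed in turn. *)
Lemma out_swap_path (S : pred vertex) (p D : arcs) : uniq p -> {subset p <= D} ->
  aout S (foldr swap_first D p) + aout S p = aout S D + ainto S p.
Proof.
elim: p => //= a p IH /andP[ap up] sD.
have {}IH := IH up (fun x xp => sD x (mem_behead (s := a :: p) xp)).
have aD : a \in foldr swap_first D p.
  have := sD a (mem_head _ _); elim: p ap {up sD IH} => //= b p IH.
  by rewrite inE negb_or => /andP[ab ap] aD; apply: mem_swap_first => //; exact: IH.
have := count_swap_first (fun a => S a.1 && ~~ S a.2) aD.
move: IH; rewrite /out /into /= [~~ S a.1 && _]andbC.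
by case: (S a.1); case: (S a.2) => /=; lia.
Qed.

Variables (s t : vertex).
Hypothesis st : s != t.

Definition reachable (D : arcs) : bool := t \in arc_reached s (arc_search s D).

Lemma out_augment (S : pred vertex) D : reachable D -> S s -> ~~ S t ->
  (aout S (augment s t D)).+1 = aout S D.
Proof.
rewrite /augment -/(reachable D) => tR Ss St; rewrite tR.
have hT := search_treeP fst snd s D.
have [sub bal] := back_pathP hT tR.
have [uT sT] := search_tree_uniq hT.
pose p := arc_path t (arc_search s D).
have {}bal : aout S p + S t = ainto S p + S s by exact: bal.
have := @out_swap_path S p D (subseq_uniq sub uT) (fun x xp => sT x (mem_subseq sub xp)).
by move: bal; rewrite Ss (negbTE St) -/p; lia.
Qed.

Lemma residualP D : exists k,
  [/\ forall S : pred vertex, S s -> ~~ S t -> aout S (residual s t D) + k = aout S D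
    & ~~ reachable (residual s t D)].
Proof.
have -> : residual s t D = iter (size D) (augment s t) D.
  exact: foldr_iter.
have key n : exists2 k, forall S : pred vertex, S s -> ~~ S t -> aout S (iter n (augment s t) D) + k = aout S D
    & (k == n) || ~~ reachable (iter n (augment s t) D).
  elim: n => [|n [k hk]] /=; first by exists 0 => // S _ _; rewrite addn0.
  set D' := iter _ _ _ in hk *; have [tR|tR _] := boolP (reachable D').
    rewrite orbF => /eqP kn; exists k.+1; last by rewrite kn eqxx.
    by move=> S Ss St; have := hk S Ss St; rewrite -(out_augment tR Ss St); lia.
  have -> : augment s t D' = D' by rewrite /augment -/(reachable D') (negbTE tR).
  by exists k => //; rewrite tR orbT.
have [k hk hn] := key (size D); exists k; split=> //.
(* Were [t] still reachable, all [size D] rounds would have succeeded, each taking an arc from the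
   cut around [s] alone, and one more round would succeed; but [D] has only [size D] arcs. *)
apply/negP => tR; rewrite tR orbF in hn.
have s1 : pred1 s s := eqxx s.
have t1 : ~~ pred1 s t by rewrite /= eq_sym.
have := hk _ s1 t1; rewrite -(out_augment tR s1 t1) (eqP hn).
have := count_size (fun a : vertex * vertex => pred1 s a.1 && ~~ pred1 s a.2) D.
by rewrite -/(aout (pred1 s) D); lia.
Qed.

(** All separating cuts drop by the same [k], so [D] and the residual network have the same minimum
    cuts. No residual arc leaves [R], so [R] attains [k]; any other separating set that attains [k]
    has no residual arc leaving it either, hence contains everything reached from [s]. *)
Lemma source_sideP D : let R := source_side s t D in exists k,
  [/\ s \in R, t \notin R, aout (mem R) D = k,
      forall S : pred vertex, S s -> ~~ S t -> k <= aout S D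
    & forall S : pred vertex, S s -> ~~ S t -> aout S D = k -> {subset R <= S}].
Proof.
move=> R; have [k [hk tR]] := residualP D; exists k.
have sR : s \in R by exact: mem_head.
have hT := search_treeP fst snd s (residual s t D).
split=> //.
- have <- := hk _ sR tR; rewrite -[RHS]add0n; congr addn.
  apply/eqP; rewrite eqn0Ngt -has_count; apply/hasPn => a aD.
  by apply/negP => /andP[/(search_closed aD) aR /negP]; exact.
- by move=> S Ss St; rewrite -(hk S Ss St) leq_addl.
- move=> S Ss St E; apply: (reached_sub hT Ss).
  by apply: (@addIn k); rewrite (hk S Ss St) E.
Qed.

End SwapPath.

(* A label [(a, b)] is the arc [a], reversed if [b] holds. *)
Section UnitFlow.
Variables (A : eqType) (W : eqType) (tl hd : A -> W) (s t : W).
Local Notation B := (A * bool)%type.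

Definition label_tl (x : B) : W := if x.2 then hd x.1 else tl x.1.
Definition label_hd (x : B) : W := if x.2 then tl x.1 else hd x.1.
Definition flip (x : B) : B := (x.1, ~~ x.2).

Local Notation lout := (out label_tl label_hd).
Local Notation linto := (into label_tl label_hd).

Lemma flipK : involutive flip.
Proof. by case=> a b; rewrite /flip /= negbK. Qed.

Lemma out_flip S p : lout S [seq flip x | x <- p] = linto S p.
Proof.
rewrite /out /into count_map; apply: eq_count => -[a b] /=.
by rewrite /label_tl /label_hd /=; case: b => /=; rewrite andbC.
Qed.

Lemma into_flip S p : linto S [seq flip x | x <- p] = lout S p.
Proof. by rewrite -out_flip -map_comp map_id_in// => x _; exact: flipK. Qed.

(** The argument of Ford and Fulkerson as an induction: for [k.+1], reversing one path lowers every
    cut by one, the residual network carries [k] units, and the path is added to them. A flow is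
    described by its balance over every vertex set. As first components in [D] are distinct, an arc
    and its reverse are never both present. *)
Lemma unit_flow k (D : seq B) : uniq [seq x.1 | x <- D] ->
  (forall S : pred W, S s -> ~~ S t -> k <= lout S D) ->
  exists F : seq B, [/\ uniq F, {subset F <= D} &
    forall S : pred W, lout S F + k * S t = linto S F + k * S s].
Proof.
elim: k D => [|k IH] D uD cut; first by exists [::].
have uD' := map_uniq uD.
have flipD x : x \in D -> flip x \notin D.
  move=> xD; apply/negP => fD; suff : x = flip x by case: x {xD fD} => a [].
  exact: (uniq_map_inj uD).
pose T := search label_tl label_hd s D.
have hT := search_treeP label_tl label_hd s D.
have [uT sT] := search_tree_uniq hT.
have tT : t \in reached label_hd s T.
  apply: contraT => tT; have := cut (mem (reached label_hd s T)) (mem_head _ _) tT.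
  suff -> : lout (mem (reached label_hd s T)) D = 0 by [].
  apply/eqP; rewrite eqn0Ngt -has_count; apply/hasPn => a aD.
  by apply/negP => /andP[/(search_closed aD) aR /negP]; exact.
have [sub balp] := back_pathP hT tT; set p := back_path _ _ _ _ in sub balp.
have up := subseq_uniq sub uT.
have sp x : x \in p -> x \in D by move=> /(mem_subseq sub)/sT.
pose rest := [seq x <- D | x \notin p].
have permD : perm_eq D (p ++ rest).
  apply: uniq_perm => //.
    rewrite cat_uniq up filter_uniq// andbT; apply/hasPn => x.
    by rewrite mem_filter => /andP[].
  move=> x; rewrite mem_cat mem_filter; case: (boolP (x \in p)) => //= /sp ->; by [].
have outD S : lout S D = lout S p + lout S rest.
  by rewrite /out (permP permD) count_cat.
have [F' [uF' sF' balF']] : exists F : seq B, [/\ uniq F, {subset F <= [seq flip x | x <- p] ++ rest}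
    & forall S : pred W, lout S F + k * S t = linto S F + k * S s].
  apply: IH => [|S Ss St].
    rewrite map_cat -map_comp (_ : [seq _ | x <- p] = [seq x.1 | x <- p])//.
    by rewrite -map_cat -(perm_uniq (perm_map _ permD)).
  have := cut S Ss St; rewrite outD; have := balp S; rewrite Ss (negbTE St).
  have -> : lout S ([seq flip x | x <- p] ++ rest) = linto S p + lout S rest.
    by rewrite -out_flip; exact: count_cat.
  by move: (lout S p) (linto S p) (lout S rest); clear; lia.
(* [p1] is the part of the path that is cancelled by reversed arcs in [F']. What remains is [p2],
   together with the arcs [F2] of [F'] that belong to [D]. *)
pose p1 := [seq x <- p | flip x \in F']; pose p2 := [seq x <- p | flip x \notin F'].
pose F2 := [seq x <- F' | x \in D].
have cp P : count P p = count P p1 + count P p2.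
  by rewrite -count_cat; apply/esym/permP; rewrite (perm_filterC (fun x => flip x \in F')).
have cF P : count P F' = count P F2 + count P [seq flip x | x <- p1].
  rewrite -count_cat; apply/esym/permP.
  rewrite -(permPr (permEl (perm_filterC (mem D) F'))) perm_cat2l.
  apply: uniq_perm; rewrite ?filter_uniq//.
    by rewrite map_inj_uniq ?filter_uniq//; exact: can_inj flipK.
  move=> x; rewrite -{1}(flipK x) mem_map; last exact: can_inj flipK.
  rewrite !mem_filter flipK /=; case xF: (x \in F'); rewrite ?andbF//= andbT.
  have := sF' _ xF; rewrite mem_cat mem_filter -{1}(flipK x) mem_map; last exact: can_inj flipK.
  case: (boolP (flip x \in p)) => [xp _|_ /= /andP[_ ->] //].
  by have := flipD _ (sp _ xp); rewrite flipK => ->.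
exists (p2 ++ F2); split.
- rewrite cat_uniq !filter_uniq// andbT; apply/hasPn => x; rewrite !mem_filter => /andP[xD xF].
  apply/negP => /andP[_ xp]; have := sF' _ xF; rewrite mem_cat mem_filter xp /= orbF.
  by move/mapP => [y yp xy]; have := flipD _ (sp _ yp); rewrite -xy xD.
- by move=> x; rewrite mem_cat !mem_filter => /orP[/andP[_ /sp]|/andP[]].
- move=> S; have := balF' S; have := balp S.
  have := cF (fun a => S (label_tl a) && ~~ S (label_hd a)).
  have := cF (fun a => ~~ S (label_tl a) && S (label_hd a)).
  have := cp (fun a => S (label_tl a) && ~~ S (label_hd a)).
  have := cp (fun a => ~~ S (label_tl a) && S (label_hd a)).
  rewrite /out /into !count_cat -!/(lout _ _) -!/(linto _ _) out_flip into_flip.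
  rewrite !mulSn; move: (lout S p) (lout S p1) (lout S p2) (lout S F') (lout S F2).
  move: (linto S p) (linto S p1) (linto S p2) (linto S F') (linto S F2).
  by move: (k * S s) (k * S t) (S s : nat) (S t : nat); clear; lia.
Qed.

End UnitFlow.

(** * Integral flows and cuts *)

Section Cuts.
Variables (V : finType) (E : seq (V * V)) (q : V -> nat).
Implicit Types (X : {set V} * {set V}) (S : pred (V * bool)).

Definition cut_size X : nat :=
  \sum_(w in boundary X) q w + count (fun e => covers e X) E.

Definition separates (u v : V) X : bool := [&& is_biset X, u \in X.1 & v \notin X.2].

(* [S] is a set of vertices of the split network. *)
Definition split_cut S : nat :=
  \sum_(e <- E) ((S (e.1, true) && ~~ S (e.2, false)) + (S (e.2, true) && ~~ S (e.1, false)))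
  + \sum_w q w * (S (w, false) && ~~ S (w, true)).

Definition biset_cut X : pred (V * bool) := fun w => if w.2 then w.1 \in X.1 else w.1 \in X.2.

Lemma sum_in_mul (A : {set V}) : \sum_(w in A) q w = \sum_w q w * (w \in A).
Proof. by rewrite big_mkcond; apply: eq_bigr => w _; case: (w \in A); rewrite ?muln1 ?muln0. Qed.

Lemma split_cut_biset X : is_biset X -> split_cut (biset_cut X) = cut_size X.
Proof.
move=> /subsetP bX; rewrite /split_cut /cut_size addnC; congr addn.
  by rewrite sum_in_mul; apply: eq_bigr => w _; rewrite /biset_cut !inE /= andbC.
rewrite -sum1_count [RHS]big_mkcond; apply: eq_bigr => -[x y] _; rewrite /covers /biset_cut /=.
move: (bX x) (bX y); case: (x \in X.1); case: (y \in X.1); case: (x \in X.2);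
  case: (y \in X.2) => //= hx hy; by [have := hx isT | have := hy isT].
Qed.

(** Not every vertex set comes from a biset. Adding the entrance of a node whose exit lies in [S],
    and removing the exit of [v] when its entrance is outside [S], does not enlarge the cut: an
    entrance leads only to its exit, and an exit is entered only from its entrance. *)
Definition cut_biset (v : V) S : {set V} * {set V} :=
  ([set w | S (w, true) && (w != v)],
   [set w | S (w, false) || S (w, true) && (w != v)]).

Lemma cut_biset_separates u v S : u != v -> S (u, true) -> ~~ S (v, false) ->
  separates u v (cut_biset v S).
Proof.
move=> uv Su Sv; rewrite /separates !inE Su uv (negbTE Sv) eqxx andbF /= andbT.
by apply/subsetP => w; rewrite !inE => ->; rewrite orbT.
Qed.

Lemma cut_biset_le v S : ~~ S (v, false) -> cut_size (cut_biset v S) <= split_cut S.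
Proof.
move=> Sv; rewrite /cut_size /split_cut addnC leq_add//.
  rewrite -sum1_count big_mkcond; apply: leq_sum => -[x y] _; rewrite /covers !inE /=.
  by case: (S (x, true)); case: (S (y, true)); case: (S (x, false)); case: (S (y, false));
    case: (x == v); case: (y == v).
rewrite sum_in_mul; apply: leq_sum => w _; rewrite leq_mul2l; apply/orP; right.
rewrite !inE; case: eqP => [->|_]; first by rewrite (negbTE Sv) andbF.
by case: (S (w, true)); case: (S (w, false)).
Qed.

End Cuts.

Section Flows.
Variables (V : finType) (E : seq (V * V)) (q : V -> nat) (u v : V).
Hypothesis uv : u != v.
Local Notation arc := (Defs.arc E).
Local Notation tail := (@arc_tail V E).
Local Notation head := (@arc_head V E).

Lemma card_in_sum (f : {set arc}) (g : arc -> V) (A : {set V}) :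
  \sum_(w in A) #|[set a in f | g a == w]| = #|[set a in f | g a \in A]|.
Proof.
rewrite -sum1_card (partition_big g (mem A)) => [|a]; last by rewrite inE => /andP[].
apply: eq_bigr => w wA; rewrite -sum1_card; apply: eq_bigl => a.
by rewrite !inE; case: eqP => [->|]; rewrite ?wA ?andbT ?andbF.
Qed.

Definition reverse (a : arc) : arc := (a.1, ~~ a.2).

Lemma count_edges (P : pred (V * V)) :
  count P E = #|[set i : 'I_(size E) | P (tnth (in_tuple E) i)]|.
Proof. by rewrite -sum1_count big_tnth -sum1_card; apply: eq_bigl => i; rewrite inE. Qed.

(** Conservation, summed over the inner part, makes the value the net flow out of it. An arc that
    leaves the inner part either enters the boundary, where capacities bound the inflow, or belongs
    to an edge covering [X]. *)
Lemma flow_value_le (f : {set arc}) X : is_flow q u v f -> separates u v X ->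
  flow_value u f <= cut_size E q X.
Proof.
case/andP=> /forallP simple /forallP cons /and3P[/subsetP bX uX vX].
have vX1 : v \notin X.1 by apply: contra vX; exact: bX.
have consV w : w \in X.1 -> w != u -> inflow f w = outflow f w.
  move=> wX wu; have := cons w; rewrite wu (_ : w != v) /=; last by apply: contra vX1 => /eqP <-.
  by case/andP=> /eqP.
have capV w : w \in boundary X -> inflow f w <= q w.
  rewrite inE => /andP[w1 w2]; have := cons w.
  rewrite (_ : w != u) /=; last by apply: contra w1 => /eqP ->.
  rewrite (_ : w != v) /=; last by apply: contra vX => /eqP <-.
  by case/andP.
have Eout : \sum_(w in X.1) outflow f w = #|[set a in f | tail a \in X.1]| by exact: card_in_sum.
have Ein : \sum_(w in X.1) inflow f w = #|[set a in f | head a \in X.1]| by exact: card_in_sum.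
have value : #|[set a in f | tail a \in X.1]| + inflow f u = #|[set a in f | head a \in X.1]| + outflow f u.
  rewrite -Eout -Ein (bigD1 u)//= [in RHS](bigD1 u)//=.
  rewrite [X in _ + X + _ = _](eq_bigr (fun w => inflow f w)); last by move=> w /andP[wX wu]; rewrite consV.
  lia.
have split : #|[set a in f | tail a \in X.1]| <= #|[set a in f | head a \in X.1]| +
    (#|[set a in f | head a \in boundary X]| + #|[set a in f | (tail a \in X.1) && (head a \notin X.2)]|).
  apply: leq_trans (leq_trans (leq_card_setU _ _) (leq_add (leqnn _) (leq_card_setU _ _))).
  apply/subset_leq_card/subsetP => a; rewrite !inE => /andP[-> ->] /=.
  by case: (head a \in X.1); case: (head a \in X.2).
have bound1 : #|[set a in f | head a \in boundary X]| <= \sum_(w in boundary X) q w.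
  by rewrite -card_in_sum; apply: leq_sum => w wX; exact: capV.
have bound2 : #|[set a in f | (tail a \in X.1) && (head a \notin X.2)]| <=
    count (fun e => covers e X) E.
  (* An edge carries flow in one direction only, so distinct arcs here belong to distinct edges. *)
  rewrite count_edges -(card_in_imset (f := fst)).
    apply/subset_leq_card/subsetP => i /imsetP[[j b]]; rewrite !inE => /and3P[_ tX hX] /= ->.
    move: tX hX; rewrite /arc_tail /arc_head /covers /=.
    by case: b => -> -> //=; rewrite orbT.
  move=> [i b] [j c]; rewrite !inE => /and3P[fi _ _] /and3P[fj _ _] /= ij; move: fi fj; rewrite -ij.
  by have := simple i; case: b; case: c => // /negP h ? ?; case: h; apply/andP.
rewrite /flow_value /cut_size; lia.
Qed.

(** Menger's theorem by way of the split network: an edge becomes two arcs that lead from the exit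
    of one end to the entrance of the other, and a node [w] becomes [q w] parallel arcs from its
    entrance to its exit. *)
Lemma exists_flow k : (forall X, separates u v X -> k <= cut_size E q X) ->
  exists2 f : {set arc}, is_flow q u v f & k <= flow_value u f.
Proof.
move=> cut.
(* Every node gets [Q] slots for parallel arcs, so that the arcs form a finite type; [valid] keeps
   the first [q w] slots of [w]. *)
pose Q := \sum_w q w.
pose A : finType := (arc + V * 'I_Q)%type.
pose tl (a : A) : V * bool := match a with inl a => (tail a, true) | inr (w, _) => (w, false) end.
pose hd (a : A) : V * bool := match a with inl a => (head a, false) | inr (w, _) => (w, true) end.
pose valid (a : A) := if a is inr (w, j) then j < q w else true.
pose D0 := [seq (a, false) | a <- enum A & valid a].
have qQ w : q w <= Q by rewrite /Q (bigD1 w)//= leq_addr.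
have card_lt n : n <= Q -> \sum_(j < Q) (j < n) = n.
  move=> nQ; rewrite -[RHS](card_ord n) -sum1_card.
  rewrite (big_ord_widen Q (fun=> 1))// [RHS]big_mkcond.
  by apply: eq_bigr => j _; case: ltnP.
have outE S : out (label_tl tl hd) (label_hd tl hd) S D0 = split_cut E q S.
  transitivity (\sum_(a : A) (S (tl a) && ~~ S (hd a)) * valid a).
    rewrite /out count_map count_filter -sum1_count big_enum_cond big_mkcond.
    by apply: eq_bigr => a _ /=; rewrite mulnb; case: ifP.
  rewrite big_sumType /split_cut; congr addn.
    transitivity (\sum_(i < size E) \sum_(b : bool) (S (tl (inl (i, b))) && ~~ S (hd (inl (i, b))))).
      by rewrite pair_bigA; apply: eq_bigr => -[i b] _; rewrite muln1.
    by rewrite big_tnth; apply: eq_bigr => i _; rewrite big_bool.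
  transitivity (\sum_w \sum_(j < Q) (S (w, false) && ~~ S (w, true)) * (j < q w)).
    by rewrite pair_bigA; apply: eq_bigr => -[w j].
  by apply: eq_bigr => w _; rewrite -big_distrr card_lt// mulnC.
have [|S Ss St|F [uF sF balF]] := @unit_flow A (V * bool)%type tl hd (u, true) (v, false) k D0.
- by rewrite -map_comp map_id filter_uniq// enum_uniq.
- rewrite outE; apply: leq_trans (cut _ (cut_biset_separates uv Ss St)) _.
  exact: cut_biset_le.
pose FA := [set a : A | (a, false) \in F].
have countF P : count P F = #|[set a in FA | P (a, false)]|.
  have perm : perm_eq F [seq (a, false) | a <- enum FA].
    apply: uniq_perm => //; first by rewrite map_inj_uniq ?enum_uniq// => a b [].
    move=> [a b]; apply/idP/mapP => [aF|[c]]; last by rewrite mem_enum inE => cF [-> ->].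
    have /mapP[c _ [ca bf]] := sF _ aF; exists a; last by rewrite bf.
    by rewrite mem_enum inE -bf.
  rewrite (permP perm) count_map -size_filter -sum1_size big_filter big_enum_cond -sum1_card.
  by apply: eq_bigl => a; rewrite inE.
pose In w := #|[set x in FA | hd x == (w, false)]|.
pose Out w := #|[set x in FA | tl x == (w, true)]|.
pose N w := #|[set x in FA | tl x == (w, false)]|.
have bal_in w : w != v -> N w = In w.
  move=> wv; have := balF (pred1 (w, false)); rewrite /out /into !countF /= !xpair_eqE andbF muln0.
  rewrite eqxx andbT eq_sym (negbTE wv) muln0 !addn0 => E1.
  transitivity #|[set x in FA | (tl x == (w, false)) && (hd x != (w, false))]|.
    by apply: eq_card => -[a|[x j]]; rewrite !inE /= !xpair_eqE !andbF /= ?andbT ?andbF.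
  rewrite {}E1; apply: eq_card => -[a|[x j]]; rewrite !inE.
    by rewrite /= /label_tl /label_hd /= !xpair_eqE !andbF.
  by rewrite /= /label_tl /label_hd /= !xpair_eqE !andbF.
have bal_out w : Out w = N w + k * (w == u).
  have := balF (pred1 (w, true)); rewrite /out /into !countF /= !xpair_eqE andbF muln0 addn0.
  rewrite eqxx andbT [u == w]eq_sym => E1.
  transitivity #|[set x in FA | (tl x == (w, true)) && (hd x != (w, true))]|.
    by apply: eq_card => -[a|[x j]]; rewrite !inE /= !xpair_eqE !andbF /= ?andbT ?andbF.
  rewrite {}E1; congr addn; apply: eq_card => -[a|[x j]]; rewrite !inE //=.
    by rewrite /label_tl /label_hd /= !xpair_eqE !andbF.
  by rewrite /label_tl /label_hd /= !xpair_eqE !andbF.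
have N_le w : N w <= q w.
  rewrite -[leqRHS](card_lt _ (qQ w)) -big_mkcond sum1_card.
  rewrite -(card_imset _ (_ : injective (fun j : 'I_Q => inr (w, j) : A))); last by move=> i j [].
  apply/subset_leq_card/subsetP => -[a|[x j]]; rewrite !inE => /andP[xF /eqP[]] // xw.
  have /mapP[y] := sF _ xF; rewrite mem_filter => /andP[hy _] [E1].
  by apply/imsetP; exists j; rewrite ?xw//; move: hy; rewrite -E1 /= xw.
(* The unit flow may use an edge in both directions, which [is_flow] forbids. Such pairs of opposite
   arcs are deleted; they contribute equally to inflow and outflow at every node, as counted by
   [Z]. *)
pose f := [set a : arc | (inl a \in FA) && (inl (reverse a) \notin FA)].
pose Z (g : arc -> V) w := #|[set a : arc | [&& inl a \in FA, inl (reverse a) \in FA & g a == w]]|.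
have reverseK : involutive reverse by case=> i b; rewrite /reverse /= negbK.
have head_reverse a : head (reverse a) = tail a by case: a => i [].
have Zeq w : Z head w = Z tail w.
  rewrite /Z -(card_imset _ (inv_inj reverseK)); apply: eq_card => a.
  apply/imsetP/idP => [[b]|]; rewrite !inE.
    by case/and3P=> h1 h2 h3 ->; rewrite reverseK h1 h2 -head_reverse reverseK.
  case/and3P=> h1 h2 h3; exists (reverse a); last by rewrite reverseK.
  by rewrite !inE reverseK h1 h2 head_reverse.
have flowE (g : arc -> V) w : #|[set a in f | g a == w]| + Z g w = #|[set a : arc | (inl a \in FA) && (g a == w)]|.
  rewrite -(cardsID [set a | inl (reverse a) \in FA] [set a | (inl a \in FA) && (g a == w)]) addnC.
  by congr addn; apply: eq_card => a; rewrite !inE;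
    case: ((inl a, false) \in F); case: ((inl (reverse a), false) \in F); case: (g a == w).
have inlE (P : pred A) : (forall x, ~~ P (inr x)) ->
    #|[set x in FA | P x]| = #|[set a : arc | (inl a \in FA) && P (inl a)]|.
  move=> Pr; rewrite -[RHS](card_imset _ (_ : injective (inl : arc -> A))); last by move=> i j [].
  apply: eq_card => -[a|x]; rewrite !inE.
    by apply/idP/imsetP => [h|[b]]; [exists a; rewrite // !inE|rewrite !inE => h [->]].
  by rewrite (negbTE (Pr x)) andbF; apply/esym/negbTE/imsetP => -[].
have inflowE w : inflow f w + Z head w = In w.
  rewrite flowE /In inlE; last by case=> x j; rewrite /= xpair_eqE andbF.
  by apply: eq_card => a; rewrite !inE /= xpair_eqE andbT.
have outflowE w : outflow f w + Z tail w = Out w.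
  rewrite flowE /Out inlE; last by case=> x j; rewrite /= xpair_eqE andbF.
  by apply: eq_card => a; rewrite !inE /= xpair_eqE andbT.
exists f.
  apply/andP; split.
    apply/forallP => i; apply/negP => /andP[]; rewrite !inE /reverse /=.
    by case/andP=> h _ /andP[_]; rewrite h.
  apply/forallP => w; apply/implyP => /andP[wu wv].
  have := inflowE w; have := outflowE w; have := bal_in w wv; have := bal_out w.
  have := N_le w; have := Zeq w; rewrite (negbTE wu) muln0 addn0; lia.
have := inflowE u; have := outflowE u; have := bal_in u uv; have := bal_out u.
by have := Zeq u; rewrite eqxx muln1 /flow_value; lia.
Qed.

Lemma max_flow_cut k : (forall X, separates u v X -> k <= cut_size E q X) ->
  k <= max_flow E q u v.
Proof.
by move=> /exists_flow[f ff kf]; apply: leq_trans kf _; exact: leq_bigmax_cond.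
Qed.

Lemma max_flow_le X : separates u v X -> max_flow E q u v <= cut_size E q X.
Proof. by move=> sX; apply/bigmax_leqP => f ff; exact: flow_value_le. Qed.

End Flows.

(** * Least minimum cuts read off the split digraph *)

Section Sides.
Variables (n : nat) (E : seq ('I_n * 'I_n)) (q : 'I_n -> nat).
Local Notation V := 'I_n.
Local Notation es := [seq (val e.1, val e.2) | e <- E].
Local Notation cs := [seq q w | w <- enum V].
Local Notation aout := (@out _ _ (@fst vertex vertex) (@snd vertex vertex)).
Implicit Types (S : pred vertex).

Lemma count_copies (P : pred (vertex * vertex)) a c l :
  count P (copies a c l) = minn c (size l) * P a.
Proof.
rewrite /copies; set st := foldr _ _ _.
suff [_ -> //] : st.1 = size l /\ count P st.2 = minn c (size l) * P a.
rewrite {}/st; elim: l => [|e l [IH1 IH2]] /=; first by rewrite minn0.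
rewrite IH1; split=> //; case: ltnP => h /=; rewrite IH2.
  by rewrite (minn_idPr h) (minn_idPr (ltnW h)) mulSn.
by rewrite (minn_idPl h) (minn_idPl (leqW h)).
Qed.

Lemma out_node_arcs S l k (c : seq nat) : aout S (node_arcs l k c) =
  \sum_(0 <= i < size c) minn (nth 0 c i) (size l) * (S (k + i, false) && ~~ S (k + i, true)).
Proof.
elim: c k => [|x c IH] k; first by rewrite big_nil.
rewrite [size _]/= big_nat_recl// addn0 /= /out count_cat count_copies -/(aout S _) IH.
by congr addn; apply: eq_bigr => i _; rewrite addSnnS.
Qed.

Lemma out_edge_arcs S : aout S (edge_arcs es) =
  \sum_(e <- E) ((S (val e.1, true) && ~~ S (val e.2, false)) +
    (S (val e.2, true) && ~~ S (val e.1, false))).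
Proof.
elim: E => [|e l IH]; first by rewrite big_nil.
by rewrite big_cons -IH /out /= addnA.
Qed.

Definition trunc_cap (w : V) : nat := minn (q w) (size E).+1.

Lemma out_split_arcs S :
  aout S (split_arcs es cs) = split_cut E trunc_cap (fun w => S (val w.1, w.2)).
Proof.
rewrite /out count_cat -!/(aout S _) out_edge_arcs out_node_arcs; congr addn.
rewrite size_map size_enum_ord big_mkord /= size_map; apply: eq_bigr => i _.
by rewrite (nth_map i) ?size_enum_ord// nth_ord_enum.
Qed.

Lemma cut_size_trunc_le X : cut_size E trunc_cap X <= cut_size E q X.
Proof. by rewrite leq_add2r; apply: leq_sum => w _; exact: geq_minl. Qed.

(** A boundary node whose capacity is really truncated would contribute [(size E).+1] on its own. *)
Lemma cut_size_trunc X : cut_size E trunc_cap X <= size E ->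
  cut_size E q X = cut_size E trunc_cap X.
Proof.
move=> h; congr addn; apply: eq_bigr => w wX; apply/esym/minn_idPl.
rewrite leqNgt; apply/negP => lt; move: h; apply/negP; rewrite -ltnNge.
apply: leq_trans (leq_addr _ _); rewrite (bigD1 w)//=; apply: leq_trans (leq_addr _ _).
by rewrite /trunc_cap leq_min leqnn andbT ltnW.
Qed.

Definition lift_pred (S : pred (V * bool)) : pred vertex :=
  fun w => if insub w.1 is Some i then S (i, w.2) else false.

Lemma lift_predE (T : pred (V * bool)) i b : lift_pred T (val i, b) = T (i, b).
Proof. by rewrite /lift_pred valK. Qed.

Lemma out_lift X : is_biset X ->
  aout (lift_pred (biset_cut X)) (split_arcs es cs) = cut_size E trunc_cap X.
Proof.
move=> bX; rewrite out_split_arcs -split_cut_biset// /split_cut; congr addn.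
  by apply: eq_bigr => e _; rewrite !lift_predE.
by apply: eq_bigr => w _; rewrite !lift_predE.
Qed.

Variables (u v : V).
Hypothesis uv : u != v.

Let R := source_side (val u, true) (val v, false) (split_arcs es cs).

Lemma source_side_cut : exists X,
  [/\ separates u v X, cut_size E q X = max_flow E q u v,
      forall Y, separates u v Y -> cut_size E q Y = max_flow E q u v ->
        X.1 \subset Y.1 /\ X.2 \subset Y.2,
      forall w, (val w \in [seq w.1 | w <- R]) = (w \in X.2)
    & (forall w, w \in [seq w.1 | w <- [seq w <- R | w.2]] -> w < n) /\ forall w, (val w \in [seq w.1 | w <- [seq w <- R | w.2]]) = (w \in X.1)].
Proof.
have st : ((val u, true) : vertex) != (val v, false) by rewrite xpair_eqE andbF.
have [k [sR tR outR cutk minR]] := source_sideP st (split_arcs es cs).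
rewrite -/R in sR tR outR minR.
pose S (w : V * bool) := (val w.1, w.2) \in R.
pose X := cut_biset v S; exists X.
have sepX : separates u v X by apply: cut_biset_separates.
have lift_sep Y : separates u v Y ->
    lift_pred (biset_cut Y) (val u, true) /\ ~~ lift_pred (biset_cut Y) (val v, false).
  by case/and3P=> _ uY vY; rewrite !lift_predE.
have cutY Y : separates u v Y -> k <= cut_size E trunc_cap Y.
  move=> sY; have [h1 h2] := lift_sep _ sY.
  by case/and3P: sY => bY _ _; rewrite -out_lift//; exact: cutk.
have bX : is_biset X by case/and3P: sepX.
have cutX : cut_size E trunc_cap X = k.
  apply/eqP; rewrite eqn_leq cutY// andbT -outR out_split_arcs.
  exact: cut_biset_le.
(* The biset of [u] alone has an empty boundary, so the minimum is at most [size E] and truncation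
   does not change it. *)
have km : k <= size E.
  apply: leq_trans (cutY ([set u], [set u]) _) _.
    by rewrite /separates /is_biset subxx !inE eqxx eq_sym.
  rewrite /cut_size (_ : boundary _ = set0) ?big_set0 ?count_size//.
  by rewrite /boundary setDv.
have cutXq : cut_size E q X = k by rewrite cut_size_trunc ?cutX.
have flowk : max_flow E q u v = k.
  apply/eqP; rewrite eqn_leq -{1}cutXq max_flow_le//=.
  apply: max_flow_cut => // Y sY; apply: leq_trans (cutY _ sY) (cut_size_trunc_le _).
have subR Y : separates u v Y -> cut_size E q Y = k -> {subset R <= lift_pred (biset_cut Y)}.
  move=> sY cY; have [h1 h2] := lift_sep _ sY; apply: minR => //.
  have bY : is_biset Y by case/and3P: sY.
  by rewrite out_lift//; apply/eqP; rewrite eqn_leq cutY// andbT -cY cut_size_trunc_le.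
have memR (w : V) b Y : separates u v Y -> cut_size E q Y = k ->
    (val w, b) \in R -> w \in (if b then Y.1 else Y.2).
  move=> sY cY /(subR _ sY cY); rewrite -topredE /= lift_predE /biset_cut /=.
  by case: b.
(* [cut_biset] discards the exit of [v], but this exit is never reached: [X] itself attains the
   minimum, so [R] lies inside it. *)
have inX1 (w : V) : (w \in X.1) = ((val w, true) \in R).
  rewrite inE; case wR : ((val w, true) \in R); rewrite /S /= wR //=.
  by have := memR w true X sepX cutXq wR; rewrite inE => /andP[].
have inX2 (w : V) : (w \in X.2) = ((val w, false) \in R) || ((val w, true) \in R).
  by rewrite -inX1 !inE.
rewrite flowk; split=> //.
- move=> Y sY cY; have bY : Y.1 \subset Y.2 by case/and3P: sY.
  split; apply/subsetP => w; first by rewrite inX1 => /(memR _ _ _ sY cY).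
  rewrite inX2 => /orP[] /(memR _ _ _ sY cY) //.
  exact: (subsetP bY).
- move=> w; rewrite inX2; apply/mapP/orP => [[[x b] xR /= ->]|].
    by case: b xR; [right|left].
  by case=> wR; [exists (val w, false)|exists (val w, true)].
- split=> [_ /mapP[[w b]] + ->|w].
    rewrite mem_filter => /andP[_ /(subR _ sepX cutXq)].
    by rewrite -topredE /= /lift_pred /=; case: insubP.
  rewrite inX1; apply/mapP/idP => [[[x b]]|wR].
    by rewrite mem_filter /= => /andP[-> xR] ->.
  by exists (val w, true); rewrite ?mem_filter.
Qed.

End Sides.

(** * Uncrossing and the degree bound *)

Section Uncrossing.
Variables (V : finType) (E : seq (V * V)) (q : V -> nat).
Implicit Types X Y : {set V} * {set V}.

Definition bisetI X Y := (X.1 :&: Y.1, X.2 :&: Y.2).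
Definition bisetU X Y := (X.1 :|: Y.1, X.2 :|: Y.2).
Definition bisetD X Y := (X.1 :\: Y.2, X.2 :\: Y.1).
Definition bisetC X := (~: X.2, ~: X.1).

Lemma cut_size_sum X : cut_size E q X =
  \sum_w q w * (w \in boundary X) + \sum_(e <- E) covers e X.
Proof.
rewrite /cut_size sum_in_mul; congr addn; rewrite -sum1_count big_mkcond.
by apply: eq_bigr => e _; case: covers.
Qed.

(** Reduces an uncrossing inequality to counts at single nodes and edges, which are finite case
    checks. *)
Lemma cut_size_uncross X Y X' Y' :
  (forall w, (w \in boundary X') + (w \in boundary Y') <= (w \in boundary X) + (w \in boundary Y)) ->
  (forall e, covers e X' + covers e Y' <= covers e X + covers e Y) ->
  cut_size E q X' + cut_size E q Y' <= cut_size E q X + cut_size E q Y.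
Proof.
move=> hw he; rewrite !cut_size_sum addnACA [leqRHS]addnACA -!big_split /=.
by apply: leq_add; apply: leq_sum => i _; rewrite -?mulnDr ?leq_mul2l ?hw ?orbT.
Qed.

Lemma cut_size_submodular X Y : is_biset X -> is_biset Y ->
  cut_size E q (bisetI X Y) + cut_size E q (bisetU X Y) <= cut_size E q X + cut_size E q Y.
Proof.
move=> /subsetP bX /subsetP bY; apply: cut_size_uncross => [w|[x y]].
  move: (bX w) (bY w); rewrite !inE.
  by case: (w \in X.1); case: (w \in X.2); case: (w \in Y.1); case: (w \in Y.2) => //= h1 h2;
    by [have := h1 isT | have := h2 isT].
move: (bX x) (bY x) (bX y) (bY y); rewrite /covers !inE /=.
case: (x \in X.1); case: (x \in X.2); case: (x \in Y.1); case: (x \in Y.2);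
case: (y \in X.1); case: (y \in X.2); case: (y \in Y.1); case: (y \in Y.2) => //= h1 h2 h3 h4;
  by [have := h1 isT | have := h2 isT | have := h3 isT | have := h4 isT].
Qed.

Lemma cut_size_posimodular X Y : is_biset X -> is_biset Y ->
  cut_size E q (bisetD X Y) + cut_size E q (bisetD Y X) <= cut_size E q X + cut_size E q Y.
Proof.
move=> /subsetP bX /subsetP bY; apply: cut_size_uncross => [w|[x y]].
  move: (bX w) (bY w); rewrite !inE.
  by case: (w \in X.1); case: (w \in X.2); case: (w \in Y.1); case: (w \in Y.2) => //= h1 h2;
    by [have := h1 isT | have := h2 isT].
move: (bX x) (bY x) (bX y) (bY y); rewrite /covers !inE /=.
case: (x \in X.1); case: (x \in X.2); case: (x \in Y.1); case: (x \in Y.2);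
case: (y \in X.1); case: (y \in X.2); case: (y \in Y.1); case: (y \in Y.2) => //= h1 h2 h3 h4;
  by [have := h1 isT | have := h2 isT | have := h3 isT | have := h4 isT].
Qed.

Lemma covers_bisetC e X : covers e (bisetC X) = covers e X.
Proof.
rewrite /covers !inE !negbK.
by case: (e.1 \in X.1); case: (e.2 \in X.1); case: (e.1 \in X.2); case: (e.2 \in X.2).
Qed.

Lemma is_biset_bisetC X : is_biset (bisetC X) = is_biset X.
Proof. by rewrite /is_biset setCS. Qed.

Lemma cut_size_bisetC X : cut_size E q (bisetC X) = cut_size E q X.
Proof.
rewrite !cut_size_sum; congr addn; last by apply: eq_bigr => e _; rewrite covers_bisetC.
by apply: eq_bigr => w _; rewrite !inE negbK andbC.
Qed.

Lemma separates_bisetC u v X : separates u v (bisetC X) = separates v u X.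
Proof. by rewrite /separates is_biset_bisetC !inE negbK [_ && (v \in _)]andbC. Qed.

(** Complementation turns the cuts for one direction into cuts of the same size for the other, so no
    flow has to be reversed. *)
Lemma max_flowC u v : u != v -> max_flow E q u v = max_flow E q v u.
Proof.
wlog le : u v / max_flow E q u v <= max_flow E q v u => [h uv|uv].
  by case: (leqP (max_flow E q u v) (max_flow E q v u)) => [/h ->//|/ltnW/h ->//]; rewrite eq_sym.
apply/eqP; rewrite eqn_leq le /=; apply: max_flow_cut => // X sX.
by rewrite -cut_size_bisetC; apply: max_flow_le; rewrite 1?eq_sym// separates_bisetC.
Qed.

Lemma covers_separates d X : is_biset X -> covers d X =
  separates d.1 d.2 X || separates d.2 d.1 X.
Proof. by move=> bX; rewrite /covers /separates bX. Qed.

Lemma is_bisetI X Y : is_biset X -> is_biset Y -> is_biset (bisetI X Y).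
Proof. exact: setISS. Qed.

Lemma is_bisetU X Y : is_biset X -> is_biset Y -> is_biset (bisetU X Y).
Proof. exact: setUSS. Qed.

Lemma is_bisetD X Y : is_biset X -> is_biset Y -> is_biset (bisetD X Y).
Proof. exact: setDSS. Qed.

(** Each biset has the least cut among those covered by its pair. The ends of the pairs avoid both
    boundaries, so each end lies in one of four quadrants. For every placement submodularity,
    posimodularity or their combination forces the intersection or the difference to be a least cut
    for one of the pairs. Both of these lie inside [X], which is what minimality of sides needs. *)
Lemma uncross (d1 d2 : V * V) (r1 r2 : nat) X Y :
  is_biset X -> is_biset Y -> covers d1 X -> covers d2 Y ->
  cut_size E q X < r1 -> cut_size E q Y < r2 ->
  d1.1 \notin boundary Y -> d1.2 \notin boundary Y ->
  d2.1 \notin boundary X -> d2.2 \notin boundary X ->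
  (forall Z, is_biset Z -> covers d1 Z -> r1 <= (cut_size E q Z).+1) ->
  (forall Z, is_biset Z -> covers d2 Z -> r2 <= (cut_size E q Z).+1) ->
  exists2 Z, Z = bisetI X Y \/ Z = bisetD X Y &
    covers d1 Z && (cut_size E q Z < r1) || covers d2 Z && (cut_size E q Z < r2).
Proof.
move=> bX bY c1 c2 lt1 lt2 n11 n12 n21 n22 h1 h2.
have sub := cut_size_submodular bX bY; have pos := cut_size_posimodular bX bY.
have hI := (h1 _ (is_bisetI bX bY), h2 _ (is_bisetI bX bY)).
have hU := (h1 _ (is_bisetU bX bY), h2 _ (is_bisetU bX bY)).
have hD := (h1 _ (is_bisetD bX bY), h2 _ (is_bisetD bX bY)).
have hD' := (h1 _ (is_bisetD bY bX), h2 _ (is_bisetD bY bX)).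
suff [h|h] : (covers d1 (bisetI X Y) && (cut_size E q (bisetI X Y) < r1) ||
      covers d2 (bisetI X Y) && (cut_size E q (bisetI X Y) < r2)) \/
    (covers d1 (bisetD X Y) && (cut_size E q (bisetD X Y) < r1) ||
      covers d2 (bisetD X Y) && (cut_size E q (bisetD X Y) < r2)).
- by exists (bisetI X Y); [left|].
- by exists (bisetD X Y); [right|].
have n1X : (d1.1 \in boundary X = false) * (d1.2 \in boundary X = false).
  move: c1 (subsetP bX d1.1) (subsetP bX d1.2); rewrite /covers !inE.
  case: (d1.1 \in X.1); case: (d1.2 \in X.1); case: (d1.1 \in X.2); case: (d1.2 \in X.2) => //= _ k1 k2;
  by [split|have := k1 isT|have := k2 isT].
have n2Y : (d2.1 \in boundary Y = false) * (d2.2 \in boundary Y = false).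
  move: c2 (subsetP bY d2.1) (subsetP bY d2.2); rewrite /covers !inE.
  case: (d2.1 \in Y.1); case: (d2.2 \in Y.1); case: (d2.1 \in Y.2); case: (d2.2 \in Y.2) => //= _ k1 k2;
  by [split|have := k1 isT|have := k2 isT].
(* Off the boundary, membership in the inner and in the outer part agree, so eight bits describe the
   placement of the four ends. *)
have in2 (Z : {set V} * {set V}) w : is_biset Z -> w \in boundary Z = false -> (w \in Z.2) = (w \in Z.1).
  move=> /subsetP bZ; rewrite inE; case: (boolP (w \in Z.1)) => [/bZ|] //=.
have E1 := (in2 _ _ bX n1X.1, in2 _ _ bX n1X.2, in2 _ _ bY (negbTE n11), in2 _ _ bY (negbTE n12)).
have E2 := (in2 _ _ bY n2Y.1, in2 _ _ bY n2Y.2, in2 _ _ bX (negbTE n21), in2 _ _ bX (negbTE n22)).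
move: c1 c2 hI hU hD hD'; rewrite /covers !inE !E1 !E2 => c1 c2 [i1 i2] [u1 u2] [a1 a2] [b1 b2].
move: c1 c2 i1 i2 u1 u2 a1 a2 b1 b2.
move: lt1 lt2 sub pos; move: (cut_size _ _ _) (cut_size _ _ _) (cut_size _ _ (bisetI _ _)).
move: (cut_size _ _ (bisetU _ _)) (cut_size _ _ (bisetD X Y)) (cut_size _ _ (bisetD Y X)).
clear; move=> cU cD cD' cX cY cI lt1 lt2 sub pos.
case: (d1.1 \in X.1); case: (d1.2 \in X.1) => //= _; case: (d2.1 \in Y.1); case: (d2.2 \in Y.1) => //= _;
case: (d1.1 \in Y.1); case: (d1.2 \in Y.1); case: (d2.1 \in X.1); case: (d2.2 \in X.1) => //=; lia.
Qed.

End Uncrossing.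

(** Double counting: predecessors and successors have the same total over [J], at most [#|J| * b],
    while every member is related to each of the [#|J|.-1] others in at least one direction. *)
Lemma tournament_bound (T : finType) (J : {set T}) (N : rel T) b :
  {in J &, forall i j, i != j -> N i j || N j i} ->
  {in J, forall j, #|[set i in J | N i j]| <= b} -> #|J| <= 2 * b + 1.
Proof.
move=> tot deg; case: (posnP #|J|) => [->//|J0].
have sumC : \sum_(j in J) #|[set i in J | N i j]| = \sum_(j in J) #|[set i in J | N j i]|.
  transitivity (\sum_(j in J) \sum_(i in J) (N i j : nat)).
    apply: eq_bigr => j _; rewrite -sum1_card [RHS]big_mkcond [LHS]big_mkcond.
    by apply: eq_bigr => i _; rewrite inE; case: (i \in J); case: (N i j).
  rewrite exchange_big; apply: eq_bigr => j _; rewrite -sum1_card [RHS]big_mkcond [LHS]big_mkcond.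
  by apply: eq_bigr => i _; rewrite inE; case: (i \in J); case: (N j i).
have h : \sum_(j in J) #|J|.-1 <= \sum_(j in J) (#|[set i in J | N i j]| + #|[set i in J | N j i]|).
  apply: leq_sum => j jJ; rewrite -ltnS prednK// (cardsD1 j J) jJ add1n ltnS.
  apply: leq_trans (leq_card_setU _ _); apply/subset_leq_card/subsetP => i; rewrite !inE.
  by case/andP=> ij iJ; rewrite iJ; exact: tot.
have hb : \sum_(j in J) #|[set i in J | N i j]| <= \sum_(j in J) b by exact: leq_sum.
rewrite big_split /= -sumC !sum_nat_const in h hb.
have : #|J| * #|J|.-1 <= #|J| * (2 * b) by lia.
rewrite leq_pmul2l//; lia.
Qed.

Section TightBisets.
Variable P : instance.
Hypothesis wfP : well_formed P.
Local Notation V := 'I_(nodes P).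
Local Notation dcut := (cut_size (edges P) (cap P)).
Implicit Types (X Y Z : {set V} * {set V}) (d : V * V).

Lemma cap_gt0 w : 0 < cap P w.
Proof. by case/and4P: wfP => /forallP/(_ w). Qed.

Lemma demand_neq d : d \in demands P -> d.1 != d.2.
Proof. by case/and4P: wfP => _ _ _ /allP h /h. Qed.

Lemma lambda0 u v : lambda set0 u v = max_flow (edges P) (cap P) u v.
Proof. by rewrite /lambda enum_set0 /= cats0. Qed.

Lemma reqE d : req d = (max_flow (edges P) (cap P) d.1 d.2).+1.
Proof. by rewrite /req lambda0 addn1. Qed.

Lemma req_le_cut d X : d \in demands P -> is_biset X -> covers d X -> req d <= (dcut X).+1.
Proof.
move=> dP bX; rewrite covers_separates// reqE ltnS => /orP[sX|sX].
  by apply: max_flow_le => //; exact: demand_neq.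
by rewrite max_flowC ?demand_neq//; apply: max_flow_le; rewrite // eq_sym demand_neq.
Qed.

Lemma deficiencyE X : deficiency X = biset_req X - dcut X.
Proof. by []. Qed.

(** By weak duality a biset covered by the demand [d] has a cut of at least [req d - 1]. So the
    deficiency never exceeds 1, and a single demand witnesses that it is positive. *)
Lemma tightP X : reflect
  (exists2 d, d \in demands P & [/\ is_biset X, covers d X & dcut X < req d]) (tight X).
Proof.
rewrite /tight deficiencyE; apply: (iffP andP) => [[bX /eqP h]|[d dP [bX cX lt]]].
  have [/hasP[d dP /andP[cd lt]]|/hasPn no] :=
    boolP (has (fun d => covers d X && (dcut X < req d)) (demands P)); first by exists d.
  have : biset_req X <= dcut X.
    apply/bigmax_leqP_seq => d dP cd; rewrite leqNgt.
    by apply: contra (no d dP) => lt; rewrite cd.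
  by rewrite -subn_eq0 h.
split=> //; rewrite eqn_leq subn_gt0; apply/andP; split.
  rewrite leq_subLR addn1; apply/bigmax_leqP_seq => e eP ce; exact: req_le_cut.
by apply: leq_trans lt _; exact: leq_bigmax_seq.
Qed.

Lemma tight_bisetC X : tight (bisetC X) = tight X.
Proof.
by apply/tightP/tightP => -[d dP h]; exists d => //; move: h;
  rewrite is_biset_bisetC covers_bisetC cut_size_bisetC.
Qed.

Lemma req_le_kmax d : d \in demands P -> req d <= kmax P.
Proof. by move=> dP; apply: leq_bigmax_seq. Qed.

Lemma card_boundary_lt d X : dcut X < req d -> d \in demands P -> #|boundary X| < kmax P.
Proof.
move=> lt dP; apply: leq_ltn_trans (leq_trans lt (req_le_kmax dP)).
apply: leq_trans (leq_addr _ _); rewrite -sum1_card; apply: leq_sum => w _; exact: cap_gt0.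
Qed.

Lemma incident_not_boundary t d X : is_biset X -> covers d X -> incident t d -> t \notin boundary X.
Proof.
move=> bX; rewrite covers_separates// /separates bX /= inE negb_and negbK /incident.
by case/orP=> /andP[h1 h2] /orP[] /eqP <-; rewrite ?h1 ?h2 ?orbT.
Qed.

Section DegreeBound.
Variable Fam : {set {set V}}.
Hypothesis Fam_tight : forall S, S \in Fam -> exists X, [/\ tight X, Defs.root P \notin X.2 & X.1 = S].
Hypothesis Fam_below : forall X, tight X -> Defs.root P \notin X.2 -> exists2 S, S \in Fam & S \subset X.1.
Hypothesis Fam_antichain : forall S T, S \in Fam -> T \in Fam -> S \subset T -> S = T.

(** Otherwise uncrossing yields a tight biset whose inner part lies in [S] and whose outer part
    avoids the root. The member of [Fam] below it is [S] itself by the antichain property. If the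
    biset is the intersection, [S] then lies in [T] as well and equals it; if it is the difference,
    [S] misses [v]. *)
Lemma entangled S T d e X Y v : S \in Fam -> T \in Fam -> S != T -> v \in S -> v \in T ->
  d \in demands P -> e \in demands P ->
  is_biset X -> covers d X -> dcut X < req d -> Defs.root P \notin X.2 -> X.1 = S ->
  is_biset Y -> covers e Y -> dcut Y < req e -> Defs.root P \notin Y.2 -> Y.1 = T ->
  [exists t, incident t d && (t \in boundary Y)] || [exists t, incident t e && (t \in boundary X)].
Proof.
move=> SF TF ST vS vT dP eP bX cX lX aX X1 bY cY lY aY Y1.
apply: contraT; rewrite negb_or !negb_exists => /andP[/forallP h1 /forallP h2].
have free e' Z : (forall t, ~~ (incident t e' && (t \in boundary Z))) ->
    e'.1 \notin boundary Z /\ e'.2 \notin boundary Z.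
  move=> h; split; [have := h e'.1|have := h e'.2];
  by rewrite /incident eqxx ?orbT.
have [n11 n12] := free _ _ h1; have [n21 n22] := free _ _ h2.
have [Z hZ cov] := uncross bX bY cX cY lX lY n11 n12 n21 n22
  (fun Z bZ cZ => req_le_cut dP bZ cZ) (fun Z bZ cZ => req_le_cut eP bZ cZ).
have bZ : is_biset Z by case: hZ => ->; [exact: is_bisetI|exact: is_bisetD].
have tZ : tight Z by apply/tightP; case/orP: cov => /andP[cZ lZ]; [exists d|exists e].
have aZ : Defs.root P \notin Z.2 by case: hZ => ->; rewrite !inE (negbTE aX) ?andbF.
have [U UF UZ] := Fam_below tZ aZ.
have ZX : Z.1 \subset X.1 by case: hZ => ->; [exact: subsetIl|exact: subsetDl].
have US : U = S by apply: Fam_antichain => //; rewrite -X1; exact: subset_trans UZ ZX.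
case: hZ UZ => -> UZ.
  have UT : U = T by apply: Fam_antichain => //; rewrite -Y1; exact: subset_trans UZ (subsetIr _ _).
  by move: ST; rewrite -US UT eqxx.
move: vS; rewrite -US => /(subsetP UZ); rewrite inE.
by rewrite (subsetP bY) // Y1.
Qed.

Let select : exists f : {set V} -> ({set V} * {set V}) * (V * V), forall S, S \in Fam ->
  [/\ is_biset (f S).1, covers (f S).2 (f S).1, dcut (f S).1 < req (f S).2,
      (f S).2 \in demands P & Defs.root P \notin (f S).1.2 /\ (f S).1.1 = S].
Proof.
suff /boolp.choice[f hf] : forall S, exists f : ({set V} * {set V}) * (V * V), S \in Fam ->
    [/\ is_biset f.1, covers f.2 f.1, dcut f.1 < req f.2,
      f.2 \in demands P & Defs.root P \notin f.1.2 /\ f.1.1 = S] by exists f.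
move=> S; have [SF|_] := boolP (S \in Fam); last by exists ((set0, set0), (Defs.root P, Defs.root P)).
have [X [/tightP[d dP [bX cX lX]] aX X1]] := Fam_tight SF.
by exists (X, d).
Qed.

Lemma degree_bound v :
  (#|[set S in Fam | v \in S]| <= (4 * kmax P - 3) ^ 2) /\
  (star_at_root P -> #|[set S in Fam | v \in S]| <= 2 * kmax P - 1).
Proof.
have [f hf] := select.
set J := [set S in Fam | v \in S].
have [->|[S0 S0J]] := set_0Vmem J; first by rewrite cards0.
have FJ S : S \in J -> S \in Fam by rewrite inE => /andP[].
(* The empty case is settled beforehand because [kmax P] is 0 without demands, and then the
   subtractions in the bounds truncate. Here a member supplies a demand. *)
have k_gt0 : 0 < kmax P.
  have [_ _ lt dP _] := hf _ (FJ _ S0J).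
  exact: leq_ltn_trans (leq0n _) (card_boundary_lt lt dP).
pose bd S := boundary (f S).1.
have bd_le S : S \in J -> #|bd S| <= (kmax P).-1.
  move=> /FJ/hf[_ _ lt dP _]; rewrite -ltnS prednK//; exact: card_boundary_lt lt dP.
pose term S t := incident t (f S).2.
have tot : {in J &, forall S T, S != T ->
    [exists t, term S t && (t \in bd T)] || [exists t, term T t && (t \in bd S)]}.
  move=> S T SJ TJ ST; have SF := FJ _ SJ; have TF := FJ _ TJ.
  have [bX cX lX dP [aX X1]] := hf _ SF; have [bY cY lY eP [aY Y1]] := hf _ TF.
  move: SJ TJ; rewrite !inE => /andP[_ vS] /andP[_ vT].
  exact: (entangled SF TF ST vS vT dP eP bX cX lX aX X1 bY cY lY aY Y1).
have own S t : S \in J -> term S t -> t \notin bd S.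
  by move=> /FJ/hf[bX cX _ _ _]; exact: incident_not_boundary.
(* The common node [t] is an end of all these pairs and hence in none of the boundaries, so
   entanglement happens through the other ends. *)
have star t : #|[set S in J | term S t]| <= 2 * (kmax P).-1 + 1.
  pose other S := if (f S).2.1 == t then (f S).2.2 else (f S).2.1.
  have otherP S t' : term S t -> term S t' -> t' = t \/ t' = other S.
    rewrite /term /incident /other; case: eqP => [-> _ /orP[] /eqP -> | _ /= /eqP -> /orP[] /eqP ->];
    by [left|right].
  have term_other S : term S t -> term S (other S).
    by rewrite /term /incident /other; case: ifP => _ _; rewrite eqxx ?orbT.
  have tot' : {in [set S in J | term S t] &, forall S T, S != T ->
      (other S \in bd T) || (other T \in bd S)}.
    move=> S T; rewrite inE => /andP[SJ' St]; rewrite inE => /andP[TJ' Tt] ST.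
    case/orP: (tot S T SJ' TJ' ST) => /existsP[t' /andP[tt' bt']].
      case: (otherP _ _ St tt') => E; last by rewrite -E bt'.
      by move: bt'; rewrite E (negbTE (own _ _ TJ' Tt)).
    case: (otherP _ _ Tt tt') => E; last by rewrite -E bt' orbT.
    by move: bt'; rewrite E (negbTE (own _ _ SJ' St)).
  apply: (tournament_bound tot') => T; rewrite inE => /andP[TJ Tt].
  apply: leq_trans (bd_le _ TJ); rewrite -(card_in_imset (f := other)).
    by apply/subset_leq_card/subsetP => x /imsetP[S]; rewrite inE => /andP[_ h] ->.
  (* Distinct members have distinct other ends: a common one would lie in the boundary of one of the
     two bisets, although it is an end of both pairs. *)
  move=> S U; rewrite inE => /andP[SJt _]; rewrite inE => /andP[UJt _] E.
  apply/eqP; apply: contraT => SU; have := tot' _ _ SJt UJt SU.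
  move: SJt UJt; rewrite inE => /andP[SJ' St]; rewrite inE => /andP[UJ' Ut].
  rewrite E (negbTE (own _ _ UJ' (term_other _ Ut))) /=.
  by rewrite -E (negbTE (own _ _ SJ' (term_other _ St))).
split; last first.
  move=> star_P; have le : 2 * (kmax P).-1 + 1 <= 2 * kmax P - 1 by lia.
  apply: leq_trans le; apply: leq_trans (star (Defs.root P)); apply/subset_leq_card/subsetP => S SJ.
  rewrite inE SJ /=; have [_ _ _ dP _] := hf _ (FJ _ SJ); exact: star_P.
(* A predecessor of [T] has an end of its pair in the boundary of [T], and [star] bounds the number
   of members at each of these nodes. *)
have deg : {in J, forall T, #|[set S in J | [exists t, term S t && (t \in bd T)]]| <=
    (kmax P).-1 * (2 * (kmax P).-1 + 1)}.
  move=> T TJ.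
  have le : \sum_(t in bd T) #|[set S in J | term S t]| <= (kmax P).-1 * (2 * (kmax P).-1 + 1).
    apply: (@leq_trans (\sum_(t in bd T) (2 * (kmax P).-1 + 1))); first by apply: leq_sum => t _.
    by rewrite sum_nat_const leq_mul2r bd_le ?orbT.
  apply: leq_trans le.
  apply: (@leq_trans #|\bigcup_(t in bd T) [set S in J | term S t]|).
    apply/subset_leq_card/subsetP => S; rewrite inE => /andP[SJ /existsP[t /andP[St tT]]].
    by apply/bigcupP; exists t => //; rewrite inE SJ.
  elim/big_rec2: _ => [|t m U _ IH]; first by rewrite cards0.
  exact: leq_trans (leq_card_setU _ _) (leq_add (leqnn _) IH).
apply: leq_trans (tournament_bound tot deg) _.
case: (kmax P) k_gt0 => // k _ /=; rewrite -mulnn; nia.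
Qed.

End DegreeBound.
End TightBisets.

(** * The antichain of minimal sides *)

Lemma subseteqP (A B : seq nat) : reflect {subset A <= B} (subseteq A B).
Proof.
rewrite /subseteq -all_predC; apply: (iffP allP) => h x /h; rewrite /= ?negbK//.
Qed.

Lemma subseteq_trans A B C : subseteq A B -> subseteq B C -> subseteq A C.
Proof. by move=> /subseteqP AB /subseteqP BC; apply/subseteqP => x /AB/BC. Qed.

Lemma subseteq_refl A : subseteq A A.
Proof. exact/subseteqP. Qed.

Definition incomparable (A B : seq nat) : bool := ~~ subseteq A B && ~~ subseteq B A.

Lemma insert_pairwise S L : pairwise incomparable L -> pairwise incomparable (insert S L).
Proof.
rewrite /insert; case: ifP => // /hasPn no pL; rewrite pairwise_cons pairwise_filter// andbT.
by apply/allP => T; rewrite mem_filter => /andP[ST /no TS]; apply/andP.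
Qed.

Lemma mem_insert S L T : T \in insert S L -> T = S \/ T \in L.
Proof.
rewrite /insert; case: ifP => _; first by right.
by rewrite inE mem_filter => /orP[/eqP|/andP[]]; [left|right].
Qed.

Lemma insert_self S L : has (fun T => subseteq T S) (insert S L).
Proof.
by rewrite /insert; case: ifP => // _; apply/hasP; exists S; rewrite ?mem_head// subseteq_refl.
Qed.

(** Insertion deletes [T] only when [S], which lies below [T], enters the list. *)
Lemma insert_below S L A : has (fun T => subseteq T A) L -> has (fun T => subseteq T A) (insert S L).
Proof.
case/hasP=> T TL TA; rewrite /insert; case: ifP => _; first by apply/hasP; exists T.
have [ST|ST] := boolP (subseteq S T).
  by apply/hasP; exists S; rewrite ?mem_head//; exact: subseteq_trans TA.
by apply/hasP; exists T; rewrite // inE mem_filter ST TL orbT.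
Qed.

Section MinimalSides.
Variables (es : seq (nat * nat)) (cs : seq nat) (a : nat).
Local Notation side := (cut_side es cs a).
Local Notation add := (add_side es cs a).

Lemma add_side_pairwise u v L : pairwise incomparable L -> pairwise incomparable (add u v L).
Proof. by rewrite /add_side; elim: (side u v) => //= S l IH /IH; exact: insert_pairwise. Qed.

Lemma mem_add_side u v L T : T \in add u v L -> T \in side u v \/ T \in L.
Proof.
rewrite /add_side; elim: (side u v) => /= [|S l IH]; first by right.
case/mem_insert => [->|/IH[h|h]]; [|left|by right]; first by left; rewrite mem_head.
by rewrite inE h orbT.
Qed.

Lemma add_side_below u v L A :
  has (fun T => subseteq T A) L -> has (fun T => subseteq T A) (add u v L).
Proof. by rewrite /add_side; elim: (side u v) => //= S l IH /IH; exact: insert_below. Qed.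

Lemma add_side_self u v L S : S \in side u v -> has (fun T => subseteq T S) (add u v L).
Proof.
rewrite /add_side; elim: (side u v) => //= T l IH; rewrite inE => /orP[/eqP ->|/IH].
  exact: insert_self.
exact: insert_below.
Qed.

Lemma minimal_sides_pairwise ds : pairwise incomparable (minimal_sides es cs a ds).
Proof. by elim: ds => //= d ds IH; do 2 apply: add_side_pairwise. Qed.

Lemma mem_minimal_sides ds S : S \in minimal_sides es cs a ds ->
  exists2 d, d \in ds & S \in side d.1 d.2 \/ S \in side d.2 d.1.
Proof.
elim: ds => //= d ds IH /mem_add_side[h|/mem_add_side[h|/IH[e eds he]]].
- by exists d; rewrite ?mem_head; [|left].
- by exists d; rewrite ?mem_head; [|right].
- by exists e; rewrite // inE eds orbT.
Qed.

Lemma minimal_sides_below ds d S : d \in ds -> S \in side d.1 d.2 \/ S \in side d.2 d.1 ->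
  has (fun T => subseteq T S) (minimal_sides es cs a ds).
Proof.
elim: ds => //= e ds IH; rewrite inE => /orP[/eqP ->|/IH h /h hb]; last by do 2 apply: add_side_below.
by case=> [|h]; [exact: add_side_self|apply: add_side_below; exact: add_side_self].
Qed.

End MinimalSides.

Section InstanceSides.
Variable P : instance.
Hypothesis wfP : well_formed P.
Local Notation V := 'I_(nodes P).
Local Notation dcut := (cut_size (edges P) (cap P)).

Definition instance_sides : seq (seq nat) :=
  minimal_sides [seq (val e.1, val e.2) | e <- edges P] [seq cap P w | w <- enum V]
    (val (Defs.root P)) [seq (val d.1, val d.2) | d <- demands P].

Definition node_set (S : seq nat) : {set V} := [set w | val w \in S].

Lemma cut_side_spec (u v : V) : u != v -> exists X,
  [/\ separates u v X, dcut X = max_flow (edges P) (cap P) u v,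
      forall Y, separates u v Y -> dcut Y = max_flow (edges P) (cap P) u v ->
        X.1 \subset Y.1 /\ X.2 \subset Y.2 &
      let s := cut_side [seq (val e.1, val e.2) | e <- edges P] [seq cap P w | w <- enum V]
        (val (Defs.root P)) (val u) (val v) in
      if Defs.root P \in X.2 then s = [::] else
      exists S, [/\ s = [:: S], node_set S = X.1 & forall w, w \in S -> w < nodes P]].
Proof.
move=> uv; have [X [sX cX minX hX2 [hn hX1]]] := source_side_cut (edges P) (cap P) uv.
exists X; split=> //; rewrite /= /cut_side hX2; case: (Defs.root P \in X.2) => //.
by eexists; split=> //; apply/setP => w; rewrite inE hX1.
Qed.

(** The range of the entries is recorded because sides are lists of numbers, and [node_set] forgets
    entries that are not nodes. *)
Lemma instance_sides_tight S : S \in instance_sides ->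
  (exists X, [/\ tight X, Defs.root P \notin X.2 & X.1 = node_set S]) /\
  forall w, w \in S -> w < nodes P.
Proof.
case/mem_minimal_sides => _ /mapP[d dP ->] /= h.
have dn := demand_neq wfP dP.
have key u v : u != v -> covers (u, v) =1 covers d ->
    max_flow (edges P) (cap P) u v = max_flow (edges P) (cap P) d.1 d.2 ->
    S \in cut_side [seq (val e.1, val e.2) | e <- edges P] [seq cap P w | w <- enum V]
        (val (Defs.root P)) (val u) (val v) ->
    (exists X, [/\ tight X, Defs.root P \notin X.2 & X.1 = node_set S]) /\
    forall w, w \in S -> w < nodes P.
  move=> uv cov flow; have [X [sX cX _ /=]] := cut_side_spec uv.
  case: ifP => [_ -> //|aX [T [-> TX Tn]]]; rewrite inE => /eqP ->.
  split=> //; exists X; rewrite aX; split=> //.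
  apply/(tightP wfP); exists d => //; have bX : is_biset X by case/and3P: sX.
  by split=> //; [rewrite -cov covers_separates// sX|rewrite reqE cX flow].
case: h; apply: key => //; first by rewrite eq_sym.
- by move=> X; rewrite /covers /= orbC.
- by apply: max_flowC; rewrite eq_sym.
Qed.

(** A tight biset is a minimum cut for a demand in one of its orientations. The least minimum cut of
    that orientation lies inside it in both components, so it avoids the root as well, and its side
    was offered for insertion. *)
Lemma instance_sides_below X : tight X -> Defs.root P \notin X.2 ->
  exists2 S, S \in instance_sides & node_set S \subset X.1.
Proof.
move=> /(tightP wfP)[d dP [bX cX lX]] aX; have dn := demand_neq wfP dP.
have cutX : dcut X = max_flow (edges P) (cap P) d.1 d.2.
  by apply/eqP; rewrite eqn_leq -ltnS -reqE lX -ltnS -reqE (req_le_cut wfP).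
have key u v : u != v -> separates u v X -> dcut X = max_flow (edges P) (cap P) u v ->
    (forall S, S \in cut_side [seq (val e.1, val e.2) | e <- edges P] [seq cap P w | w <- enum V]
        (val (Defs.root P)) (val u) (val v) -> has (fun T => subseteq T S) instance_sides) ->
    exists2 S, S \in instance_sides & node_set S \subset X.1.
  move=> uv sX cuv; have [Y [_ _ /(_ X sX cuv)[Y1 Y2] /=]] := cut_side_spec uv.
  rewrite (negbTE (contra (subsetP Y2 _) aX)) => -[S [-> SY _]] /(_ S (mem_head _ _)).
  case/hasP=> T TU /subseteqP TS; exists T => //.
  apply: subset_trans Y1; rewrite -SY; apply/subsetP => w; rewrite !inE; exact: TS.
have dM := map_f (fun d : V * V => (val d.1, val d.2)) dP.
move: cX; rewrite covers_separates// => /orP[sX|sX].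
  by apply: (key _ _ dn sX cutX) => S hS; apply: minimal_sides_below dM _; left.
apply: (key d.2 d.1) => //; first by rewrite eq_sym.
  by rewrite cutX; exact: max_flowC.
by move=> S hS; apply: minimal_sides_below dM _; right.
Qed.

Lemma node_set_sub S T : S \in instance_sides -> node_set S \subset node_set T -> subseteq S T.
Proof.
move=> /instance_sides_tight[_ Sn] /subsetP ST; apply/subseteqP => w wS.
by have := ST (Ordinal (Sn _ wS)); rewrite !inE; apply.
Qed.

Definition side_family : {set {set V}} := [set A | A \in map node_set instance_sides].

Lemma instance_sides_antichain S T :
  S \in instance_sides -> T \in instance_sides -> subseteq S T -> S = T.
Proof.
move=> SU TU ST; apply/eqP; apply: contraT => ne.
have /(pairwiseP [::]) pw := minimal_sides_pairwise [seq (val e.1, val e.2) | e <- edges P]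
  [seq cap P w | w <- enum V] (val (Defs.root P)) [seq (val d.1, val d.2) | d <- demands P].
case: (ltngtP (index S instance_sides) (index T instance_sides)) => [lt|lt|eq].
- have := pw _ _ _ _ lt; rewrite !inE !index_mem !nth_index// => /(_ SU TU).
  by rewrite /incomparable ST.
- have := pw _ _ _ _ lt; rewrite !inE !index_mem !nth_index// => /(_ TU SU).
  by rewrite /incomparable ST andbF.
- by move: ne; rewrite -(nth_index [::] SU) eq nth_index ?eqxx.
Qed.

Lemma instance_sides_uniq : uniq instance_sides.
Proof.
rewrite uniq_pairwise; apply: sub_pairwise (minimal_sides_pairwise _ _ _ _) => S T /andP[h _].
by apply: contra h => /eqP ->; exact: subseteq_refl.
Qed.

Lemma node_set_inj : {in instance_sides &, injective node_set}.
Proof.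
by move=> S T SU TU E; apply: instance_sides_antichain => //; apply: node_set_sub; rewrite ?E.
Qed.

Lemma side_family_antichain A B : A \in side_family -> B \in side_family -> A \subset B -> A = B.
Proof.
rewrite !inE => /mapP[S SU ->] /mapP[T TU ->] /(node_set_sub SU) ST.
by rewrite (instance_sides_antichain SU TU ST).
Qed.

Lemma count_sides (w : V) : (count (fun S => val w \in S) instance_sides <= (4 * kmax P - 3) ^ 2) /\
  (star_at_root P -> count (fun S => val w \in S) instance_sides <= 2 * kmax P - 1).
Proof.
have le : count (fun S => val w \in S) instance_sides <= #|[set A in side_family | w \in A]|.
  have fU S : S \in [seq S <- instance_sides | val w \in S] -> S \in instance_sides.
    by rewrite mem_filter => /andP[].
  rewrite -size_filter -(size_map node_set) cardE; apply: uniq_leq_size.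
    rewrite map_inj_in_uniq ?filter_uniq ?instance_sides_uniq// => S T /fU SU /fU TU.
    exact: node_set_inj.
  move=> A /mapP[S]; rewrite mem_filter => /andP[wS SU] ->.
  by rewrite mem_enum !inE map_f.
have [||h1 h2] := degree_bound wfP _ _ side_family_antichain w.
- by move=> A; rewrite inE => /mapP[S SU ->]; have [] := instance_sides_tight SU.
- move=> X tX aX; have [S SU SX] := instance_sides_below tX aX.
  by exists (node_set S) => //; rewrite inE map_f.
by split=> [|/h2 h2']; [exact: leq_trans le h1|exact: leq_trans le h2'].
Qed.

End InstanceSides.

(** * The greedy algorithm *)

Section Greedy.
Variable R : realType.
Local Open Scope ring_scope.
Local Notation H := (harmonic_sum R).

Lemma harmonic_sum_le m n : (m <= n)%N -> H m <= H n.
Proof.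
move=> mn; rewrite /harmonic_sum (@big_cat_nat _ _ _ m.+1 1 n.+1)//= lerDl.
by apply: sumr_ge0 => i _; rewrite invr_ge0 ler0n.
Qed.

(** Each of the last [n - m] terms of the sum is at least [1 / n]. *)
Lemma harmonic_sum_step m n : (m <= n)%N -> H m + (n - m)%:R / n%:R <= H n.
Proof.
move=> mn; rewrite /harmonic_sum (@big_cat_nat _ _ _ m.+1 1 n.+1)//= lerD2l.
rewrite mulrC mulr_natr -subSS -sumr_const_nat; apply: ler_sum_nat => i /andP[mi ni].
by rewrite lef_pV2 ?posrE ?ler_nat ?ltr0n//; lia.
Qed.

Definition price (x : llink) : R := x.2.2.1%:R / x.2.2.2%:R.

Lemma price_ge0 x : 0 <= price x.
Proof. by rewrite divr_ge0. Qed.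

Variable L : seq llink.
Hypothesis den_gt0 : {in L, forall x, 0 < x.2.2.2}%N.

Lemma cheaperE U x y : x \in L -> y \in L ->
  cheaper U x y = (price x * (hits y U)%:R <= price y * (hits x U)%:R).
Proof.
move=> xL yL; have x0 := den_gt0 xL; have y0 := den_gt0 yL.
have b0 : x.2.2.2%:R != 0 :> R by rewrite pnatr_eq0 -lt0n.
have d0 : y.2.2.2%:R != 0 :> R by rewrite pnatr_eq0 -lt0n.
have bd : 0 < (x.2.2.2%:R * y.2.2.2%:R)^-1 :> R by rewrite invr_gt0 mulr_gt0 ?ltr0n.
rewrite /cheaper -(ler_nat R) !natrM /price -(ler_pM2r bd).
by congr (_ <= _); field; rewrite ?b0 ?d0.
Qed.

Lemma bestP U : match best U L with
  | [::] => {in L, forall z, hits z U = 0%N}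
  | x :: _ => [/\ x \in L, (0 < hits x U)%N &
      {in L, forall z, (0 < hits z U)%N -> price x / (hits x U)%:R <= price z / (hits z U)%:R}]
  end.
Proof.
suff : forall L', {subset L' <= L} -> match best U L' with
    | [::] => {in L', forall z, hits z U = 0%N}
    | x :: _ => [/\ x \in L', (0 < hits x U)%N &
        {in L', forall z, (0 < hits z U)%N -> price x / (hits x U)%:R <= price z / (hits z U)%:R}]
    end by exact.
elim=> //= x L' IH sL.
have xL : x \in L by apply: sL; exact: mem_head.
have sL' : {subset L' <= L} by move=> z zL; apply: sL; rewrite inE zL orbT.
have {}IH := IH sL'.
case: ifP => [/eqP x0|/negbT]; last rewrite -lt0n => x0.
  case: (best U L') IH => [|y b] IH.
    by move=> z; rewrite inE => /orP[/eqP ->//|]; exact: IH.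
  case: IH => yL y0 ymin; split=> //; first by rewrite inE yL orbT.
  by move=> z; rewrite inE => /orP[/eqP ->|]; [rewrite x0|exact: ymin].
case: (best U L') IH => [IH|y b [yL y0 ymin]].
  split=> //; first exact: mem_head.
  by move=> z; rewrite inE => /orP[/eqP ->//|/IH ->].
have : cheaper U x y = (price x / (hits x U)%:R <= price y / (hits y U)%:R).
  by rewrite (cheaperE _ xL (sL' _ yL)) ler_pdivrMr ?ltr0n// [X in _ = (_ <= X)]mulrAC ler_pdivlMr ?ltr0n.
case: ifP => _ le.
  split=> //; first exact: mem_head.
  move=> z; rewrite inE => /orP[/eqP ->//|zL z0].
  by apply: le_trans (ymin _ zL z0); rewrite -le.
split=> //; first by rewrite inE yL orbT.
move=> z; rewrite inE => /orP[/eqP -> _|]; last exact: ymin.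
by apply: ltW; rewrite ltNge -le.
Qed.

Lemma hits_filter x z U : (hits z [seq S <- U | ~~ hit x S] <= hits z U)%N.
Proof. by rewrite /hits count_filter; apply: sub_count => S /= /andP[]. Qed.

(* Dual fitting: [y S] is the share of [S] in the price of the link chosen when
   [S] was hit. *)
Lemma greedyP U C n : (size U <= n)%N -> {in U, forall S, has (fun x => hit x S) L} ->
  exists (Xs : seq llink) (y : seq nat -> R),
  [/\ {subset Xs <= L}, (iter n (greedy_step L) (U, C)).2 = [seq x.1 | x <- Xs] ++ C,
      {in U, forall S, has (fun x => hit x S) Xs} /\ (forall S, 0 <= y S),
      \sum_(x <- Xs) price x = \sum_(S <- U) y S &
      {in L, forall x, \sum_(S <- U | hit x S) y S <= price x * H (hits x U)}].
Proof.
elim: n U C => [|n IH] U C.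
  rewrite leqn0 size_eq0 => /eqP -> _; exists [::], (fun=> 0); split=> //.
  - by rewrite !big_nil.
  - by move=> x _; rewrite big_nil /harmonic_sum big_geq// mulr0.
move=> leU hU; rewrite iterSr {2}/greedy_step /=.
have := bestP U; case E : (best U L) => [|x b].
  move=> h0; have U0 : U = [::].
    case: U hU h0 {leU E} => // S U hU h0.
    have /hasP[x xL hx] := hU S (mem_head _ _).
    by have := h0 x xL; rewrite /hits /= hx.
  by have := IH U C; rewrite U0; apply.
case=> xL x0 xmin; set U' := [seq S <- U | ~~ hit x S].
have sizeU' : (size U' + hits x U = size U)%N.
  by rewrite size_filter /hits addnC count_predC.
have hU' : {in U', forall S, has (fun x => hit x S) L}.
  by move=> S; rewrite mem_filter => /andP[_ /hU].
have [|Xs [y [sX EX [hX y0] sumX dual]]] := IH U' (x.1 :: C) _ hU'.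
  by rewrite -ltnS (leq_trans _ leU)// -sizeU' -addn1 leq_add2l.
pose p := price x / (hits x U)%:R.
have p0 : 0 <= p by rewrite divr_ge0 ?price_ge0.
pose y' S := if hit x S then p else y S.
have sumU (Q : pred (seq nat)) : \sum_(S <- U | Q S) y' S =
    (count (fun S => hit x S && Q S) U)%:R * p + \sum_(S <- U' | Q S) y S.
  rewrite (bigID (hit x)) /=; congr (_ + _).
    rewrite (eq_bigr (fun=> p)) => [|S /andP[_ hS]]; last by rewrite /y' hS.
    rewrite big_const_seq iter_addr_0 mulr_natl; congr (_ *+ _).
    by apply: eq_count => S; rewrite andbC.
  rewrite /U' big_filter_cond; apply: eq_big => [S|S /andP[_ hS]]; first by rewrite andbC.
  by rewrite /y' (negbTE hS).
exists (rcons Xs x), y'; split.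
- by move=> z; rewrite mem_rcons inE => /orP[/eqP ->//|/sX].
- by rewrite EX map_rcons cat_rcons.
- split; last by move=> S; rewrite /y'; case: ifP.
  move=> S SU; rewrite has_rcons; have [//|hS] := boolP (hit x S).
  by rewrite hX ?orbT// mem_filter hS.
- rewrite -cats1 big_cat big_seq1 sumX (sumU xpredT) addrC; congr (_ + _).
  rewrite (eq_count (a2 := hit x)) => [|S]; last by rewrite andbT.
  by rewrite /p mulrCA divff ?mulr1// pnatr_eq0 -lt0n.
- move=> z zL; rewrite sumU; have [z0|z0] := posnP (hits z U).
    have z0' : hits z U' = 0%N by apply/eqP; rewrite -leqn0 -z0 hits_filter.
    have -> : count (fun S => hit x S && hit z S) U = 0%N.
      apply/eqP; rewrite -leqn0 -z0; apply: sub_count => S /andP[_]; exact.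
    by rewrite mul0r add0r z0 -z0'; exact: dual.
  have cnt : (count (fun S => hit x S && hit z S) U + hits z U' = hits z U)%N.
    rewrite /hits /U' count_filter -[RHS]size_filter -(count_predC (hit x) [seq S <- U | hit z S]).
    by rewrite !count_filter; congr (_ + _)%N; apply: eq_count => S /=; rewrite andbC.
  (* The sides of [z] that are hit in this round are charged the ratio of [x], which is at most that
     of [z] because [x] was chosen as best. The induction hypothesis covers the other sides of [z],
     and the harmonic sum absorbs both. *)
  apply: le_trans (_ : (hits z U - hits z U')%:R * (price z / (hits z U)%:R) + price z * H (hits z U') <= _).
    apply: lerD; last exact: dual.
    rewrite (_ : count _ U = (hits z U - hits z U')%N); last by rewrite -cnt addnK.
    by apply: ler_wpM2l; [exact: ler0n|exact: xmin].
  rewrite mulrCA -mulrDr ler_wpM2l ?price_ge0// addrC.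
  by apply: harmonic_sum_step; rewrite -cnt leq_addl.
Qed.
End Greedy.

(** * Feasible solutions as hitting sets *)

Section Feasibility.
Variable P : instance.
Hypothesis wfP : well_formed P.
Local Notation V := 'I_(nodes P).
Local Notation link := 'I_(size (links P)).
Local Notation dcut := (cut_size (edges P) (cap P)).
Implicit Types (X : {set V} * {set V}) (I : {set link}) (i : link).

Lemma cut_size_cat (E F : seq (V * V)) X :
  cut_size (E ++ F) (cap P) X = cut_size E (cap P) X + count (fun e => covers e X) F.
Proof. by rewrite /cut_size count_cat addnA. Qed.

Lemma feasible_covers I X : feasible I -> tight X -> exists2 i, i \in I & covers (ends i) X.
Proof.
move=> fI /(tightP wfP)[d dP [bX cX lX]].
have dn := demand_neq wfP dP.
have le : req d <= dcut X + count (fun e => covers e X) [seq ends i | i <- enum I].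
  apply: leq_trans (fI d dP) _; rewrite -cut_size_cat.
  move: cX; rewrite covers_separates// => /orP[sX|sX]; first exact: max_flow_le.
  by rewrite /lambda max_flowC//; apply: max_flow_le; rewrite // eq_sym.
have : has (fun e => covers e X) [seq ends i | i <- enum I] by rewrite has_count; lia.
by rewrite has_map => /hasP[i]; rewrite mem_enum; exists i.
Qed.

Lemma covers_feasible I :
  (forall X, tight X -> exists2 i, i \in I & covers (ends i) X) -> feasible I.
Proof.
move=> cov d dP; have dn := demand_neq wfP dP.
apply: max_flow_cut => // X sX; rewrite cut_size_cat -/(req d).
have bX : is_biset X by case/and3P: sX.
have cX : covers d X by rewrite covers_separates// sX.
case: (ltnP (dcut X) (req d)) => [lt|le]; last exact: leq_trans le (leq_addr _ _).
have tX : tight X by apply/(tightP wfP); exists d.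
have [i iI ci] := cov X tX; have le := req_le_cut wfP dP bX cX.
apply: leq_trans le _; rewrite -addn1 leq_add2l -has_count has_map.
by apply/hasP; exists i; rewrite ?mem_enum.
Qed.

Lemma link_incident i : incident (Defs.root P) (ends i).
Proof.
by case/and4P: wfP => _ _ /allP/(_ _ (mem_tnth i (in_tuple (links P))))/and3P[].
Qed.

Lemma link_cost_ge0 i : (0 <= cost i)%R.
Proof.
by case/and4P: wfP => _ _ /allP/(_ _ (mem_tnth i (in_tuple (links P))))/and3P[].
Qed.

Lemma covers_link i X : is_biset X -> Defs.root P \notin X.2 ->
  covers (ends i) X = ((ends i).1 \in X.1) || ((ends i).2 \in X.1).
Proof.
move=> bX aX; have aX1 := contra (subsetP bX _) aX.
have := link_incident i; rewrite /covers /incident => /orP[] /eqP ->.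
  by rewrite aX (negbTE aX1) andbT.
by rewrite aX (negbTE aX1) andbT orbF.
Qed.

(** The programs work on natural numbers, so ordinals and rationals are replaced by numbers. The
    encoding of the raw instance is literally that of [P]. *)
Definition raw_edge (e : V * V) : nat * nat := (val e.1, val e.2).
Definition raw_cost (c : rat) : nat * nat := (`|numq c|, `|denq c|)%N.
Definition raw_of : raw_instance :=
  (map raw_edge (edges P), ([seq cap P w | w <- enum V], (val (Defs.root P),
    ([seq (raw_edge l.1, raw_cost l.2) | l <- links P], map raw_edge (demands P))))).

Lemma enc_seq_map (T U : Type) (f : U -> tree) (g : T -> U) s :
  enc_seq f (map g s) = enc_seq (fun x => f (g x)) s.
Proof. by elim: s => //= x s ->. Qed.

Lemma enc_raw_of : enc raw_of = enc_instance P.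
Proof.
congr (Branch _ (Branch _ (Branch _ (Branch _ _)))); exact: enc_seq_map.
Qed.

Definition llink_of i : llink := (val i, (raw_edge (ends i), raw_cost (cost i))).

Lemma labelE k l : label k l = zip (iota k (size l)) l.
Proof. by elim: l k => //= x l IH k; rewrite IH. Qed.

Lemma label_links : label 0 raw_of.2.2.2.1 = [seq llink_of i | i <- enum 'I_(size (links P))].
Proof.
have E : raw_of.2.2.2.1 = [seq (raw_edge (ends i), raw_cost (cost i)) | i <- enum link].
  transitivity [seq (raw_edge l.1, raw_cost l.2) | l <-
    [seq tnth (in_tuple (links P)) i | i <- enum link]]; first by rewrite map_tnth_enum.
  by rewrite -map_comp.
by rewrite labelE E size_map size_enum_ord -val_enum_ord zip_map.
Qed.

Lemma llink_of_inj : injective llink_of.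
Proof. by move=> i j [/val_inj]. Qed.

Lemma hit_covers i S X : is_biset X -> Defs.root P \notin X.2 -> X.1 = node_set P S ->
  hit (llink_of i) S = covers (ends i) X.
Proof. by move=> bX aX X1; rewrite covers_link// X1 !inE. Qed.

(** Sides avoid the root, so a link hits a side only through its other end. *)
Lemma hits_le i : exists w : V,
  hits (llink_of i) (instance_sides P) = count (fun S => val w \in S) (instance_sides P).
Proof.
exists (if (ends i).1 == Defs.root P then (ends i).2 else (ends i).1).
apply: eq_in_count => S SU; have [[X [tX aX X1]] _] := instance_sides_tight wfP SU.
have /tightP[//|d _ [bX _ _]] := tX.
have : val (Defs.root P) \notin S.
  by apply: contra aX => aS; apply: (subsetP bX); rewrite X1 inE.
have := link_incident i; rewrite /hit /incident /=; case: eqP => [-> _ /negbTE -> //|_ /= /eqP ->].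
by move=> /negbTE ->; rewrite orbF.
Qed.

End Feasibility.

Local Open Scope ring_scope.

(** * The approximation guarantee *)

Section Approximation.
Variables (R : realType) (P : instance).
Hypothesis wfP : well_formed P.
Hypothesis feasP : feasible_instance P.
Local Notation V := 'I_(nodes P).
Local Notation link := 'I_(size (links P)).
Local Notation U := (instance_sides P).
Local Notation L := [seq llink_of i | i <- enum link].

Lemma price_llink_of (i : link) : price R (llink_of i) = ratr (cost i).
Proof.
rewrite /price /= /ratr -[in RHS](gez0_abs (_ : 0 <= numq (cost i))).
  by rewrite -[in RHS](gez0_abs (denq_ge0 (cost i))).
by rewrite numq_ge0 link_cost_ge0.
Qed.

Lemma sides_hit : {in U, forall S, has (fun x => hit x S) L}.
Proof.
move=> S SU; have [[X [tX aX X1]] _] := instance_sides_tight wfP SU.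
have [I0 fI0] := feasP; have [i _ ci] := feasible_covers wfP fI0 tX.
have /tightP[//|d _ [bX _ _]] := tX.
apply/hasP; exists (llink_of i); first by rewrite map_f ?mem_enum.
by rewrite (hit_covers wfP i bX aX X1).
Qed.

Lemma fractional_cover_exists : (@fractional_cover P R !=set0)%classic.
Proof.
have [I0 fI0] := feasP; exists (\row_i (i \in I0)%:R); split=> [i|Y tY].
  by rewrite mxE; case: (i \in I0); rewrite /= ?lexx ler01.
have [i iI ci] := feasible_covers wfP fI0 tY.
rewrite (bigD1 i)//= mxE iI lerDl; apply: sumr_ge0 => j _; rewrite mxE; exact: ler0n.
Qed.

(** Only an inequality, since [Xs] is a list that might repeat links; further terms are
    nonnegative. *)
Lemma total_cost_le (I : {set link}) (Xs : seq llink) : {subset Xs <= L} ->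
  {in I, forall i, llink_of i \in Xs} ->
  ratr (total_cost I) <= \sum_(x <- Xs) price R x.
Proof.
move=> sX IX; rewrite /total_cost rmorph_sum /=.
apply: (@le_trans _ _ (\sum_(i | llink_of i \in Xs) price R (llink_of i))).
  rewrite big_mkcond [leRHS]big_mkcond; apply: ler_sum => i _.
  have [iI|_] := boolP (i \in I); first by rewrite (IX i iI) price_llink_of.
  by case: ifP => // _; exact: price_ge0.
elim: Xs sX {IX} => [|x Xs IH] sX; first by rewrite big_nil big_pred0.
have sX' : {subset Xs <= L} by move=> z zX; apply: sX; rewrite inE zX orbT.
rewrite big_cons; have /mapP[j _ xE] := sX x (mem_head _ _).
have [jX|jX] := boolP (x \in Xs).
  apply: le_trans (le_trans (IH sX') _); last by rewrite lerDr price_ge0.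
  rewrite le_eqVlt; apply/orP; left; apply/eqP; apply: eq_bigl => i.
  by rewrite inE; case: eqP => [->|].
rewrite (bigD1 j) -?xE ?mem_head//= lerD2l; apply: le_trans (IH sX').
rewrite le_eqVlt; apply/orP; left; apply/eqP; apply: eq_bigl => i.
rewrite inE xE (inj_eq (@llink_of_inj P)); case: eqP => [->|_] /=; last by rewrite andbT.
by rewrite -xE (negbTE jX).
Qed.

Lemma greedy_approx : let C := greedy L U in let I := [set i : link | val i \in C] in
  feasible I /\ forall D, (forall w : V, count (fun S => val w \in S) U <= D)%N ->
    ratr (total_cost I) <= harmonic_sum R D * tau_star P R.
Proof.
move=> C I.
have den_gt0 : {in L, forall x, 0 < x.2.2.2}%N.
  by move=> _ /mapP[i _ ->] /=; rewrite absz_gt0 denq_neq0.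
have [Xs [y [sX EX [hX y0] sumX dual]]] := greedyP R den_gt0 [::] (leqnn _) sides_hit.
rewrite -foldr_iter -/(greedy L U) -/C cats0 in EX.
have memI i : (i \in I) = (llink_of i \in Xs).
  rewrite inE EX; apply/mapP/idP => [[x xX]|h]; last by exists (llink_of i).
  by have /mapP[j _ xE] := sX _ xX; rewrite xE => /val_inj ->; rewrite -xE.
split.
  apply: (covers_feasible wfP) => Y tY.
  have cov X : tight X -> Defs.root P \notin X.2 -> exists2 i, i \in I & covers (ends i) X.
    move=> tX aX; have [S SU SX] := instance_sides_below wfP tX aX.
    have /hasP[x xX hx] := hX S SU; have /mapP[i _ xE] := sX x xX.
    exists i; first by rewrite memI -xE.
    have /tightP[//|d _ [bX _ _]] := tX.
    rewrite (covers_link wfP)//; move: hx; rewrite xE => /orP[] h; apply/orP.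
      by left; apply: (fintype.subsetP SX); rewrite inE.
    by right; apply: (fintype.subsetP SX); rewrite inE.
  (* Feasibility supplies a link that covers [Y]. Its end at the root is then not in the boundary,
     so the root is outside the outer part of [Y] or of its complement. *)
  have [I0 fI0] := feasP; have [i0 _ ci0] := feasible_covers wfP fI0 tY.
  have /tightP[//|d _ [bY _ _]] := tY.
  have := incident_not_boundary bY ci0 (link_incident wfP i0).
  rewrite inE negb_and negbK => /orP[aY|]; last exact: cov.
  have [|//|i iI ci] := cov (bisetC Y); first by rewrite tight_bisetC.
    by rewrite inE negbK.
  by exists i; rewrite // -covers_bisetC.
move=> D hD; have [x [x01 xcov] [<- _]] := tau_star_min fractional_cover_exists.
apply: (@le_trans _ _ (\sum_(z <- Xs) price R z)).
  by apply: total_cost_le => // i; rewrite memI.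
rewrite sumX.
(* Weak duality with the shares [y]: every side receives total weight at least 1 from [x].
   Exchanging the sums gathers at each link the shares of the sides it hits, which amount to at most
   [harmonic_sum R D] times its cost. *)
apply: (@le_trans _ _ (\sum_(S <- U) y S * \sum_(i | hit (llink_of i) S) x 0 i)).
  rewrite big_seq [leRHS]big_seq; apply: ler_sum => S SU.
  rewrite ler_peMr//; have [[X [tX aX X1]] _] := instance_sides_tight wfP SU.
  apply: le_trans (xcov X tX) _; have /tightP[//|d _ [bX _ _]] := tX.
  by rewrite (eq_bigl (fun i => hit (llink_of i) S))// => i; rewrite (hit_covers wfP i bX aX X1).
under eq_bigr do rewrite big_distrr big_mkcond /=.
rewrite exchange_big /fractional_cost big_distrr /=; apply: ler_sum => i _.
have xi0 : 0 <= x 0 i by have /andP[] := x01 i.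
rewrite -big_mkcond -big_distrl /= mulrA ler_wpM2r//.
have iL : llink_of i \in L by rewrite map_f ?mem_enum.
apply: le_trans (dual _ iL) _; rewrite price_llink_of mulrC ler_wpM2r//.
  by rewrite ler0q link_cost_ge0.
by apply: harmonic_sum_le; have [w ->] := hits_le wfP i.
Qed.

End Approximation.

Theorem theorem6 (R : realType) :
  exists (A : program) (T : {poly nat}),
    forall P : instance, well_formed P ->
    exists (output : tree) (n : nat),
      [/\ runs A (enc_instance P) output n,
          (n <= T.[tree_size (enc_instance P)])%N
        & feasible_instance P ->
          exists2 I : {set 'I_(size (links P))},
            output = enc_solution I &
            [/\ feasible I,
                ratr (total_cost I) <=
                  harmonic_sum R ((4 * kmax P - 3) ^ 2)%N * tau_star P R
              & star_at_root P ->
                ratr (total_cost I) <=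
                  harmonic_sum R (2 * kmax P - 1)%N * tau_star P R]].
Proof.
have [A [c hA]] := ptime_program ptime_solve.
exists A, (('X + 1) ^+ c) => P wfP.
have [n [run le]] := hA (raw_of P); rewrite enc_raw_of in run le.
exists (enc (solve (raw_of P))), n; split=> //.
  by rewrite horner_exp !hornerE natrXE natrDE addn1.
move=> feasP; have [fI approx] := greedy_approx R wfP feasP.
exists [set i | val i \in greedy [seq llink_of i | i <- enum 'I_(size (links P))] (instance_sides P)].
  rewrite /solve label_links /enc_solution -map_comp; congr enc_seq.
  by apply: eq_map => i /=; rewrite inE.
split=> // [|star_P]; apply: approx => w.
  by have [] := count_sides wfP w.
by have [_] := count_sides wfP w; apply.
Qed.
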